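(* Let $(M^{d},\boldsymbol{c},\sigma)$, $d=n+1\ge3$, be an almost pseudo-Riemannian structure with $\sigma$ a defining density for a hypersurface $\Sigma$ and $I^2$ nowhere zero. Let $\mathcal{E}^\Phi$ be any tractor bundle, $w_0\in\mathbb{R}$, $h_0:=d+2w_0$, and $f_0\in\Gamma(\mathcal{E}^\Phi[w_0])$. Let $\ell\in\mathbb{Z}_{\ge0}$ and let $f^{(\ell)}=f_0+\sigma f_1+\cdots+\sigma^{\ell}f_\ell+O(\sigma^{\ell+1})$, with $f_i\in\Gamma(\mathcal{E}^\Phi[w_0-i])$, be a solution to order $\ell$ of the extension problem, i.e. $I\cdot Df^{(\ell)}=O(\sigma^\ell)$. Then, provided $\ell\neq h_0-2=n+2w_0-1$, there is an extension $$f^{(\ell+1)}=f^{(\ell)}+\sigma^{\ell+1}f_{\ell+1},$$ unique modulo $\sigma^{\ell+2}$, which solves $I\cdot Df^{(\ell+1)}=0$ modulo $O(\sigma^{\ell+1})$. If $\ell=h_0-2$, then the extension is obstructed by $P_{\ell+1}f_0|_\Sigma$, where $P_{\ell+1}=\big(-\frac1{I^2}I\cdot D\big)^{\ell+1}$ acting on $\mathcal{E}^\Phi[w_0]$ (a tangential operator along $\Sigma$); that is, such an extension exists if and only if $P_{\ell+1}f_0|_\Sigma=0$.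
   Context: All objects are smooth. A conformal manifold $(M^d,\boldsymbol{c})$ is a manifold with a conformal class of metrics of fixed signature. $\mathcal{E}[w]$ is the bundle of conformal densities of weight $w$ (a section is a family of functions $(f^g)_{g\in\boldsymbol{c}}$ with $f^{\Omega^2g}=\Omega^wf^g$). $\mathbf{g}=\sigma_g^2g$ is the conformal metric, with $\sigma_g\in\Gamma(\mathcal{E}[1])$ represented by $1$ in the scale $g$. For $g\in\boldsymbol{c}$, the Levi-Civita connection acts on $\mathcal{E}[w]$ by $\nabla\tau=\sigma_g^wd(\sigma_g^{-w}\tau)$; $P_{ab}$ is the Schouten tensor, $\mathrm{Ric}=(d-2)P+J\mathbf{g}$, $J=\mathbf{g}^{ab}P_{ab}$. The standard tractor bundle $\mathcal{T}=\mathcal{E}_A$ is identified by $g$ with $\mathcal{E}[1]\oplus T^*M[1]\oplus\mathcal{E}[-1]$; for $\widehat g=\Omega^2g$, $\Upsilon=\Omega^{-1}d\Omega$: $\widehat\sigma=\sigma$, $\widehat\mu_b=\mu_b+\Upsilon_b\sigma$, $\widehat\rho=\rho-\Upsilon^b\mu_b-\frac12\Upsilon^b\Upsilon_b\sigma$. Tractor connection: $\nabla_a(\sigma,\mu_b,\rho)=(\nabla_a\sigma-\mu_a,\nabla_a\mu_b+\mathbf{g}_{ab}\rho+P_{ab}\sigma,\nabla_a\rho-P_{ab}\mu^b)$. Tractor metric: $h=2\sigma\rho+\mathbf{g}^{ab}\mu_a\mu_b$ (quadratic form), used to raise/lower tractor indices. A tractor bundle $\mathcal{E}^\Phi$ is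 a (sub)bundle of tensor powers of $\mathcal{T}$ with the induced connection; $\mathcal{E}^\Phi[w]=\mathcal{E}^\Phi\otimes\mathcal{E}[w]$, and $\nabla$ below is the coupled tractor–Levi-Civita connection, $\Delta=\mathbf{g}^{ab}\nabla_a\nabla_b$. The Thomas-D operator $D_A:\mathcal{E}^\Phi[w]\to\mathcal{E}_A\otimes\mathcal{E}^\Phi[w-1]$ is the conformally invariant operator $D_AV\stackrel{g}{=}((d+2w-2)wV,\ (d+2w-2)\nabla_aV,\ -(\Delta V+wJV))$. For $\sigma\in\Gamma(\mathcal{E}[1])$, $I_A=\frac1dD_A\sigma\stackrel{g}{=}(\sigma,\nabla_a\sigma,-\frac1d(\Delta\sigma+J\sigma))$ is the scale tractor, $I^2=I^AI_A$, and $I\cdot D:=I^AD_A:\mathcal{E}^\Phi[w]\to\mathcal{E}^\Phi[w-1]$. Almost pseudo-Riemannian means $I$ is nowhere zero. $\sigma$ is a defining density for $\Sigma$ if $\Sigma=\mathcal{Z}(\sigma)$ and $\nabla^g\sigma$ is nonzero (here also nowhere null) at every point of $\Sigma$. One works locally on the side of $\Sigma$ where $\sigma\ge0$, near $\Sigma$. $O(\sigma^k)$ denotes $\sigma^k$ times a smooth section. An operator $P$ is tangential along $\Sigma$ if $P\circ\sigma=\sigma\circ\widetilde P$ for some linear operator $\widetilde P$, so that $(Pf)|_\Sigma$ depends only on $f|_\Sigma$. *)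

(* Defs.v *)
From HB Require Import structures.
From mathcomp Require Import all_boot all_order all_algebra.
From mathcomp Require Import all_classical all_reals all_analysis.
From mathcomp Require Import ring.

Set Implicit Arguments.
Unset Strict Implicit.
Unset Printing Implicit Defensive.

Import Order.TTheory GRing.Theory Num.Theory.
Import numFieldNormedType.Exports.

Local Open Scope classical_set_scope.
Local Open Scope ring_scope.

Section smooth_on.
Context {R : realType} {d : nat}.
Local Notation V := 'rV[R]_d.

Definition pderiv (i : 'I_d) (f : V -> R) : V -> R :=
  fun x => 'D_(delta_mx 0 i) f x.

(* C^oo on an open set: every iterated partial derivative is (Frechet)
   differentiable at every point *)
Definition smooth_on (U : set V) (f : V -> R) :=
  forall (s : seq 'I_d) x, U x -> differentiable (foldr pderiv f s) x.

Lemma near_eq_differentiable (f g : V -> R) x :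
  (\near x, f x = g x) -> differentiable f x -> differentiable g x.
Proof.
move=> fg df.
have E : g \o shift x = cst (g x) + 'd f x +o_ 0 id.
  have fgx : f x = g x by exact: nbhs_singleton fg.
  have /eqaddoP H := diff_locally df.
  apply/eqaddoP => _/posnumP[e]; have := H _ [gt0 of e%:num].
  have : \forall y \near (0 : V), f (y + x) = g (y + x).
    by move: fg; rewrite (near_shift 0) subr0.
  apply: filter_app2; near=> y => fgy.
  by rewrite !fctE /= fgy fgx.
have dg : 'd g x = 'd f x :> (V -> R).
  by apply: diff_unique E; exact: diff_continuous.
apply/diff_locallyP; split; last by rewrite dg.
by rewrite dg; exact: diff_continuous.
Unshelve. all: by end_near. Qed.

(* A class of functions that is differentiable on U and stable under partial
   derivatives, up to equality on U, consists of smooth functions. *)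
Lemma smooth_on_coind (U : set V) (C : set (V -> R)) : open U ->
  (forall f, C f -> forall x, U x -> differentiable f x) ->
  (forall f i, C f -> exists2 h, C h & {in U, pderiv i f =1 h}) ->
  forall f, C f -> smooth_on U f.
Proof.
move=> oU Cd Cp f Cf s.
suff [h Ch hE] : exists2 h, C h & {in U, foldr pderiv f s =1 h}.
  move=> x Ux; apply: near_eq_differentiable (Cd _ Ch _ Ux).
  have : nbhs x U by exact: open_nbhs_nbhs.
  by apply: filterS => y Uy; rewrite hE ?inE.
elim: s => [|i s [h Ch hE]] /=; first by exists f.
have [k Ck kE] := Cp h i Ch; exists k => // x Ux.
rewrite -kE // /pderiv; apply: near_eq_derive.
have : nbhs x U by apply: open_nbhs_nbhs; split => //; rewrite inE in Ux.
by apply: filterS => y Uy; rewrite hE ?inE.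
Qed.

Lemma smooth_on_pderiv U f i : smooth_on U f -> smooth_on U (pderiv i f).
Proof. by move=> Sf s; have := Sf (rcons s i); rewrite foldr_rcons. Qed.

Lemma smooth_on_diff U f x : smooth_on U f -> U x -> differentiable f x.
Proof. by move=> Sf; exact: (Sf [::]). Qed.

Lemma smooth_on_cst U (a : R) : open U -> smooth_on U (cst a).
Proof.
move=> oU; apply: (@smooth_on_coind _ [set h | exists b, h = cst b]) => //.
- by move=> _ [b ->] x _; exact: differentiable_cst.
- move=> _ i [b ->]; exists (cst 0); first by exists 0.
  by move=> x _; rewrite /pderiv derive_cst.
- by exists a.
Qed.

Lemma smooth_onB U f g : open U ->
  smooth_on U f -> smooth_on U g -> smooth_on U (f - g).
Proof.
move=> oU Sf Sg; apply: (@smooth_on_coind _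
  [set h | exists f g, [/\ smooth_on U f, smooth_on U g & h = f - g]]) => //.
- move=> _ [{Sf}f [{Sg}g [Sf Sg ->]]] x Ux.
  by apply: differentiableB; exact: smooth_on_diff Ux.
- move=> _ i [{Sf}f [{Sg}g [Sf Sg ->]]].
  exists (pderiv i f - pderiv i g).
    by exists (pderiv i f), (pderiv i g); split => //; exact: smooth_on_pderiv.
  move=> x; rewrite inE => Ux; rewrite /pderiv deriveB //;
    by apply: diff_derivable; exact: smooth_on_diff Ux.
- by exists f, g.
Qed.

Inductive prodsum U : (V -> R) -> Prop :=
| prodsumM f g : smooth_on U f -> smooth_on U g -> prodsum U (f * g)
| prodsumD f g : prodsum U f -> prodsum U g -> prodsum U (f + g).

Lemma smooth_onM U f g : open U ->
  smooth_on U f -> smooth_on U g -> smooth_on U (f * g).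
Proof.
move=> oU Sf Sg.
have dC h : prodsum U h -> forall x, U x -> differentiable h x.
  elim=> [{Sf}f {Sg}g Sf Sg|f1 f2 _ d1 _ d2] x Ux.
    by apply: differentiableM; exact: smooth_on_diff Ux.
  by apply: differentiableD; [exact: d1|exact: d2].
apply: (@smooth_on_coind U (prodsum U)) => //; last by constructor.
move=> h i; elim=> [{Sf}f {Sg}g Sf Sg|f1 f2 C1 [h1 Ch1 E1] C2 [h2 Ch2 E2]].
    exists (f * pderiv i g + g * pderiv i f).
      by constructor; constructor => //; exact: smooth_on_pderiv.
    move=> x; rewrite inE => Ux; rewrite /pderiv deriveM //;
      by apply: diff_derivable; exact: smooth_on_diff Ux.
  exists (h1 + h2); first by constructor.
  move=> x Ux; rewrite -[RHS]/(h1 x + h2 x) -(E1 x Ux) -(E2 x Ux).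
  by move: Ux; rewrite inE /pderiv => Ux; rewrite deriveD //; apply: diff_derivable; exact: dC Ux.
Qed.

End smooth_on.

Section manifold.
Variables (R : realType) (d : nat).
Local Notation V := 'rV[R]_d.

Record chart (T : topologicalType) := Chart {
  cdom : set T;
  cimg : set V;
  cmap : T -> V;
  cinv : V -> T;
  cdom_open : open cdom;
  cimg_open : open cimg;
  cmapP : forall x, cdom x -> cimg (cmap x);
  cinvP : forall y, cimg y -> cdom (cinv y);
  cmapK : forall x, cdom x -> cinv (cmap x) = x;
  cinvK : forall y, cimg y -> cmap (cinv y) = y;
  cmap_cont : forall x, cdom x -> {for x, continuous cmap};
  cinv_cont : forall y, cimg y -> {for y, continuous cinv} }.

Arguments cdom_open {T} c : rename.
Arguments cimg_open {T} c : rename.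

Record manifold := Manifold {
  mcarrier :> topologicalType;
  atlas : set (chart mcarrier);
  manifold_hausdorff : hausdorff_space mcarrier;
  manifold_countable : @second_countable mcarrier;
  atlas_cover : forall x, exists2 c, atlas c & cdom c x;
  atlas_smooth : forall c c', atlas c -> atlas c' -> forall i,
    smooth_on (cimg c `&` cinv c @^-1` cdom c')
              (fun y => cmap c' (cinv c y) 0 i) }.

Variable M : manifold.

Definition smooth (f : M -> R) :=
  forall c, atlas c -> smooth_on (cimg c) (f \o cinv c).

Definition smooth_pred : {pred M -> R} := fun f => `[< smooth f >].

Lemma smooth_pred_subring : subring_closed smooth_pred.
Proof.
split.
- by apply/asboolP => c _; exact/smooth_on_cst/cimg_open.
- move=> f g /asboolP Sf /asboolP Sg; apply/asboolP => c Ac.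
  have -> : (f - g) \o cinv c = (f \o cinv c) - (g \o cinv c) by [].
  exact: smooth_onB (cimg_open c) (Sf c Ac) (Sg c Ac).
- move=> f g /asboolP Sf /asboolP Sg; apply/asboolP => c Ac.
  have -> : (f * g) \o cinv c = (f \o cinv c) * (g \o cinv c) by [].
  exact: smooth_onM (cimg_open c) (Sf c Ac) (Sg c Ac).
Qed.

Record smf := Smf { smf_fun :> M -> R; smf_smooth : smf_fun \in smooth_pred }.

HB.instance Definition _ := [isSub for smf_fun].
HB.instance Definition _ := [Choice of smf by <:].
HB.instance Definition _ := GRing.isSubringClosed.Build (M -> R) smooth_pred
  smooth_pred_subring.
HB.instance Definition _ :=
  GRing.SubChoice_isSubComPzRing.Build (M -> R) _ smf (subringClosedP _).

Lemma smf_eqP (f g : smf) : (forall x, f x = g x) -> f = g.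
Proof. by move=> fg; apply/val_inj/funext. Qed.

Fact smf_cst_subproof (a : R) : cst a \in smooth_pred.
Proof. by apply/asboolP => c _; exact/smooth_on_cst/cimg_open. Qed.

Definition smf_cst (a : R) : smf := Smf (smf_cst_subproof a).
Local Notation "a %:S" := (smf_cst a) (at level 1, format "a %:S").

(* meant for nowhere vanishing f *)
Definition smf_inv (f : smf) : smf := xget 0 [set h | f * h = 1].

(* Smooth vector fields, as derivations of the algebra of smooth functions. *)
Record vfield := VField {
  vf_fun :> smf -> smf;
  vf_linear : forall a f h, vf_fun (a%:S * f + h) = a%:S * vf_fun f + vf_fun h;
  vf_leibniz : forall f h, vf_fun (f * h) = vf_fun f * h + f * vf_fun h }.

Lemma vfield_eqP (X Y : vfield) : (forall f, X f = Y f) -> X = Y.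
Proof.
case: X Y => [X lX dX] [Y lY dY] /= /funext XY; subst Y.
by congr VField; exact: Prop_irrelevance.
Qed.

Fact vf_zero_linear a (f h : smf) : (0 : smf) = a%:S * 0 + 0.
Proof. by rewrite mulr0 addr0. Qed.
Fact vf_zero_leibniz (f h : smf) : (0 : smf) = 0 * h + f * 0.
Proof. by rewrite mulr0 mul0r addr0. Qed.
Definition vf_zero := VField vf_zero_linear vf_zero_leibniz.

Fact vf_add_linear (X Y : vfield) a f h :
  X (a%:S * f + h) + Y (a%:S * f + h) = a%:S * (X f + Y f) + (X h + Y h).
Proof. by rewrite !vf_linear; ring. Qed.
Fact vf_add_leibniz (X Y : vfield) f h :
  X (f * h) + Y (f * h) = (X f + Y f) * h + f * (X h + Y h).
Proof. by rewrite !vf_leibniz; ring. Qed.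
Definition vf_add X Y := VField (vf_add_linear X Y) (vf_add_leibniz X Y).

Fact vf_scale_linear (u : smf) (X : vfield) a f h :
  u * X (a%:S * f + h) = a%:S * (u * X f) + u * X h.
Proof. by rewrite vf_linear; ring. Qed.
Fact vf_scale_leibniz (u : smf) (X : vfield) f h :
  u * X (f * h) = (u * X f) * h + f * (u * X h).
Proof. by rewrite vf_leibniz; ring. Qed.
Definition vf_scale u X := VField (vf_scale_linear u X) (vf_scale_leibniz u X).

Fact vf_bracket_linear (X Y : vfield) a f h :
  X (Y (a%:S * f + h)) - Y (X (a%:S * f + h)) =
  a%:S * (X (Y f) - Y (X f)) + (X (Y h) - Y (X h)).
Proof. by rewrite !vf_linear; ring. Qed.
Fact vf_bracket_leibniz (X Y : vfield) f h :
  X (Y (f * h)) - Y (X (f * h)) =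
  (X (Y f) - Y (X f)) * h + f * (X (Y h) - Y (X h)).
Proof.
have D (Z : vfield) u v : Z (u + v) = Z u + Z v.
  by have := vf_linear Z 1 u v; rewrite (_ : 1%:S = 1) ?mul1r //; exact: val_inj.
by rewrite !vf_leibniz !D !vf_leibniz; ring.
Qed.
Definition vf_bracket X Y :=
  VField (vf_bracket_linear X Y) (vf_bracket_leibniz X Y).

HB.instance Definition _ := gen_eqMixin vfield.
HB.instance Definition _ := gen_choiceMixin vfield.

Fact vf_addA : associative vf_add.
Proof. by move=> X Y Z; apply: vfield_eqP => f /=; ring. Qed.
Fact vf_addC : commutative vf_add.
Proof. by move=> X Y; apply: vfield_eqP => f /=; ring. Qed.
Fact vf_add0 : left_id vf_zero vf_add.
Proof. by move=> X; apply: vfield_eqP => f /=; ring. Qed.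
Fact vf_addN : left_inverse vf_zero (vf_scale (-1)) vf_add.
Proof. by move=> X; apply: vfield_eqP => f /=; ring. Qed.

HB.instance Definition _ :=
  GRing.isZmodule.Build vfield vf_addA vf_addC vf_add0 vf_addN.

Fact vf_scaleA u v X : vf_scale u (vf_scale v X) = vf_scale (u * v) X.
Proof. by apply: vfield_eqP => f /=; ring. Qed.
Fact vf_scale1 : left_id 1 vf_scale.
Proof. by move=> X; apply: vfield_eqP => f /=; ring. Qed.
Fact vf_scaleDr : right_distributive vf_scale +%R.
Proof. by move=> u X Y; apply: vfield_eqP => f /=; ring. Qed.
Fact vf_scaleDl X : {morph vf_scale^~ X : u v / u + v}.
Proof. by move=> u v; apply: vfield_eqP => f /=; ring. Qed.

HB.instance Definition _ := GRing.Zmodule_isLmodule.Build smf vfield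
  vf_scaleA vf_scale1 vf_scaleDr vf_scaleDl.

Local Notation bform := (vfield -> vfield -> smf).

Definition form1 (al : vfield -> smf) :=
  forall u X Y, al (u *: X + Y) = u * al X + al Y.

Definition bilinear (B : bform) :=
  (forall Y, form1 (B^~ Y)) /\ (forall X, form1 (B X)).

(* Pseudo-Riemannian metric of signature (p, d - p): it admits an orthonormal
   basis at every point, which makes it nondegenerate. *)
Definition is_metric (g : bform) :=
  [/\ bilinear g, forall X Y, g X Y = g Y X &
    exists2 p, (p <= d)%N & forall x, exists e : 'I_d -> vfield,
      forall i j, g (e i) (e j) x = (-1) ^+ (p <= i)%N *+ (i == j)].

Definition rescaling (Om : smf) (g h : bform) :=
  (forall x, 0 < Om x) /\ (forall X Y, h X Y = Om ^+ 2 * g X Y).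

(* The operations of a pseudo-Riemannian metric.  Each of them exists and is
   uniquely determined by the properties listed: the index-raising isomorphism,
   the contraction B_ab |-> g^ab B_ab (as the C^oo(M)-linear map sending
   al_a be_b to g^ab al_a be_b) and the Levi-Civita connection. *)
Record metric_ops (g : bform) := MetricOps {
  sharp : (vfield -> smf) -> vfield;
  sharpP : forall al, form1 al -> forall X, g (sharp al) X = al X;
  contr : bform -> smf;
  contr_linear : forall u B B', bilinear B -> bilinear B' ->
    contr (fun X Y => u * B X Y + B' X Y) = u * contr B + contr B';
  contr_form1 : forall al be, form1 al -> form1 be ->
    contr (fun X Y => al X * be Y) = al (sharp be);
  lc : vfield -> vfield -> vfield;
  lc_linear : forall u (X Y Z : vfield), lc (u *: X + Y) Z = u *: lc X Z + lc Y Z;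
  lc_add : forall X Y Z : vfield, lc X (Y + Z) = lc X Y + lc X Z;
  lc_leibniz : forall (X : vfield) u (Y : vfield), lc X (u *: Y) = u *: lc X Y + X u *: Y;
  lc_torsion : forall X Y, lc X Y - lc Y X = vf_bracket X Y;
  lc_metric : forall X Y Z : vfield, X (g Y Z) = g (lc X Y) Z + g Y (lc X Z) }.

Section curvature.
Variables (g : bform) (D : metric_ops g).

Definition curv (X Y Z : vfield) : vfield :=
  lc D X (lc D Y Z) - lc D Y (lc D X Z) - lc D (vf_bracket X Y) Z.

Definition ricci : bform := fun Y Z => contr D (fun X W => g (curv X Y Z) W).

(* J and P are obtained by solving Ric = (d - 2) P + J g, J = g^ab P_ab,
   so that Sc = 2 (d - 1) J. *)
Definition schoutenJ : smf := (2 * (d%:R - 1))^-1%:S * contr D ricci.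

Definition schouten : bform :=
  fun X Y => (d%:R - 2)^-1%:S * (ricci X Y - schoutenJ * g X Y).

End curvature.

(* f has non-zero differential at x, in a chart *)
Definition dnonzero (f : M -> R) (x : M) :=
  exists c, [/\ atlas c, cdom c x &
    exists i, pderiv i (f \o cinv c) (cmap c x) != 0].

End manifold.

Notation bform M := (vfield M -> vfield M -> smf M).
Notation "a %:S" := (smf_cst _ a) (at level 1, format "a %:S").

Record conformal (R : realType) (d : nat) := Conformal {
  cmanifold :> manifold R d;
  cclass : set (bform cmanifold);
  cclassP : exists2 g, is_metric g &
    cclass = [set h | exists Om, rescaling Om g h] }.

Section conformal.
Variables (R : realType) (d : nat) (C : conformal R d).

Record scale := Scale {
  scale_form :> vfield C -> vfield C -> smf C;
  scale_in : cclass scale_form }.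

(* A section of E[w] is the family of its representatives, one for each scale;
   likewise for E_A below. *)
Definition density (w : R) (f : scale -> smf C) :=
  forall (g h : scale) Om, rescaling Om g h ->
    forall x, f h x = Om x `^ w * f g x.

Definition triple : Type := (smf C)^o * (vfield C -> (smf C)^o) * (smf C)^o.

HB.instance Definition _ := GRing.Lmodule.on triple.

Definition triple_family : Type := scale -> triple.

HB.instance Definition _ := GRing.Lmodule.on triple_family.

Definition slot_sigma (t : triple) : smf C := t.1.1.
Definition slot_mu (t : triple) : vfield C -> smf C := t.1.2.
Definition slot_rho (t : triple) : smf C := t.2.

(* Representatives of the slots of weights 1, 1, -1.  Here U is the vector
   field Upsilon^a = g^ab Upsilon_b, where Upsilon = Om^-1 dOm. *)
Definition tractor_family (t : scale -> triple) :=
  (forall g, form1 (slot_mu (t g))) /\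
  forall (g h : scale) Om (U : vfield C), rescaling Om g h ->
    (forall X, Om * g U X = X Om) ->
  [/\ slot_sigma (t h) = Om * slot_sigma (t g),
      forall X, slot_mu (t h) X
        = Om * (slot_mu (t g) X + g U X * slot_sigma (t g)) &
      Om * slot_rho (t h) = slot_rho (t g) - slot_mu (t g) U
                            - 2^-1%:S * g U U * slot_sigma (t g)].

Definition tractor_pred : {pred triple_family} :=
  fun t => `[< tractor_family t >].

Lemma slot_sigmaP u t t' :
  slot_sigma (u *: t + t') = u * slot_sigma t + slot_sigma t'.
Proof. by []. Qed.
Lemma slot_muP u t t' X : slot_mu (u *: t + t') X = u * slot_mu t X + slot_mu t' X.
Proof. by []. Qed.
Lemma slot_rhoP u t t' : slot_rho (u *: t + t') = u * slot_rho t + slot_rho t'.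
Proof. by []. Qed.
Let slotP := (slot_sigmaP, slot_muP, slot_rhoP).

Lemma tractor_pred_submod : submod_closed tractor_pred.
Proof.
split.
  have s0 : slot_sigma 0 = 0 by [].
  have m0 X : slot_mu 0 X = 0 by [].
  have r0 : slot_rho 0 = 0 by [].
  apply/asboolP; split=> [g u X Y|g h Om U _ _]; first by rewrite !m0; ring.
  by rewrite s0 r0; split=> [|X|]; rewrite ?m0; ring.
move=> u t t' /asboolP[mt ht] /asboolP[mt' ht']; apply/asboolP; split.
  move=> g v X Y; have E := mt g v X Y; have E' := mt' g v X Y.
  by rewrite !slotP E E'; ring.
move=> g h Om U gh UE.
have [s1 s2 s3] := ht g h Om U gh UE; have [r1 r2 r3] := ht' g h Om U gh UE.
split=> [|X|]; rewrite !slotP.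
- by rewrite s1 r1; ring.
- by rewrite s2 r2; ring.
- by rewrite mulrDr mulrCA s3 r3; ring.
Qed.

Record tractor := Tractor {
  tractor_rep :> scale -> triple;
  tractorP : tractor_rep \in tractor_pred }.

HB.instance Definition _ := [isSub for tractor_rep].
HB.instance Definition _ := [Choice of tractor by <:].

Fact tractor_comb_subproof u (a b : tractor) :
  u *: tractor_rep a + tractor_rep b \in tractor_pred.
Proof. by case: tractor_pred_submod => _; apply; exact: tractorP. Qed.
Definition tractor_comb u (a b : tractor) := Tractor (tractor_comb_subproof u a b).

Definition tractor_zero := Tractor (proj1 tractor_pred_submod).
Definition tractor_add := tractor_comb 1.
Definition tractor_scale u a := tractor_comb u a tractor_zero.
Definition tractor_opp := tractor_scale (-1).

Fact tractor_addA : associative tractor_add.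
Proof. by move=> a b c; apply: val_inj; rewrite /= !scale1r addrA. Qed.
Fact tractor_addC : commutative tractor_add.
Proof. by move=> a b; apply: val_inj; rewrite /= !scale1r addrC. Qed.
Fact tractor_add0 : left_id tractor_zero tractor_add.
Proof. by move=> a; apply: val_inj; rewrite /= scale1r add0r. Qed.
Fact tractor_addN : left_inverse tractor_zero tractor_opp tractor_add.
Proof. by move=> a; apply: val_inj; rewrite /= scale1r addr0 scaleN1r addNr. Qed.

HB.instance Definition _ :=
  GRing.isZmodule.Build tractor tractor_addA tractor_addC tractor_add0 tractor_addN.

Fact tractor_scaleA u v a :
  tractor_scale u (tractor_scale v a) = tractor_scale (u * v) a.
Proof. by apply: val_inj; rewrite /= !addr0 scalerA. Qed.
Fact tractor_scale1 : left_id 1 tractor_scale.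
Proof. by move=> a; apply: val_inj; rewrite /= addr0 scale1r. Qed.
Fact tractor_scaleDr : right_distributive tractor_scale +%R.
Proof. by move=> u a b; apply: val_inj; rewrite /= !addr0 !scale1r scalerDr. Qed.
Fact tractor_scaleDl a : {morph tractor_scale^~ a : u v / u + v}.
Proof. by move=> u v; apply: val_inj; rewrite /= !addr0 !scale1r scalerDl. Qed.

HB.instance Definition _ := GRing.Zmodule_isLmodule.Build (smf C) tractor
  tractor_scaleA tractor_scale1 tractor_scaleDr tractor_scaleDl.

(* the section of E[w], resp. E_A, with a given representative in the scale g *)
Definition density_of (g : scale) (w : R) (u : smf C) : scale -> smf C :=
  xget (fun=> 0) [set f | density w f /\ f g = u].
Definition tractor_of (g : scale) (u : triple) : tractor :=
  xget 0 [set t : tractor | t g = u].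

(* Sections of the k-th tensor power of the tractor bundle, with weight w, are
   seen as the smf-multilinear maps from k-tuples of tractors to densities of
   weight w; indices are raised and lowered with the tractor metric. *)
Definition tens (k : nat) := ('I_k -> tractor) -> scale -> smf C.

Definition is_tensor k (w : R) (V : tens k) :=
  (forall t, density w (V t)) /\
  (forall t i (u : smf C) (a b : tractor) g,
    V [eta t with i |-> u *: a + b] g =
    u * V [eta t with i |-> a] g + V [eta t with i |-> b] g).

Definition dmul k (f : scale -> smf C) (V : tens k) : tens k :=
  fun t => f * V t.
Definition fmul k (u : smf C) (V : tens k) : tens k := dmul (cst u) V.
Definition rmul k (a : R) (V : tens k) : tens k := fmul a%:S V.

(* The operators below act on sections and are given by their expression in a
   scale g, with representatives of the result in the other scales following
   from the transformation laws.  The tractor metric, the tractor connection,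
   D_A, I_A, I^2 and I.D are conformally invariant: they do not depend on g. *)
Section in_scale.
Variables (g : scale) (D : metric_ops g).

(* sg_g^w d(sg_g^-w f) *)
Definition nabla_density (w : R) (X : vfield C) (f : scale -> smf C) :=
  density_of g w (X (f g)).

Definition nabla_tractor (X : vfield C) (t : tractor) : tractor :=
  let sg := slot_sigma (t g) in
  let mu := slot_mu (t g) in
  let rho := slot_rho (t g) in
  tractor_of g
    (X sg - mu X,
     fun Y => X (mu Y) - mu (lc D X Y) + g X Y * rho + schouten D X Y * sg,
     X rho - schouten D X (sharp D mu)).

Definition nabla k (w : R) (X : vfield C) (V : tens k) : tens k :=
  fun t => nabla_density w X (V t)
    - \sum_(i < k) V [eta t with i |-> nabla_tractor X (t i)].

(* nabla_a nabla_b V, coupled with the Levi-Civita connection *)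
Definition nabla2 k (w : R) (X Y : vfield C) (V : tens k) : tens k :=
  nabla w X (nabla w Y V) - nabla w (lc D X Y) V.

Definition laplacian k (w : R) (V : tens k) : tens k :=
  fun t => density_of g (w - 2) (contr D (fun X Y => nabla2 w X Y V t g)).

Definition densityJ : scale -> smf C := density_of g (-2) (schoutenJ D).

(* the three slots of D_A V, with values in tensor powers of the tractor
   bundle *)
Definition thomasD k (w : R) (V : tens k) :
    tens k * (vfield C -> tens k) * tens k :=
  let c := d%:R + 2 * w - 2 in
  (rmul (c * w) V,
   fun X => rmul c (nabla w X V),
   - (laplacian w V + rmul w (dmul densityJ V))).

Definition tractor_metric (t u : triple) : smf C :=
  slot_sigma t * slot_rho u + slot_rho t * slot_sigma u
  + slot_mu t (sharp D (slot_mu u)).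

Definition scale_tractor (sg : scale -> smf C) : tractor :=
  let DA := thomasD 1 (fun _ : 'I_0 -> tractor => sg) in
  let e := fun _ : 'I_0 => 0 : tractor in
  tractor_of g
    (d%:R^-1%:S *: ((DA.1.1 e g, fun X => DA.1.2 X e g, DA.2 e g) : triple)).

Definition Isq (sg : scale -> smf C) : smf C :=
  let I := scale_tractor sg g in tractor_metric I I.

Definition IdotD (sg : scale -> smf C) k (w : R) (V : tens k) : tens k :=
  let I := scale_tractor sg g in
  let DV := thomasD w V in
  fun t => density_of g (w - 1)
    (slot_sigma I * DV.2 t g + slot_rho I * DV.1.1 t g
     + DV.1.2 (sharp D (slot_mu I)) t g).

(* (- I^-2 I.D)^m on weight w; each factor lowers the weight by 1 *)
Fixpoint obstruction_op (sg : scale -> smf C) k (m : nat) (w : R) (V : tens k) :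
    tens k :=
  if m is m'.+1 then
    obstruction_op sg m' (w - 1) (- fmul (smf_inv (Isq sg)) (IdotD sg w V))
  else V.

(* The sections (of weight 0) of a subbundle of the k-th tensor power that is
   preserved by the connection; a subbundle is the image of a smooth bundle
   projection. *)
Definition tractor_bundle k (S : set (tens k)) :=
  (exists pi : tens k -> tens k,
    [/\ forall V, is_tensor 0 V -> is_tensor 0 (pi V),
        forall u V W, is_tensor 0 V -> is_tensor 0 W ->
          pi (fmul u V + W) = fmul u (pi V) + pi W,
        forall V, is_tensor 0 V -> pi (pi V) = pi V &
        S = [set V | is_tensor 0 V /\ pi V = V]]) /\
  (forall X V, S V -> S (nabla 0 X V)).

(* the sections of weight w, i.e. sg_g^w times sections of weight 0 *)
Definition bundle_section k (S : set (tens k)) (w : R) (V : tens k) :=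
  is_tensor w V /\ S (fun t => density_of g 0 (V t g)).

Definition bigO_sigma (sg : scale -> smf C) k (S : set (tens k)) (w : R)
    (m : nat) (V : tens k) :=
  exists2 U, bundle_section S (w - m%:R) U & V = dmul (sg ^+ m) U.

(* for an operator P from weight w to weight w' *)
Definition tangential (sg : scale -> smf C) k (S : set (tens k)) (w w' : R)
    (P : tens k -> tens k) :=
  exists P' : tens k -> tens k,
    [/\ forall U, bundle_section S (w - 1) U -> bundle_section S (w' - 1) (P' U),
        forall a U W, bundle_section S (w - 1) U -> bundle_section S (w - 1) W ->
          P' (rmul a U + W) = rmul a (P' U) + P' W &
        forall U, bundle_section S (w - 1) U ->
          P (dmul sg U) = dmul sg (P' U)].

Definition vanishes_on k (Sigma : set C) (V : tens k) :=
  forall t x, Sigma x -> V t g x = 0.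

Definition almost_pseudo_Riemannian (sg : scale -> smf C) :=
  density 1 sg /\
  forall x, let I := scale_tractor sg g in
    ~ [/\ slot_sigma I x = 0, forall X, slot_mu I X x = 0 & slot_rho I x = 0].

(* In the scale g, nabla sg is the differential of the representative sg g. *)
Definition defining_density (sg : scale -> smf C) (Sigma : set C) :=
  let dsg := fun X : vfield C => X (sg g) in
  Sigma = [set x | sg g x = 0] /\
  forall x, Sigma x -> dnonzero (sg g) x /\ dsg (sharp D dsg) x != 0.

End in_scale.

End conformal.

(* Main.v *)
(* On sections of weight v one has [I.D, sigma] = (d + 2 v) I^2, hence, for
   sigma^(j+1) u of weight w,
     I.D (sigma^(j+1) u)
       = sigma^(j+1) I.D u + (j+1) (d + 2 w - 2 - j) I^2 sigma^j u.
   Writing I.D F = sigma^l E, the section F + sigma^(l+1) u is a solution to the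
   next order iff E + (l+1) (h0 - 2 - l) I^2 u vanishes along Sigma.  This
   determines u along Sigma unless l = h0 - 2, in which case E itself has to
   vanish along Sigma.  For l = h0 - 2 the same commutator shows that P_(l+1) is
   tangential, and that P_(l+1) f_0 is along Sigma a nonzero multiple of I^-2 E.

   Two facts about smooth functions are needed.  A section vanishing along Sigma
   is sigma times a smooth section.  The Laplacian preserves the sections of a
   subbundle, which is invariant only under first derivatives: as vector fields
   are given as derivations, one has to know that near a point they are
   combinations of finitely many of them. *)

Require Import Defs.
From HB Require Import structures.
From mathcomp Require Import all_boot all_order all_algebra.
From mathcomp Require Import all_classical all_reals all_analysis.
From mathcomp Require Import ring lra.

Set Implicit Arguments.
Unset Strict Implicit.
Unset Printing Implicit Defensive.

Import Order.TTheory GRing.Theory Num.Theory.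
Import numFieldNormedType.Exports.

Local Open Scope classical_set_scope.
Local Open Scope ring_scope.

(** * Smooth functions on open subsets of R^d *)

(** The nonzero multiple arises as follows. Write F = f_0 + sigma W; by tangentiality P_(l+1) F and
    P_(l+1) f_0 agree along Sigma. The innermost factor of P_(l+1) sends F to -sigma^l I^-2 E, and
    each of the l other factors strips off one power of sigma at the cost of a constant. For l = h0
    - 2 these constants are l * 1, (l - 1) * 2, ..., 1 * l, with product (l!)^2.

    Densities and tractors are determined by their representatives in the fixed scale [g], and all
    operators are computed there. A subbundle is the fixed set of a C^oo-linear projection of
    sections, so membership may be tested after multiplication by sigma or by a cutoff function;
    this keeps quotients by sigma and Laplacians in the bundle.

    Division by sigma rests on mean value theorems: to any order, u / s is a smooth function plus a
    quotient flat enough along s = 0 to be differentiable. The same division yields Hadamard's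
    lemma, and with it the local frames. *)

Section smooth_calculus.
Context {R : realType} {d : nat}.
Local Notation V := 'rV[R]_d.
Implicit Types (f g h p : V -> R) (U W : set V) (x y : V) (i j : 'I_d).

Lemma pderivD i f g x : differentiable f x -> differentiable g x ->
  pderiv i (f + g) x = pderiv i f x + pderiv i g x.
Proof. by move=> df dg; rewrite /pderiv deriveD //; exact: diff_derivable. Qed.

Lemma pderivB i f g x : differentiable f x -> differentiable g x ->
  pderiv i (f - g) x = pderiv i f x - pderiv i g x.
Proof. by move=> df dg; rewrite /pderiv deriveB //; exact: diff_derivable. Qed.

Lemma pderivM i f g x : differentiable f x -> differentiable g x ->
  pderiv i (f * g) x = pderiv i f x * g x + f x * pderiv i g x.
Proof.
move=> df dg; rewrite /pderiv deriveM; do ?exact: diff_derivable.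
by rewrite addrC; congr (_ + _); exact: mulrC.
Qed.

Lemma pderiv_cst i (a : R) x : pderiv i (cst a) x = 0.
Proof. exact: derive_cst. Qed.

Lemma near_open (P : V -> Prop) U x : open U -> U x ->
  (forall y, U y -> P y) -> \forall y \near x, P y.
Proof.
move=> oU Ux UP; have : nbhs x U by exact: open_nbhs_nbhs.
exact: filterS.
Qed.

Lemma pderiv_eq_on U i f g : open U -> (forall x, U x -> f x = g x) ->
  forall x, U x -> pderiv i f x = pderiv i g x.
Proof.
move=> oU fg x Ux; apply: near_eq_derive.
exact: near_open Ux fg.
Qed.

Lemma smooth_on_eq U f g : open U -> (forall x, U x -> f x = g x) ->
  smooth_on U f -> smooth_on U g.
Proof.
move=> oU fg Sf; apply: (@smooth_on_coind _ _ _
  [set h | exists2 f, smooth_on U f & forall x, U x -> f x = h x]) => //.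
- move=> h [f' Sf' f'h] x Ux; apply: near_eq_differentiable (smooth_on_diff Sf' Ux).
  exact: near_open Ux f'h.
- move=> h i [f' Sf' f'h]; exists (pderiv i f').
    by exists (pderiv i f') => //; exact: smooth_on_pderiv.
  by move=> x; rewrite inE => Ux; apply/esym/(pderiv_eq_on _ oU f'h Ux).
- by exists f.
Qed.

Lemma smooth_on_sub U W f : W `<=` U -> smooth_on U f -> smooth_on W f.
Proof. by move=> WU Sf s x /WU; exact: Sf. Qed.

Lemma smooth_on_local U f :
  (forall x, U x -> exists2 W, W x & smooth_on W f) -> smooth_on U f.
Proof. by move=> L s x /L[W Wx Sf]; exact: Sf. Qed.

Lemma smooth_onN U f : open U -> smooth_on U f -> smooth_on U (- f).
Proof.
move=> oU Sf; rewrite -[- f]sub0r; apply: smooth_onB => //.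
exact: (smooth_on_cst 0).
Qed.

Lemma smooth_onD U f g : open U ->
  smooth_on U f -> smooth_on U g -> smooth_on U (f + g).
Proof.
by move=> oU Sf Sg; rewrite -[g]opprK; apply: smooth_onB => //; exact: smooth_onN.
Qed.

Lemma smooth_onX U f n : open U -> smooth_on U f -> smooth_on U (f ^+ n).
Proof.
move=> oU Sf; elim: n => [|n IHn]; first by rewrite expr0; exact: (smooth_on_cst 1).
by rewrite exprS; exact: smooth_onM.
Qed.

Lemma smooth_on_sum (I : Type) (r : seq I) (F : I -> V -> R) U : open U ->
  (forall k, smooth_on U (F k)) -> smooth_on U (\sum_(k <- r) F k).
Proof.
move=> oU SF; elim/big_ind: _ => //; first exact: (smooth_on_cst 0).
by move=> *; exact: smooth_onD.
Qed.

Lemma pderiv_coord i j x : pderiv i (fun y => y 0 j) x = (i == j)%:R.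
Proof.
rewrite /pderiv deriveE; last exact: differentiable_coord.
have lf : linear (fun N : V => N 0 j) by move=> a u v; rewrite !mxE.
pose f : {linear V -> R} := HB.pack (fun N : V => N 0 j) (GRing.isLinear.Build R V R _ _ lf).
rewrite (_ : (fun y => _) = f) // diff_lin /=; last exact: coord_continuous.
by rewrite mxE eqxx eq_sym.
Qed.

Lemma smooth_on_coord U j : open U -> smooth_on U (fun y => y 0 j).
Proof.
move=> oU; apply: (@smooth_on_coind _ _ _
  [set h | h = (fun y => y 0 j) \/ exists a, h = cst a]) => //; last by left.
- move=> _ [->|[a ->]] x _; first exact: differentiable_coord.
  exact: differentiable_cst.
- move=> _ i [->|[a ->]]; last first.
    by exists (cst 0) => [|x _]; [right; exists 0|exact: pderiv_cst].
  exists (cst (i == j)%:R); first by right; eexists.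
  by move=> x _; rewrite pderiv_coord.
Qed.

Inductive compsum U (K : set (R -> R)) p : (V -> R) -> Prop :=
| compsumM h phi : smooth_on U h -> K phi -> compsum U K p (h * (phi \o p))
| compsumD h1 h2 : compsum U K p h1 -> compsum U K p h2 -> compsum U K p (h1 + h2).

Lemma differentiable_comp1 (phi : R -> R) p x :
  differentiable p x -> derivable phi (p x) 1 -> differentiable (phi \o p) x.
Proof. by move=> dp dphi; apply: differentiable_comp => //; exact/derivable1_diffP. Qed.

Lemma pderiv_comp1 i (phi : R -> R) p x :
  differentiable p x -> derivable phi (p x) 1 ->
  pderiv i (phi \o p) x = phi^`()%classic (p x) * pderiv i p x.
Proof.
move=> dp dphi; have dphi' : differentiable phi (p x) by exact/derivable1_diffP.
rewrite /pderiv deriveE; last exact: differentiable_comp.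
by rewrite diff_comp //= diff1E // deriveE // mulrC.
Qed.

(** By the chain rule the sums of h * (phi \o p), with h smooth and phi in [K], are stable under
    partial derivatives, so that coinduction applies. [K] is closed under derivation up to a sum of
    two members, the form taken by the derivative of [flat_exp]; for powers the second term is
    zero. *)
Lemma smooth_on_comp1 (K : set (R -> R)) (A : set R) U p (phi : R -> R) :
  (forall phi, K phi -> forall a, A a -> derivable phi a 1) ->
  (forall phi, K phi -> exists phi1 phi2, [/\ K phi1, K phi2 &
    forall a, A a -> phi^`()%classic a = phi1 a + phi2 a]) ->
  open U -> smooth_on U p -> (forall x, U x -> A (p x)) -> K phi ->
  smooth_on U (phi \o p).
Proof.
move=> dK KK oU Sp UA Kphi.
have dC h : compsum U K p h -> forall x, U x -> differentiable h x.
  elim=> [{}h {Kphi}phi Sh Kphi|h1 h2 _ d1 _ d2] x Ux.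
    apply: differentiableM; first exact: smooth_on_diff Ux.
    by apply: differentiable_comp1; [exact: smooth_on_diff Ux|apply: dK => //; exact: UA].
  by apply: differentiableD; [exact: d1|exact: d2].
rewrite -[phi \o p]mul1r.
apply: (@smooth_on_coind _ _ U (compsum U K p)) => //; last first.
  by constructor => //; exact: (smooth_on_cst 1).
move=> h i; elim=> [{}h {Kphi}phi Sh Kphi|h1 h2 C1 [k1 Ck1 E1] C2 [k2 Ck2 E2]]; last first.
  exists (k1 + k2); first by constructor.
  move=> x Ux; rewrite -[RHS]/(k1 x + k2 x) -(E1 x Ux) -(E2 x Ux).
  by rewrite inE in Ux; apply: pderivD; exact: dC Ux.
have [phi1 [phi2 [K1 K2 E]]] := KK _ Kphi.
exists (pderiv i h * (phi \o p) + ((h * pderiv i p) * (phi1 \o p)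
                                   + (h * pderiv i p) * (phi2 \o p))).
  have Shp : smooth_on U (h * pderiv i p).
    by apply: smooth_onM => //; exact: smooth_on_pderiv.
  by constructor; [|constructor]; constructor => //; exact: smooth_on_pderiv.
move=> x; rewrite inE => Ux.
have dp : differentiable p x := smooth_on_diff Sp Ux.
have dphi : derivable phi (p x) 1 by apply: dK => //; exact: UA.
rewrite pderivM; [|exact: smooth_on_diff Ux|exact: differentiable_comp1].
rewrite pderiv_comp1 // E; last exact: UA.
by rewrite !fctE /=; ring.
Qed.

Lemma smooth_onV U p : open U -> smooth_on U p -> (forall x, U x -> p x != 0) ->
  smooth_on U (fun x => (p x)^-1).
Proof.
move=> oU Sp p0.
apply: (@smooth_on_comp1 [set phi | exists a n, phi = (fun x : R => a * x ^- n)]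
  [set a | a != 0] U p (fun a => a^-1)) => //.
- move=> _ [a [n ->]] x /= x0; apply: derivableM => //.
  apply: derivableV; first by rewrite expf_neq0.
  exact: exprn_derivable.
- move=> _ [a [n ->]]; exists (fun x : R => - (a * n%:R) * x ^- n.+1), (fun x : R => 0 * x ^- n).
  split; [by eexists; eexists..|].
  move=> x /= x0.
  have dX : derivable (fun y : R => y ^+ n) x 1 by exact: exprn_derivable.
  have xn0 : x ^+ n != 0 by rewrite expf_neq0.
  have dV : derivable (fun y : R => y ^- n) x 1 by exact: derivableV.
  have -> : (fun y : R => a * y ^- n)^`()%classic x = a * 'D_1 (fun y : R => y ^- n) x.
    by rewrite derive1E deriveMl.
  have -> : 'D_1 (fun y : R => y ^- n) x = - (x ^+ n) ^- 2 * (n%:R * x ^+ n.-1).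
    rewrite (@deriveV R R (fun y : R => y ^+ n) x 1 xn0 dX).
    rewrite (@exp_derive R n x 1).
    by rewrite /GRing.scale /= mulr1.
  case: n {dX dV} xn0 => [|n] xn0; first by rewrite mul0r !mulr0 oppr0 !mul0r addr0.
  have xn : x ^+ n != 0 by rewrite expf_neq0.
  set c := n.+1%:R; rewrite /= mul0r addr0 !exprS expr0 mulr1.
  by field; rewrite x0 xn.
- by exists 1, 1%N; apply/funext => x; rewrite mul1r.
Qed.

Lemma smooth_on_powR U p (w : R) : open U -> smooth_on U p ->
  (forall x, U x -> 0 < p x) -> smooth_on U (fun x => p x `^ w).
Proof.
move=> oU Sp p0.
apply: (@smooth_on_comp1 [set phi | exists a r, phi = (fun x : R => a * x `^ r)]
  [set a | 0 < a] U p (fun a => a `^ w)) => //.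
- move=> _ [a [r ->]] x /= x0; apply: derivableM => //.
  by apply: derivable_powR; rewrite in_itv/= x0.
- move=> _ [a [r ->]]; exists (fun x : R => (a * r) * x `^ (r - 1)), (fun x : R => 0 * x `^ r).
  split; [by eexists; eexists..|].
  move=> x /= x0; have xI : x \in `]0, +oo[ by rewrite in_itv/= x0.
  rewrite derive1E deriveM //; last exact: derivable_powR.
  rewrite derive_cst scaler0 addr0 -derive1E powR_derive1 //.
  by rewrite mul0r addr0 /GRing.scale /= mulrA.
- by exists 1, w; apply/funext => x; rewrite mul1r.
Qed.

Lemma is_derive_line f z v (t : R) : differentiable f (z + t *: v) ->
  is_derive t (1 : R) (fun t => f (z + t *: v)) ('D_v f (z + t *: v)).
Proof.
move=> df; have D : derivable f (z + t *: v) v by exact: diff_derivable.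
have E : (fun h : R => h^-1 *: (((fun t => f (z + t *: v)) \o shift t) (h *: 1) - f (z + t *: v)))
  = (fun h : R => h^-1 *: ((f \o shift (z + t *: v)) (h *: v) - f (z + t *: v))).
  by apply/funext => h /=; rewrite [h%:A]mulr1 scalerDl addrCA.
by split; rewrite ?/derivable ?/derive E.
Qed.

Lemma MVT_line f z v (h : R) : 0 < h ->
  (forall t, 0 <= t <= h -> differentiable f (z + t *: v)) ->
  exists2 t, 0 < t < h & f (z + h *: v) - f z = h * 'D_v f (z + t *: v).
Proof.
move=> h0 df.
have [||t /[!in_itv]/= th E] :=
    @MVT R (fun t => f (z + t *: v)) (fun t => 'D_v f (z + t *: v)) 0 h h0.
- move=> t; rewrite in_itv/= => /andP[t0 th]; apply: is_derive_line.
  by apply: df; rewrite !ltW.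
- apply: derivable_within_continuous => t; rewrite in_itv/= => th.
  by have [] := is_derive_line (df t th).
by exists t => //; rewrite scale0r addr0 subr0 mulrC in E.
Qed.

End smooth_calculus.

(** * Symmetry of second partial derivatives *)

Section schwarz.
Context {R : realType} {d : nat}.
Local Notation V := 'rV[R]_d.
Implicit Types (f g h p : V -> R) (U W : set V) (x y : V) (i j : 'I_d).

Lemma rV_norm_lt (v : V) (e : R) : 0 < e -> (forall i, `|v 0 i| < e) -> `|v| < e.
Proof.
move=> e0 H; rewrite [ltLHS]/Num.norm /= mx_normrE; apply/bigmax_ltP; split => // -[a b] _ /=.
by rewrite ord1.
Qed.

Lemma rV_coord_le (v : V) i : `|v 0 i| <= `|v|.
Proof.
rewrite [leRHS]/Num.norm /= mx_normrE; apply/bigmax_geP; right => /=.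
by exists (0, i).
Qed.

Lemma norm_delta_le i : `|delta_mx 0 i : V| <= 1.
Proof.
rewrite [leLHS]/Num.norm /= mx_normrE; apply/bigmax_leP; split => // -[a b] _ /=.
by rewrite mxE; case: (_ && _); rewrite ?normr1 ?normr0 ?ler01.
Qed.

Lemma ball_distP x (r : R) y : ball x r y <-> `|y - x| < r.
Proof. by rewrite -ball_normE /= distrC. Qed.

Lemma open_ball_sub U x : open U -> U x -> exists2 r : R, 0 < r & ball x r `<=` U.
Proof.
move=> oU Ux; have : nbhs x U by exact: open_nbhs_nbhs.
by case/nbhs_ballP => r /= r0 rU; exists r.
Qed.

Lemma smooth_near U f x (e : R) : smooth_on U f -> U x -> 0 < e ->
  \forall y \near x, `|f x - f y| < e.
Proof.
move=> Sf Ux e0; have : f y @[y --> x] --> f x.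
  exact: differentiable_continuous (smooth_on_diff Sf Ux).
by move=> /pseudometric_normed_Zmodule.cvgr_dist_lt; apply.
Qed.

(** The mean value theorem is applied in direction i to f(. + h e_j) - f, then in direction j to
    [pderiv i f]. The left-hand side is symmetric in i and j, which is what forces the mixed
    derivatives to agree. *)
Lemma second_difference U f x i j (h : R) : smooth_on U f ->
  0 < h -> (forall s t, 0 <= s <= h -> 0 <= t <= h ->
     U (x + s *: delta_mx 0 i + t *: delta_mx 0 j)) ->
  exists s t, [/\ 0 < s < h, 0 < t < h &
   f (x + h *: delta_mx 0 i + h *: delta_mx 0 j) - f (x + h *: delta_mx 0 i)
    - (f (x + h *: delta_mx 0 j) - f x) =
   h ^+ 2 * pderiv j (pderiv i f) (x + s *: delta_mx 0 i + t *: delta_mx 0 j)].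
Proof.
move=> Sf h0 HU; set ei := delta_mx 0 i; set ej := delta_mx 0 j.
have hh : 0 <= h <= h by rewrite lexx ltW.
have h00 : 0 <= (0 : R) <= h by rewrite lexx ltW.
have D s t : 0 <= s <= h -> 0 <= t <= h -> differentiable f (x + s *: ei + t *: ej).
  by move=> sh th; apply: smooth_on_diff Sf _; exact: HU.
pose G y := f (y + h *: ej) - f y.
have dsh y : differentiable (fun z : V => z + h *: ej) y.
  by apply: differentiableD => //; exact: differentiable_cst.
have dG1 t : 0 <= t <= h -> differentiable (fun y => f (y + h *: ej)) (x + t *: ei).
  move=> th; apply: (@differentiable_comp _ _ _ _ (fun z : V => z + h *: ej) f) => //.
  exact: D.
have dG2 t : 0 <= t <= h -> differentiable f (x + t *: ei).
  by move=> th; have := D t 0 th h00; rewrite scale0r addr0.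
have [|s sh E] := @MVT_line _ _ G x ei h h0.
  by move=> t th; apply: differentiableB; [exact: dG1|exact: dG2].
have sh' : 0 <= s <= h by case/andP: sh => *; rewrite !ltW.
have DG : 'D_ei G (x + s *: ei) = pderiv i f (x + s *: ei + h *: ej) - pderiv i f (x + s *: ei).
  rewrite /pderiv -/ei -[LHS]/('D_ei ((fun y => f (y + h *: ej)) - f) (x + s *: ei)).
  rewrite deriveB; [|by apply: diff_derivable; exact: (dG1 s sh')|by apply: diff_derivable; exact: (dG2 s sh')].
  congr (_ - _); rewrite /derive.
  suff -> : (fun u : R => u^-1 *: (((fun y => f (y + h *: ej)) \o shift (x + s *: ei)) (u *: ei)
                                   - f (x + s *: ei + h *: ej)))
      = (fun u : R => u^-1 *: ((f \o shift (x + s *: ei + h *: ej)) (u *: ei)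
                                   - f (x + s *: ei + h *: ej))) by [].
  by apply/funext => u /=; rewrite !addrA.
have [|t th E2] := @MVT_line _ _ (pderiv i f) (x + s *: ei) ej h h0.
  by move=> t th; apply: (smooth_on_diff (smooth_on_pderiv i Sf)); exact: HU.
exists s, t; split => //.
by rewrite -[LHS]/(G (x + h *: ei) - G x) E DG E2 mulrA -expr2.
Qed.

Lemma pderivC U f i j x : open U -> smooth_on U f -> U x ->
  pderiv i (pderiv j f) x = pderiv j (pderiv i f) x.
Proof.
move=> oU Sf Ux; set A := LHS; set B := RHS.
apply/eqP; rewrite -subr_eq0 -normr_eq0; apply/negPn/negP => AB0.
(* [A] and [B] are each approximated within a third of their distance by values of the mixed
   derivatives that the symmetric second difference makes equal. *)
pose e := `|A - B| / 3.
have e0 : 0 < e by rewrite divr_gt0 // lt0r AB0 normr_ge0.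
have /nbhs_ballP[r /= r0 rP] : \forall y \near x, U y /\
   (`|A - pderiv i (pderiv j f) y| < e /\ `|B - pderiv j (pderiv i f) y| < e).
  have nU : nbhs x U by exact: open_nbhs_nbhs.
  have nA := smooth_near (smooth_on_pderiv i (smooth_on_pderiv j Sf)) Ux e0.
  have nB := smooth_near (smooth_on_pderiv j (smooth_on_pderiv i Sf)) Ux e0.
  by exact: filterI nU (filterI nA nB).
(* Two displacements of norm at most r / 3 stay inside the ball of radius r. *)
pose h := r / 3; have h0 : 0 < h by rewrite divr_gt0.
have inb (a b : 'I_d) s t : 0 <= s <= h -> 0 <= t <= h ->
    ball x r (x + s *: delta_mx 0 a + t *: delta_mx 0 b).
  move=> /andP[s0 sh] /andP[t0 th]; apply/ball_distP; set a' := s *: _; set b' := t *: _.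
  have -> : x + a' + b' - x = a' + b' by rewrite -[x + a' + b']addrA [x + _]addrC addrK.
  rewrite {}/a' {}/b'.
  apply: le_lt_trans (ler_normD _ _) _; rewrite !normrZ !ger0_norm //.
  have := norm_delta_le a; have := norm_delta_le b => nb na.
  have : s * `|delta_mx 0 a : V| <= h by apply: le_trans sh; rewrite ler_piMr.
  have : t * `|delta_mx 0 b : V| <= h by apply: le_trans th; rewrite ler_piMr.
  by rewrite /h; lra.
have [s [t [sh th E1]]] := @second_difference U f x i j h Sf h0
   (fun s t sh th => (rP _ (inb i j s t sh th)).1).
have [s' [t' [sh' th' E2]]] := @second_difference U f x j i h Sf h0
   (fun s t sh th => (rP _ (inb j i s t sh th)).1).
have W a : 0 < a < h -> 0 <= a <= h by case/andP => *; rewrite !ltW.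
have [_ [_ BB]] := rP _ (inb i j s t (W _ sh) (W _ th)).
have [_ [AA _]] := rP _ (inb j i s' t' (W _ sh') (W _ th')).
set a' := pderiv i _ _ in AA E2; set b' := pderiv j _ _ in BB E1.
move: a' b' AA BB E1 E2 => a' b' AA BB E1 E2.
have E : b' = a'.
  apply: (@mulfI _ (h ^+ 2)); first by rewrite expf_neq0 // gt_eqF.
  have swap (k m u v : R) : k - m - (u - v) = k - u - (m - v) by ring.
  apply: etrans (esym E1) _; apply: etrans _ E2.
  by rewrite swap; congr (_ - _ - _); congr (f _); rewrite addrAC.
have : `|A - B| < e + e.
  have -> : A - B = (A - a') - (B - b') by rewrite E; ring.
  by apply: le_lt_trans (ler_normB _ _) _; exact: ltrD.
by rewrite {1}/e; have := normr_ge0 (A - B); rewrite /e; lra.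
Qed.

End schwarz.

(** * Division by a function with nonvanishing differential *)

Section local_division.
Context {R : realType} {d : nat}.
Local Notation V := 'rV[R]_d.
Implicit Types (s f g h v w z : V -> R) (x y p : V) (i j : 'I_d).

Lemma smooth_MVT (U : set V) f x (v : V) : smooth_on U f ->
  (forall c : R, 0 <= c <= 1 -> U (x + c *: v)) ->
  exists2 c : R, 0 < c < 1 & f (x + v) - f x = 'D_v f (x + c *: v).
Proof.
move=> Sf HU; have [|c c01 E] := @MVT_line _ _ f x v 1 ltr01.
  by move=> t /HU; exact: smooth_on_diff Sf.
by exists c => //; rewrite scale1r mul1r in E.
Qed.

Lemma deriveZr f x (t : R) (v : V) : differentiable f x -> 'D_(t *: v) f x = t * 'D_v f x.
Proof. by move=> df; rewrite !deriveE // linearZ. Qed.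

(** A differentiable s vanishing at p is O(|y - p|), so z = o(s) is o(|y - p|) there: this is
    differentiability with zero differential. *)
Lemma little_o_diff s z p : differentiable s p -> s p = 0 -> z p = 0 ->
  (forall e : R, 0 < e -> \forall y \near p, `|z y| <= e * `|s y|) ->
  differentiable z p /\ forall i, pderiv i z p = 0.
Proof.
move=> ds s0 z0 H.
have [C C0 sC] : exists2 C : R, 0 < C & \forall y \near (0 : V), `|s (y + p)| <= C * `|y|.
  have [k k0 kP] := @linear_lipschitz _ _ _ ('d s p) (diff_continuous ds).
  exists (k + 1); first by rewrite addr_gt0.
  have /eqaddoP /(_ 1 ltr01) := diff_locally ds.
  apply: filterS => y; rewrite !fctE /= s0 add0r mul1r => E.
  have N : `|s (y + p)| <= `|s (y + p) - 'd s p y| + `|'d s p y|.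
    by rewrite -{1}[s (y + p)](subrK ('d s p y)); exact: ler_normD.
  apply: (le_trans N); rewrite mulrDl mul1r addrC; apply: lerD E.
  exact: kP.
pose c0 : V -> R := cst 0.
have c0E y : 'd c0 p y = 0 by rewrite /c0 diff_cst.
have K (e : R) : 0 < e -> \forall y \near (0 : V), `|z (y + p)| <= e * `|y|.
  move=> e0; have e0' : 0 < e / C by rewrite divr_gt0.
  have zS : \forall y \near (0 : V), `|z (y + p)| <= e / C * `|s (y + p)|.
    by move: (H _ e0'); rewrite (near_shift 0) subr0.
  apply: filterS2 sC zS => y sy zy; apply: le_trans zy _.
  by rewrite mulrAC ler_pdivrMr // -mulrA ler_pM2l // mulrC.
have dz : 'd z p = 'd c0 p :> (V -> R).
  apply: diff_unique; first exact: diff_continuous.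
  apply/eqaddoP => e e0; move: (K e e0); apply: filterS => y.
  by rewrite !fctE /= z0 c0E addr0 subr0.
have Dz : differentiable z p.
  apply/diff_locallyP; rewrite dz; split; first exact: diff_continuous.
  apply/eqaddoP => e e0; move: (K e e0); apply: filterS => y.
  by rewrite !fctE /= z0 c0E addr0 subr0.
by split=> // i; rewrite /pderiv deriveE // dz c0E.
Qed.

Variables (B : set V) (s : V -> R) (i0 : 'I_d).
Hypotheses (oB : open B) (Ss : smooth_on B s)
  (s'0 : forall x, B x -> pderiv i0 s x != 0).
Local Notation S := (smooth_on B).
Let e0 : V := delta_mx 0 i0.

Let dS f x : S f -> B x -> differentiable f x.
Proof. by move=> Sf; exact: smooth_on_diff Sf. Qed.

(* In the coordinates obtained by replacing the i0-th one with s, [Tder] is the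
   partial derivative along s and [tander j] the one along the j-th coordinate.
   [flat n v] means that v vanishes to order n along s = 0. *)
Definition Tder f : V -> R := fun y => pderiv i0 f y / pderiv i0 s y.
Local Notation T := Tder.

Let Sr : S (fun y => (pderiv i0 s y)^-1).
Proof. by apply: smooth_onV => //; exact: smooth_on_pderiv. Qed.

Lemma Tder_smooth f : S f -> S (T f).
Proof.
move=> Sf; rewrite (_ : T f = pderiv i0 f * (fun y => (pderiv i0 s y)^-1)) //.
by apply: smooth_onM => //; exact: smooth_on_pderiv.
Qed.

Lemma TderM f g x : S f -> S g -> B x -> T (f * g) x = T f x * g x + f x * T g x.
Proof.
move=> Sf Sg Bx; rewrite /T pderivM; [|exact: dS..].
by rewrite mulrDl mulrAC mulrA.
Qed.

Lemma TderD f g x : S f -> S g -> B x -> T (f + g) x = T f x + T g x.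
Proof. by move=> Sf Sg Bx; rewrite /T pderivD ?mulrDl //; exact: dS. Qed.

Lemma TderB f g x : S f -> S g -> B x -> T (f - g) x = T f x - T g x.
Proof. by move=> Sf Sg Bx; rewrite /T pderivB ?mulrBl //; exact: dS. Qed.

Lemma Tder_s x : B x -> T s x = 1.
Proof. by move=> Bx; rewrite /T divff // s'0. Qed.

Lemma Tder_eq f g : (forall x, B x -> f x = g x) -> forall x, B x -> T f x = T g x.
Proof. by move=> fg x Bx; rewrite /T (pderiv_eq_on _ oB fg). Qed.

Fixpoint flat n v : Prop :=
  if n is m.+1 then (forall y, B y -> s y = 0 -> v y = 0) /\ flat m (T v) else True.

Lemma flat_eq n v w : (forall x, B x -> v x = w x) -> flat n v -> flat n w.
Proof.
elim: n v w => [//|n IHn] v w vw [v0 fv]; split; last exact: IHn (Tder_eq vw) fv.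
by move=> y By sy; rewrite -vw // v0.
Qed.

Lemma flatW n v : flat n.+1 v -> flat n v.
Proof. by elim: n v => [//|n IHn] v [v0 fv]; split => //; exact: IHn. Qed.

Lemma flatD n v w : S v -> S w -> flat n v -> flat n w -> flat n (v + w).
Proof.
elim: n v w => [//|n IHn] v w Sv Sw [v0 fv] [w0 fw]; split.
  by move=> y By sy; rewrite fctE v0 // w0 // addr0.
have /flat_eq : forall x, B x -> T v x + T w x = T (v + w) x by move=> x Bx; rewrite TderD.
by apply; apply: IHn fv fw; exact: Tder_smooth.
Qed.

Lemma flatM n f v : S f -> S v -> flat n v -> flat n (f * v).
Proof.
elim: n f v => [//|n IHn] f v Sf Sv [v0 fv]; split.
  by move=> y By sy; rewrite fctE v0 // mulr0.
have /flat_eq : forall x, B x -> (T f * v + f * T v) x = T (f * v) x.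
  by move=> x Bx; rewrite TderM.
apply; have STv := Tder_smooth Sv; have STf := Tder_smooth Sf.
apply: flatD; do ?exact: smooth_onM; apply: IHn => //.
by apply: flatW; split.
Qed.

Lemma flatN n v : S v -> flat n v -> flat n (- v).
Proof.
move=> Sv fv; apply: (@flat_eq _ (cst (-1) * v)).
  by move=> x _; rewrite !fctE mulN1r.
by apply: flatM => //; exact: (smooth_on_cst (-1)).
Qed.

Lemma flatB n v w : S v -> S w -> flat n v -> flat n w -> flat n (v - w).
Proof.
move=> Sv Sw fv fw; apply: flatD => //; [exact: smooth_onN|exact: flatN].
Qed.

Lemma flat_s n v : S v -> flat n v -> flat n.+1 (s * v).
Proof.
elim: n v => [|n IHn] v Sv fv.
  by split=> // y By sy; rewrite fctE sy mul0r.
split; first by move=> y By sy; rewrite fctE sy mul0r.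
have /flat_eq : forall x, B x -> (v + s * T v) x = T (s * v) x.
  by move=> x Bx; rewrite TderM // Tder_s // mul1r.
apply; have STv := Tder_smooth Sv.
apply: flatD => //; first exact: smooth_onM.
by apply: IHn => //; case: fv.
Qed.

Lemma flat_sX n v : S v -> flat n (s ^+ n * v).
Proof.
move=> Sv; elim: n => [//|n IHn].
rewrite exprS -mulrA; apply: flat_s => //.
by apply: smooth_onM => //; exact: smooth_onX.
Qed.

(** The next Taylor coefficient of v along s is obtained by integrating that of [T v]: since T s =
    1, it is the coefficient w1 of [T v] divided by n + 1. The error s^(n+1) T w is flat enough by
    [flat_sX]. *)
Lemma flat_taylor n v : S v -> flat n v -> exists2 w, S w & flat n.+1 (v - s ^+ n * w).
Proof.
elim: n v => [|n IHn] v Sv fv.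
  exists v => //; split=> // y _ _.
  by rewrite expr0 mul1r subrr.
case: fv => v0 fTv; have STv := Tder_smooth Sv.
have [w1 Sw1 fw1] := IHn _ STv fTv.
have Sc (a : R) : S (cst a) by exact: smooth_on_cst.
pose w := cst n.+1%:R^-1 * w1; have Sw : S w by exact: smooth_onM.
have SX k : S (s ^+ k) by exact: smooth_onX.
exists w => //; split.
  by move=> y By sy; rewrite /= !fctE v0 // sy expr0n mul0r subr0.
have TX k x : B x -> T (s ^+ k.+1) x = k.+1%:R * s x ^+ k.
  move=> Bx; elim: k => [|k IHk]; first by rewrite expr1 Tder_s // expr0 mulr1.
  rewrite exprS TderM // Tder_s // IHk mul1r exprfctE.
  by rewrite !exprS -[in RHS]natr1; ring.
have STw := Tder_smooth Sw.
apply: (@flat_eq _ ((T v - s ^+ n * w1) - s ^+ n.+1 * T w)).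
  move=> x Bx; rewrite TderB //; last exact: smooth_onM.
  rewrite TderM // TX // !fctE /=; have : n.+1%:R != 0 :> R by rewrite pnatr_eq0.
  move=> n0; rewrite (_ : w x = n.+1%:R^-1 * w1 x) //.
  have -> : n.+1%:R * s x ^+ n * (n.+1%:R^-1 * w1 x) = s x ^+ n * w1 x.
    by rewrite mulrACA mulfV // mul1r.
  by rewrite opprD addrA.
apply: flatB => //; [|by apply: smooth_onM|exact: flat_sX].
by apply: smooth_onB => //; apply: smooth_onM.
Qed.

Lemma dist_lt_mul_gt0 (a b : R) : `|a - b| < `|a| -> 0 < a * b.
Proof.
rewrite -(@ltr_pXn2r _ 2) ?nnegrE ?normr_ge0 // !real_normK ?num_real // => H.
by have := sqr_ge0 b; nra.
Qed.

Lemma smooth_near_sign f x : S f -> B x -> f x != 0 -> \forall y \near x, 0 < f x * f y.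
Proof.
move=> Sf Bx fx0; have fx : 0 < `|f x| by rewrite normr_gt0.
apply: filterS (smooth_near Sf Bx fx) => y; exact: dist_lt_mul_gt0.
Qed.

Lemma smooth_line_incr x (t : R) : (forall c : R, 0 <= c <= 1 -> B (x + c *: (t *: e0))) ->
  exists2 c : R, 0 < c < 1 & s (x + t *: e0) - s x = t * pderiv i0 s (x + c *: (t *: e0)).
Proof.
move=> HB; have [c c01 E] := smooth_MVT Ss HB.
exists c => //; rewrite E deriveZr //; apply: dS => //; apply: HB.
by case/andP: c01 => *; rewrite !ltW.
Qed.

Lemma zero_on_line p (dl : R) : B p -> s p = 0 -> 0 < dl ->
  \forall y \near p, exists t : R, s (y + t *: e0) = 0 /\
    forall c : R, 0 <= c <= 1 -> ball p dl (y + c *: (t *: e0)).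
Proof.
move=> Bp sp dl0; set a := pderiv i0 s p.
have [r1 /= r10 r1P] : exists2 r : R, 0 < r & ball p r `<=` [set y | B y /\ 0 < a * pderiv i0 s y].
  have nB : nbhs p B by exact: open_nbhs_nbhs.
  have nA := smooth_near_sign (smooth_on_pderiv i0 Ss) Bp (s'0 Bp).
  have N : nbhs p (B `&` [set y | 0 < a * pderiv i0 s y]) by exact: filterI nB nA.
  by case/nbhs_ballP: N => r r0 rP; exists r.
pose r := Num.min dl r1; have r0 : 0 < r by rewrite lt_min dl0.
have rP : ball p r `<=` [set y | B y /\ 0 < a * pderiv i0 s y].
  by move=> y /ball_distP yr; apply: r1P; apply/ball_distP; apply: lt_le_trans yr _; rewrite ge_min lexx orbT.
pose rho := r / 3; have rho0 : 0 < rho by rewrite divr_gt0.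
have inb y t : ball p rho y -> `|t| <= rho -> ball p r (y + t *: e0).
  move=> /ball_distP yp tr; apply/ball_distP; rewrite addrAC.
  apply: le_lt_trans (ler_normD _ _) _; rewrite normrZ.
  have := @norm_delta_le R d i0; rewrite -/e0 => ne.
  have : `|t| * `|e0| <= rho by apply: le_trans tr; apply: ler_piMr ne; exact: normr_ge0.
  by move: yp; rewrite /rho; lra.
have inbc y t c : ball p rho y -> `|t| <= rho -> 0 <= c <= 1 -> ball p r (y + c *: (t *: e0)).
  move=> yp tr /andP[c0 c1]; rewrite scalerA; apply: inb => //.
  by rewrite normrM ger0_norm //; apply: le_trans tr; rewrite ler_piMl ?normr_ge0.
have pp : ball p rho p by apply/ball_distP; rewrite subrr normr0.
have nrho : `|rho| <= rho by rewrite gtr0_norm.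
have nrho' : `|- rho| <= rho by rewrite normrN.
have [c1 c101 E1] := smooth_line_incr (fun c cP => (rP _ (inbc p rho c pp nrho cP)).1).
have [c2 c201 E2] := smooth_line_incr (fun c cP => (rP _ (inbc p (- rho) c pp nrho' cP)).1).
have W (c : R) : 0 < c < 1 -> 0 <= c <= 1 by case/andP => *; rewrite !ltW.
have [_ P1] := rP _ (inbc p rho c1 pp nrho (W _ c101)).
have [_ P2] := rP _ (inbc p (- rho) c2 pp nrho' (W _ c201)).
rewrite sp subr0 in E1; rewrite sp subr0 in E2.
set b1 := pderiv i0 s _ in P1 E1; set b2 := pderiv i0 s _ in P2 E2.
have P12 : s (p + rho *: e0) * s (p + (- rho) *: e0) < 0.
  rewrite E1 E2; have : 0 < b1 * b2.
    have : 0 < (a * a) * (b1 * b2) by rewrite mulrACA mulr_gt0.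
    by rewrite pmulr_rgt0 // lt0r mulf_eq0 orbb -expr2 sqr_ge0 andbT s'0.
  move=> b12; rewrite mulrACA mulrN mulNr oppr_lt0 mulr_gt0 // mulr_gt0 //.
have nz1 : s (p + rho *: e0) != 0 by apply: contraTneq P12 => ->; rewrite mul0r ltxx.
have nz2 : s (p + (- rho) *: e0) != 0 by apply: contraTneq P12 => ->; rewrite mulr0 ltxx.
have /nbhs_ballP[q1 /= q10 q1P] := smooth_near_sign Ss (rP _ (inb p rho pp nrho)).1 nz1.
have /nbhs_ballP[q2 /= q20 q2P] := smooth_near_sign Ss (rP _ (inb p (- rho) pp nrho')).1 nz2.
apply/nbhs_ballP; exists (Num.min rho (Num.min q1 q2)).
  by rewrite /= !lt_min rho0 q10 q20.
move=> y /ball_distP; rewrite !lt_min => /and3P[y1 y2 y3].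
have yb : ball p rho y by apply/ball_distP.
have Q1 : 0 < s (p + rho *: e0) * s (y + rho *: e0).
  by apply: q1P; apply/ball_distP; rewrite opprD addrACA subrr addr0.
have Q2 : 0 < s (p + (- rho) *: e0) * s (y + (- rho) *: e0).
  by apply: q2P; apply/ball_distP; rewrite opprD addrACA subrr addr0.
have Q12 : s (y + rho *: e0) * s (y + (- rho) *: e0) < 0.
  rewrite -(nmulr_rgt0 _ P12); have := mulr_gt0 Q1 Q2; congr (0 < _); exact: mulrACA.
have [||| t tI st] := @IVT R (fun t => s (y + t *: e0)) (- rho) rho 0.
- by rewrite ge0_cp // ltW.
- apply: derivable_within_continuous => t; rewrite in_itv/= => tr.
  have [] // := @is_derive_line R d s y e0 t _.
  by apply: dS => //; apply: (rP _ (inb _ _ _ _)).1 => //; rewrite ler_norml.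
- rewrite ge_min le_max /=.
  have [y4|y4|y4] := ltgtP (s (y + rho *: e0)) 0.
  + by rewrite (nmulr_rlt0 _ y4) in Q12; rewrite (ltW Q12) ?orbT.
  + by rewrite (pmulr_rlt0 _ y4) in Q12; rewrite (ltW Q12) ?orbT.
  + by move: Q12; rewrite y4 mul0r ltxx.
have tr : `|t| <= rho by rewrite ler_norml; rewrite in_itv/= in tI.
exists t; split=> // c cP.
have /ball_distP yc := inbc y t c yb tr cP; apply/ball_distP; apply: lt_le_trans yc _.
by rewrite ge_min lexx.
Qed.

(** In the inductive step, Cauchy's mean value theorem compares v with s^(m+1) between y and a zero
    of s on the line through y along e0, where both vanish: v(y) / s(y)^(m+1) = T v(xi) / ((m+1)
    s(xi)^m). The bound on [T v] is used with the constant e (m+1) to absorb the denominator. *)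
Lemma flat_limit m v p (e : R) : S v -> flat m.+1 v -> B p -> s p = 0 -> 0 < e ->
  \forall y \near p, `|v y| <= e * `|s y| ^+ m.
Proof.
move=> + + Bp sp; elim: m v e => [|m IHm] v e Sv fv e_gt0.
  case: fv => v0 _; have := smooth_near Sv Bp e_gt0; rewrite v0 //.
  by apply: filterS => y; rewrite sub0r normrN expr0 mulr1 => /ltW.
case: (fv) => v0 fTv.
have nB : nbhs p B by exact: open_nbhs_nbhs.
have e'0 : 0 < e * m.+1%:R by rewrite mulr_gt0.
have STv : S (T v) by exact: Tder_smooth.
have N : nbhs p (B `&` [set y | `|T v y| <= e * m.+1%:R * `|s y| ^+ m]).
  exact: filterI nB (IHm _ _ STv fTv e'0).
case/nbhs_ballP: N => r /= r0 rP.
apply: filterS2 nB (zero_on_line Bp sp r0) => y By [t [st tP]].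
have [sy|sy] := eqVneq (s y) 0.
  by rewrite v0 // normr0 mulr_ge0 // ltW.
have BP c : 0 <= c <= 1 -> B (y + c *: (t *: e0)) by move=> /tP /rP [].
pose ca : V -> R := cst (s y ^+ m.+1); pose cb : V -> R := cst (v y).
have Sca : S ca by exact: smooth_on_cst.
have Scb : S cb by exact: smooth_on_cst.
have SsX : S (s ^+ m.+1) by exact: smooth_onX.
(* Cauchy's auxiliary function: it vanishes at y by construction, and at y + t e0 because v and s
   do. *)
pose g := v * ca - s ^+ m.+1 * cb.
have Sg : S g by apply: smooth_onB => //; exact: smooth_onM.
have [c c01 E] := smooth_MVT Sg BP.
have c01' : 0 <= c <= 1 by case/andP: c01 => *; rewrite !ltW.
have By' : B (y + t *: e0) by have := BP 1; rewrite scale1r ler01 lexx; exact.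
have t0 : t != 0 by apply: contra_neq sy => t0; rewrite t0 scale0r addr0 in st.
set xi := y + c *: (t *: e0) in E; have Bxi : B xi by exact: BP.
have dg : differentiable g xi by exact: dS.
have E0 : pderiv i0 g xi = 0.
  apply: (mulfI t0); rewrite mulr0 -deriveZr // -E /g /ca /cb !fctE /=.
  rewrite (v0 _ By') // st expr0n /=; ring.
have TX k x : B x -> pderiv i0 (s ^+ k.+1) x = k.+1%:R * s x ^+ k * pderiv i0 s x.
  move=> Bx; elim: k => [|k IHk]; first by rewrite expr1 expr0; ring.
  rewrite exprS pderivM; [|exact: dS|by apply: dS => //; exact: smooth_onX].
  by rewrite IHk exprfctE !exprS -[in RHS]natr1; ring.
have E1 : T v xi * s y ^+ m.+1 = m.+1%:R * s xi ^+ m * v y.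
  apply: (mulIf (s'0 Bxi)); rewrite {1}/Tder mulrAC divfK ?s'0 //.
  move: E0; rewrite /g pderivB; [|by apply: dS => //; exact: smooth_onM..].
  rewrite !pderivM; try exact: dS.
  rewrite TX // /ca /cb !pderiv_cst !mulr0 !addr0 => /eqP; rewrite subr_eq0 => /eqP.
  by move=> EE; apply: etrans EE _; rewrite /cst; ring.
have [_ Hxi] := rP _ (tP _ c01').
(* The derivative of s along the line has no zero, so s cannot vanish both at y + t e0 and at the
   interior point xi. *)
have sxi : s xi != 0.
  apply/negP => /eqP sxi.
  have BP2 k : 0 <= k <= 1 -> B (xi + k *: (((1 - c) * t) *: e0)).
    move=> /andP[k0 k1]; rewrite /xi -addrA !scalerA -scalerDl.
    have -> : c * t + k * ((1 - c) * t) = (c + k * (1 - c)) * t by ring.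
    rewrite -scalerA; apply: BP; case/andP: c01' => *; apply/andP; split; nra.
  have [k k01] := smooth_line_incr BP2.
  rewrite sxi {1}/xi !scalerA -addrA -scalerDl (_ : c * t + _ = t); last ring.
  rewrite st subr0 => /esym /eqP; rewrite mulf_eq0 (negPf (s'0 _)); last first.
    by rewrite -scalerA; apply: BP2; case/andP: k01 => *; rewrite !ltW.
  rewrite orbF mulf_eq0 (negPf t0) orbF subr_eq0 => /eqP c1.
  by move: c01; rewrite -c1 ltxx andbF.
have key : m.+1%:R * `|s xi| ^+ m * `|v y| <= e * m.+1%:R * `|s xi| ^+ m * `|s y| ^+ m.+1.
  have <- : `|T v xi * s y ^+ m.+1| = m.+1%:R * `|s xi| ^+ m * `|v y|.
    by rewrite E1 !normrM normr_nat normrX.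
  by rewrite normrM normrX ler_wpM2r // exprn_ge0.
have pos : 0 < m.+1%:R * `|s xi| ^+ m by rewrite mulr_gt0 // exprn_gt0 // normr_gt0.
by rewrite -(ler_pM2l pos); apply: le_trans key _; rewrite le_eqVlt; apply/orP; left; apply/eqP; ring.
Qed.

Let ST f : S f -> S (T f).
Proof. exact: Tder_smooth. Qed.

Let Sp j f : S f -> S (pderiv j f).
Proof. exact: smooth_on_pderiv. Qed.

Let SM f g : S f -> S g -> S (f * g).
Proof. exact: smooth_onM. Qed.

(** By [flat_limit] v is o(s^(m+1)), hence z, which is bounded by v / s^m, is o(s). *)
Lemma flat_small m v p : S v -> flat m.+2 v -> B p -> s p = 0 -> forall z, z p = 0 ->
  (forall y, B y -> `|z y| * `|s y| ^+ m <= `|v y|) ->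
  (forall y, B y -> s y = 0 -> z y = 0) ->
  differentiable z p /\ forall j, pderiv j z p = 0.
Proof.
move=> Sv fv Bp sp z zp zv z0.
apply: (little_o_diff (dS Ss Bp) sp zp _) => e e_gt0.
have nB : nbhs p B by exact: open_nbhs_nbhs.
apply: filterS2 nB (flat_limit Sv fv Bp sp e_gt0) => y By vy.
have [sy|sy] := eqVneq (s y) 0; first by rewrite z0 // normr0 mulr_ge0 // ltW.
have pos : 0 < `|s y| ^+ m by rewrite exprn_gt0 // normr_gt0.
rewrite -(ler_pM2r pos); apply: le_trans (zv _ By) _; apply: le_trans vy _.
by rewrite exprS mulrA.
Qed.

(** The function v - s T v is flat to order 2, so its differential vanishes at p; there this reads
    dv = T v ds. *)
Lemma pderiv_zero_set j v p : S v -> (forall y, B y -> s y = 0 -> v y = 0) -> B p -> s p = 0 ->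
  pderiv j v p = pderiv j s p * T v p.
Proof.
move=> Sv v0 Bp sp; pose u := v - s * T v.
have Su : S u by apply: smooth_onB => //; exact: SM (ST Sv).
have u0 y : B y -> s y = 0 -> u y = 0.
  by move=> By sy; rewrite /u !fctE v0 // sy mul0r subr0.
have fu : flat 2 u.
  split=> //; split=> // y By sy.
  rewrite TderB //; last exact: SM (ST Sv).
  rewrite TderM //; last exact: ST.
  by rewrite Tder_s // mul1r sy mul0r addr0 subrr.
have [y By|_ /(_ j)] := flat_small Su fu Bp sp (u0 _ Bp sp) _ u0.
  by rewrite expr0 mulr1.
rewrite /u pderivB; [|exact: dS|by apply: dS => //; exact: SM (ST Sv)].
rewrite pderivM; [|exact: dS|by apply: dS => //; exact: ST].
by rewrite sp mul0r addr0 => /eqP; rewrite subr_eq0 => /eqP.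
Qed.

Definition tander j f : V -> R := pderiv j f - pderiv j s * T f.

Lemma tander_smooth j f : S f -> S (tander j f).
Proof. by move=> Sf; apply: smooth_onB => //; [exact: Sp|exact: SM (Sp _ Ss) (ST Sf)]. Qed.

(** The two operators are coordinate derivatives in one coordinate system, so they commute; in the
    original coordinates this comes down to [pderivC] for f and for s. *)
Lemma Tder_tander j f x : S f -> B x -> T (tander j f) x = tander j (T f) x.
Proof.
move=> Sf Bx; rewrite /tander.
have Sjs := Sp j Ss; have STf := ST Sf.
rewrite TderB //; [|exact: Sp|exact: SM].
rewrite TderM //.
pose r : V -> R := fun y => (pderiv i0 s y)^-1.
have Sr' : S r by exact: Sr.
have si0 : differentiable (pderiv i0 s) x by apply: dS => //; exact: Sp.
have Dr : pderiv j r x = - (r x * T (pderiv j s) x).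
  rewrite /r /pderiv deriveV; [|exact: s'0|exact: diff_derivable].
  rewrite -/(pderiv j (pderiv i0 s) x) -/(pderiv i0 s) (pderivC _ _ oB Ss Bx).
  by rewrite /Tder /GRing.scale /= mulNr expr2 invfM; congr (- _); ring.
have -> : (pderiv j (T f) - pderiv j s * T (T f)) x =
   pderiv j (pderiv i0 f * r) x - pderiv j s x * T (T f) x by [].
rewrite pderivM; [|by apply: dS => //; exact: Sp|exact: dS].
rewrite (pderivC _ _ oB Sf Bx) Dr.
rewrite (_ : T (pderiv j f) x = pderiv i0 (pderiv j f) x * r x) //.
rewrite (_ : T f x = pderiv i0 f x * r x) //.
ring.
Qed.

Lemma flat_tander n j v : S v -> flat n v -> flat n (tander j v).
Proof.
elim: n v => [//|n IHn] v Sv [v0 fv]; split.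
  move=> y By sy; rewrite /tander !fctE; apply/eqP; rewrite subr_eq0; apply/eqP.
  exact: pderiv_zero_set.
have STv := ST Sv.
apply: (@flat_eq n (tander j (T v))); last exact: IHn.
by move=> x Bx; rewrite Tder_tander.
Qed.

(** Only the component of [pderiv j] along [T] costs an order of vanishing; the tangential component
    preserves it. *)
Lemma flat_pderiv n j v : S v -> flat n.+1 v -> flat n (pderiv j v).
Proof.
move=> Sv fv; have STv := ST Sv; have Sjs := Sp j Ss.
apply: (@flat_eq n (tander j v + pderiv j s * T v)).
  by move=> x Bx; rewrite /tander !fctE subrK.
apply: flatD => //; [exact: tander_smooth|exact: SM| |].
  by apply: flatW; exact: flat_tander.
by apply: flatM => //; case: fv.
Qed.

(* Quotients v / s^m that vanish to order N along s = 0. *)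
Definition Zclass N z : Prop := exists m v, [/\ S v, flat (m + N) v &
  forall y, B y -> z y = if s y == 0 then 0 else v y / s y ^+ m].

(** Two orders of vanishing beyond the denominator make z = v / s^m of size o(s) at the zeros of s;
    elsewhere z is an ordinary quotient. *)
Lemma Zclass_diff N z x : Zclass N.+2 z -> B x -> differentiable z x /\
  (s x = 0 -> forall j, pderiv j z x = 0).
Proof.
move=> [m [v [Sv fv zE]]] Bx; have [sx|sx] := eqVneq (s x) 0.
  suff [dz Dz] : differentiable z x /\ forall j, pderiv j z x = 0 by [].
  have zx : z x = 0 by rewrite zE // sx eqxx.
  have fv' : flat m.+2 v.
    elim: N fv {zE} => [|N IHN] fv; first by rewrite !addnS addn0 in fv.
    by apply: IHN; apply: flatW; rewrite -addnS.
  apply: (flat_small Sv fv' Bx sx zx) => y By; last by move=> sy; rewrite zE // sy eqxx.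
  rewrite zE //; case: eqVneq => [->|sy]; first by rewrite normr0 mul0r.
  by rewrite -normrX -normrM divfK // expf_neq0.
split=> [|sx0]; last by rewrite sx0 eqxx in sx.
have SX : S (s ^+ m) by exact: smooth_onX.
have dq : differentiable (v * (fun y => ((s ^+ m) y)^-1)) x.
  apply: differentiableM; first exact: dS.
  by apply: differentiableV; [exact: dS|rewrite exprfctE expf_neq0].
apply: near_eq_differentiable dq.
have nB : nbhs x B by exact: open_nbhs_nbhs.
apply: filterS2 nB (smooth_near_sign Ss Bx sx) => y By sxy.
have sy : s y != 0 by apply: contraTneq sxy => ->; rewrite mulr0 ltxx.
by rewrite zE // (negPf sy) !fctE.
Qed.

Lemma Zclass_pderiv N z j : Zclass N.+2 z -> Zclass N.+1 (pderiv j z).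
Proof.
move=> Zz; have [m [v [Sv fv zE]]] := Zz.
(* The numerator of the derivative of v / s^m over s^(m+1). Its first term loses one order through
   the derivative and regains it from the factor s, so the numerator is as flat as v; only the
   denominator has grown. *)
pose v' := s * pderiv j v - cst m%:R * (pderiv j s * v).
exists m.+1, v'; have Sjv := Sp j Sv; have Sjs := Sp j Ss.
have Sc : S (cst m%:R : V -> R) by exact: smooth_on_cst.
split.
- by apply: smooth_onB => //; [exact: SM|apply: SM => //; exact: SM].
- apply: flatB => //; [exact: SM|by apply: SM => //; exact: SM| |].
    rewrite addSn; apply: flat_s => //; apply: flat_pderiv => //.
    by rewrite -addnS.
  rewrite addSn -addnS; apply: flatM => //; first exact: SM.
  by apply: flatM.
move=> y By; case: eqVneq => [sy|sy].
  by have [_ ->] := Zclass_diff Zz By.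
have SX : S (s ^+ m) by exact: smooth_onX.
have sXy : (s ^+ m) y != 0 by rewrite exprfctE expf_neq0.
pose q : V -> R := fun y => ((s ^+ m) y)^-1.
have dq : differentiable q y by apply: differentiableV => //; exact: dS.
have -> : pderiv j z y = pderiv j (v * q) y.
  apply: near_eq_derive.
  have nB : nbhs y B by exact: open_nbhs_nbhs.
  apply: filterS2 nB (smooth_near_sign Ss By sy) => t Bt syt.
  have st : s t != 0 by apply: contraTneq syt => ->; rewrite mulr0 ltxx.
  by rewrite zE // (negPf st) /q !fctE.
rewrite pderivM //; last exact: dS.
have pX : pderiv j (s ^+ m) y * s y = m%:R * s y ^+ m * pderiv j s y.
  elim: (m) => [|k IHk]; first by rewrite expr0 (pderiv_cst _ 1) !mul0r.
  rewrite exprS pderivM; [|exact: dS|by apply: dS => //; exact: smooth_onX].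
  by rewrite mulrDl -[X in _ + X]mulrA IHk exprfctE !exprS -[in RHS]natr1; ring.
have -> : pderiv j q y = - (m%:R * pderiv j s y / s y ^+ m.+1).
  have -> : pderiv j q y = - ((s ^+ m) y) ^- 2 * pderiv j (s ^+ m) y.
    by rewrite /pderiv /q deriveV //; apply: diff_derivable; exact: dS.
  have -> : pderiv j (s ^+ m) y = m%:R * s y ^+ m * pderiv j s y / s y.
    by rewrite -pX mulfK.
  rewrite exprfctE.
  have sm : s y ^+ m != 0 by rewrite expf_neq0.
  rewrite [s y ^+ m.+1]exprS; move: (s y ^+ m) (m%:R : R) sm => X c X0.
  by field; rewrite X0 sy.
have sm : s y ^+ m != 0 by rewrite expf_neq0.
rewrite /q /v' !fctE [s y ^+ m.+1]exprS; move: (s y ^+ m) (m%:R : R) sm => X c X0.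
by rewrite /=; field; rewrite X0 sy.
Qed.

Lemma Taylor_approx u N : S u -> (forall y, B y -> s y = 0 -> u y = 0) ->
  exists2 a, S a & flat N.+1 (u - s * a).
Proof.
move=> Su u0; elim: N => [|N [a Sa fa]].
  exists (cst 0); first exact: smooth_on_cst.
  by split=> // y By sy; rewrite !fctE u0 // sy mul0r subr0.
have Sua : S (u - s * a) by apply: smooth_onB => //; exact: SM.
have [w Sw fw] := flat_taylor Sua fa.
have SX : S (s ^+ N) by exact: smooth_onX.
exists (a + s ^+ N * w); first by apply: smooth_onD => //; exact: SM.
by rewrite mulrDr opprD addrA [s * (_ * _)]mulrA -exprS.
Qed.

(* The functions that are, for every N, the sum of a smooth function and of an
   element of [Zclass N] are differentiable and stable under [pderiv]; u / s is
   one of them by Taylor expansion along s = 0. *)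
Lemma local_division_smooth u : S u -> (forall y, B y -> s y = 0 -> u y = 0) ->
  S (fun y => if s y == 0 then T u y else u y / s y).
Proof.
move=> Su u0.
apply: (@smooth_on_coind _ _ B [set h | forall N, exists a z,
   [/\ S a, Zclass N z & forall y, B y -> h y = a y + z y]]) => //.
(* The remainder in [Zclass 2] is already differentiable. *)
- move=> h /(_ 2) [a [z [Sa Zz hE]]] x Bx.
  have daz : differentiable (a + z) x.
    by apply: differentiableD; [exact: dS|have [] := Zclass_diff Zz Bx].
  apply: near_eq_differentiable daz.
  by apply: near_open Bx _ => // y By; rewrite hE.
- move=> h j Ch; exists (pderiv j h); last by [].
  move=> N; have [a [z [Sa Zz hE]]] := Ch N.+2.
  have [m [v [Sv fv zE]]] := Zclass_pderiv j Zz.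
  exists (pderiv j a), (pderiv j z); split.
  + exact: Sp.
  + by exists m, v; split=> //; apply: flatW; rewrite -addnS.
  + move=> y By; rewrite (pderiv_eq_on _ oB (g := a + z) _ By) //.
    by apply: pderivD; [exact: dS|have [] := Zclass_diff Zz By].
(* One order more than [Zclass N] asks for: u - s a is then flat to order at least 2 even when N =
   0, which gives a = T u along s = 0. *)
- move=> N; have [a Sa fa] := Taylor_approx N.+1 Su u0.
  exists a, (fun y => if s y == 0 then 0 else (u - s * a) y / s y ^+ 1); split=> //.
    exists 1%N, (u - s * a); split=> //; last by apply: flatW.
    by apply: smooth_onB => //; exact: SM.
  move=> y By; case: eqVneq => sy.
    case: fa => _ [/(_ y By sy)].
    rewrite TderB ?TderM ?Tder_s //; last exact: SM.
    by rewrite sy mul0r addr0 mul1r addr0 => /eqP; rewrite subr_eq0 => /eqP.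
  by rewrite expr1 !fctE; field.
Qed.

End local_division.

Section division.
Context {R : realType} {d : nat}.
Local Notation V := 'rV[R]_d.

(* Where s vanishes and u too, the ratio does not depend on the choice of i. *)
Definition divf (u s : V -> R) : V -> R := fun y =>
  if s y == 0 then
    if [pick i | pderiv i s y != 0] is Some i then pderiv i u y / pderiv i s y else 0
  else u y / s y.

Lemma smooth_on_divf (U : set V) (u s : V -> R) : open U -> smooth_on U u -> smooth_on U s ->
  (forall x, U x -> s x = 0 -> u x = 0 /\ exists i, pderiv i s x != 0) ->
  smooth_on U (divf u s).
Proof.
move=> oU Su Ss H; apply: smooth_on_local => x Ux.
have nU : nbhs x U by exact: open_nbhs_nbhs.
have [sx|sx] := eqVneq (s x) 0; last first.
  have /nbhs_ballP[r /= r0 rP] : nbhs x (U `&` [set y | 0 < s x * s y]).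
    exact: filterI nU (smooth_near_sign Ss Ux sx).
  exists (ball x r); first exact: ballxx.
  have oB : open (ball x r) by exact: ball_open.
  have s0 y : ball x r y -> s y != 0.
    by move=> /rP [_ /= sxy]; apply: contraTneq sxy => ->; rewrite mulr0 ltxx.
  have sub : ball x r `<=` U by move=> y /rP [].
  apply: (@smooth_on_eq _ _ _ (u * (fun y => (s y)^-1))) => //.
    by move=> y /s0 sy; rewrite /divf (negPf sy).
  apply: smooth_onM => //; first exact: smooth_on_sub Su.
  by apply: smooth_onV => //; exact: smooth_on_sub Ss.
have [_ [i si]] := H x Ux sx.
have /nbhs_ballP[r /= r0 rP] : nbhs x (U `&` [set y | 0 < pderiv i s x * pderiv i s y]).
  exact: filterI nU (smooth_near_sign (smooth_on_pderiv i Ss) Ux si).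
exists (ball x r); first exact: ballxx.
have oB : open (ball x r) by exact: ball_open.
have s0 y : ball x r y -> pderiv i s y != 0.
  by move=> /rP [_ /= sxy]; apply: contraTneq sxy => ->; rewrite mulr0 ltxx.
have sub : ball x r `<=` U by move=> y /rP [].
have SuB := smooth_on_sub sub Su; have SsB := smooth_on_sub sub Ss.
have u0 y : ball x r y -> s y = 0 -> u y = 0 by move=> /sub Uy sy; have [] := H y Uy sy.
apply: smooth_on_eq (local_division_smooth oB SsB s0 SuB u0) => //.
move=> y By; rewrite /divf; case: eqVneq => // sy; case: pickP => [j sj|/(_ i)].
  by rewrite (pderiv_zero_set oB SsB s0 j SuB u0 By sy) mulrAC mulfV // mul1r.
by rewrite s0.
Qed.

Lemma divfK_on (u s : V -> R) x : (s x = 0 -> u x = 0) -> u x = s x * divf u s x.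
Proof.
move=> H; rewrite /divf; case: eqVneq => [sx|sx]; first by rewrite H // sx mul0r.
by rewrite mulrCA mulfV // mulr1.
Qed.

End division.

(** * Composition, Hadamard's lemma and bump functions *)

Section composition.
Context {R : realType} {d m : nat}.
Local Notation V := 'rV[R]_d.
Local Notation W := 'rV[R]_m.
Implicit Types (U : set V) (A : set W) (h : V -> R) (f : W -> R) (phi : V -> W).

Lemma differentiable_rV phi x : (forall i, differentiable (fun y => phi y 0 i) x) ->
  differentiable phi x.
Proof.
move=> dphi; rewrite (_ : phi = \sum_(i < m) (fun y => phi y 0 i *: (delta_mx 0 i : W))).
  by apply: differentiable_sum => i; exact: differentiableZl.
by apply/funext => y; rewrite fct_sumE [LHS]row_sum_delta.
Qed.

Lemma pderiv_comp phi f x j : (forall i, differentiable (fun y => phi y 0 i) x) ->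
  differentiable f (phi x) ->
  pderiv j (f \o phi) x = \sum_(i < m) pderiv j (fun y => phi y 0 i) x * pderiv i f (phi x).
Proof.
move=> dphi df; have dp := differentiable_rV dphi.
rewrite /pderiv deriveE; last exact: differentiable_comp.
rewrite diff_comp //= [X in 'd f _ X]row_sum_delta linear_sum.
apply: eq_bigr => i _; rewrite linearZ /= deriveE // deriveE //; congr (_ * _).
have dc : differentiable (fun N : W => N 0 i) (phi x) by exact: differentiable_coord.
have -> : (fun y => phi y 0 i) = (fun N : W => N 0 i) \o phi by [].
rewrite (diff_comp dp dc) /=.
have lf : linear (fun N : W => N 0 i) by move=> a u v; rewrite !mxE.
pose g : {linear W -> R} := HB.pack (fun N : W => N 0 i) (GRing.isLinear.Build R W R _ _ lf).
have -> : 'd (fun N : W => N 0 i) (phi x) = g :> (W -> R).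
  by apply: (@diff_lin _ _ _ g); exact: coord_continuous.
by [].
Qed.

Inductive mcompsum U A phi : (V -> R) -> Prop :=
| mcompsumM h f : smooth_on U h -> smooth_on A f -> mcompsum U A phi (h * (f \o phi))
| mcompsumD h1 h2 : mcompsum U A phi h1 -> mcompsum U A phi h2 -> mcompsum U A phi (h1 + h2).

(** By the chain rule, sums of products h * (f \o phi) with h and f smooth are stable under partial
    derivatives, as in the one-variable case. *)
Lemma smooth_on_comp U A phi f : open U -> (forall i, smooth_on U (fun y => phi y 0 i)) ->
  (forall x, U x -> A (phi x)) -> smooth_on A f -> smooth_on U (f \o phi).
Proof.
move=> oU Sphi UA Sf.
have dphi x i : U x -> differentiable (fun y => phi y 0 i) x.
  by move=> Ux; exact: (smooth_on_diff (Sphi i) Ux).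
have dC h : mcompsum U A phi h -> forall x, U x -> differentiable h x.
  elim=> [{}h {Sf}f Sh Sf|h1 h2 _ d1 _ d2] x Ux.
    apply: differentiableM; first exact: smooth_on_diff Ux.
    apply: differentiable_comp; last exact: smooth_on_diff (UA _ Ux).
    by apply: differentiable_rV => i; exact: dphi.
  by apply: differentiableD; [exact: d1|exact: d2].
rewrite -[f \o phi]mul1r.
apply: (@smooth_on_coind _ _ U (mcompsum U A phi)) => //; last first.
  by constructor => //; exact: (smooth_on_cst 1).
move=> h j; elim=> [{}h {Sf}f Sh Sf|h1 h2 C1 [k1 Ck1 E1] C2 [k2 Ck2 E2]]; last first.
  exists (k1 + k2); first by constructor.
  move=> x Ux; rewrite -[RHS]/(k1 x + k2 x) -(E1 x Ux) -(E2 x Ux).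
  by rewrite inE in Ux; apply: pderivD; exact: dC Ux.
exists (pderiv j h * (f \o phi) +
  \sum_(i < m) (h * pderiv j (fun y => phi y 0 i)) * (pderiv i f \o phi)).
  constructor; first by constructor => //; exact: smooth_on_pderiv.
  elim/big_ind: _ => [|h1 h2 C1 C2|i _].
  - by rewrite -[0](mul0r (f \o phi)); constructor => //; exact: (smooth_on_cst 0).
  - by constructor.
  - constructor; last exact: smooth_on_pderiv.
    by apply: smooth_onM => //; exact: smooth_on_pderiv.
move=> x; rewrite inE => Ux.
have df : differentiable f (phi x) := smooth_on_diff Sf (UA _ Ux).
rewrite pderivM; [|exact: smooth_on_diff Ux|apply: differentiable_comp => //].
  rewrite pderiv_comp //; last by move=> i; exact: dphi.
  rewrite -[RHS]/(_ + (\sum_(i < m) _) x) fct_sumE mulr_sumr; congr (_ + _).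
  by apply: eq_bigr => i _; rewrite !fctE /= mulrA.
by apply: differentiable_rV => i; exact: dphi.
Qed.

End composition.

Section hadamard.
Context {R : realType} {d : nat}.
Local Notation V := 'rV[R]_d.

(** Changing the coordinates of p into those of y one at a time makes f y - f p telescope. The k-th
    increment vanishes where y_k = p_k, and [smooth_on_divf] divides it by y_k - p_k. *)
Lemma Hadamard (x0 : V) (r : R) (f : V -> R) (p : V) :
  smooth_on (ball x0 r) f -> ball x0 r p ->
  exists F : 'I_d -> V -> R, [/\ forall k, smooth_on (ball x0 r) (F k),
    forall y, ball x0 r y -> f y = f p + \sum_(k < d) (y 0 k - p 0 k) * F k y &
    forall k, F k p = pderiv k f p].
Proof.
move=> Sf Bp; set B := ball x0 r; have oB : open B by exact: ball_open.
pose mix (k : nat) (y : V) : V := \row_j (if (j < k)%N then y 0 j else p 0 j).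
(* A ball of the maximum norm is a cube, so it is closed under exchanging coordinates between two of
   its points. *)
have mixB k y : B y -> B (mix k y).
  move=> /ball_distP By; move/ball_distP: (Bp) => Bp'; apply/ball_distP.
  have r0 : 0 < r := le_lt_trans (normr_ge0 _) By.
  apply: rV_norm_lt => // i; rewrite !mxE; case: ifP => _.
    by apply: le_lt_trans By; have := rV_coord_le (y - x0) i; rewrite !mxE.
  by apply: le_lt_trans Bp'; have := rV_coord_le (p - x0) i; rewrite !mxE.
have Sm k : smooth_on B (f \o mix k).
  apply: (@smooth_on_comp _ _ _ B B) => //; last exact: mixB.
  move=> i; case: (ltnP i k) => ik.
    rewrite (_ : (fun y => _) = (fun y : V => y 0 i)); first exact: smooth_on_coord.
    by apply/funext => y; rewrite mxE ik.
  rewrite (_ : (fun y => _) = cst (p 0 i)); first exact: smooth_on_cst.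
  by apply/funext => y; rewrite mxE ltnNge ik.
pose s (k : 'I_d) : V -> R := fun y => y 0 k - p 0 k.
have Ss k : smooth_on B (s k).
  by apply: smooth_onB => //; [exact: smooth_on_coord|exact: (smooth_on_cst (p 0 k))].
have ps (k i : 'I_d) y : pderiv i (s k) y = (i == k)%:R.
  rewrite [LHS](@pderivB _ _ i (fun y : V => y 0 k) (cst (p 0 k))); first by rewrite pderiv_coord pderiv_cst subr0.
    exact: differentiable_coord.
  exact: differentiable_cst.
pose u (k : 'I_d) : V -> R := (f \o mix k.+1) - (f \o mix k).
have Su k : smooth_on B (u k) by apply: smooth_onB.
have u0 (k : 'I_d) y : s k y = 0 -> u k y = 0.
  move=> /eqP; rewrite /s subr_eq0 => /eqP yk; rewrite /u !fctE /=.
  apply/eqP; rewrite subr_eq0; apply/eqP; congr (f _); apply/rowP => j; rewrite !mxE ltnS.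
  rewrite leq_eqVlt; case: eqP => //= jk; rewrite (val_inj jk) ltnn //.
pose F k := divf (u k) (s k).
have SF k : smooth_on B (F k).
  apply: smooth_on_divf => // x Bx sx; split; first exact: u0.
  by exists k; rewrite ps eqxx oner_neq0.
have mix0 y : mix 0%N y = p by apply/rowP => j; rewrite mxE.
have mixd y : mix d y = y by apply/rowP => j; rewrite mxE ltn_ord.
have E y : B y -> f y = f p + \sum_(k < d) (y 0 k - p 0 k) * F k y.
  move=> By; rewrite (eq_bigr (fun k : 'I_d => f (mix k.+1 y) - f (mix k y))); last first.
    by move=> k _; rewrite /F -[_ - p 0 k]/(s k y) -divfK_on //; exact: u0.
  by rewrite -(big_mkord xpredT (fun k => f (mix k.+1 y) - f (mix k y))) telescope_sumr // mix0 mixd addrC subrK.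
exists F; split => // i.
have dF k : differentiable (F k) p by exact: smooth_on_diff (SF k) Bp.
have ds k : differentiable (s k) p by exact: smooth_on_diff (Ss k) Bp.
have -> : pderiv i f p = pderiv i (cst (f p) + \sum_(k < d) s k * F k) p.
  apply: pderiv_eq_on oB _ _ Bp => y By.
  by rewrite E // !fctE fct_sumE.
rewrite pderivD; [|exact: differentiable_cst|].
  rewrite pderiv_cst add0r /pderiv derive_sum; last first.
    by move=> k; apply: diff_derivable; exact: differentiableM.
  rewrite (bigD1 i) //= big1 ?addr0.
    by rewrite -/(pderiv i _ p) pderivM // ps eqxx mul1r /s subrr mul0r addr0.
  move=> k ki; rewrite -/(pderiv i _ p) pderivM // ps eq_sym (negPf ki) mul0r.
  by rewrite /s subrr mul0r addr0.
by apply: differentiable_sum => k; exact: differentiableM.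
Qed.

End hadamard.

Section bump.
Context {R : realType}.

(** The cutoff function exp(-1/t) is the case n = 0; the other n make the family closed under
    derivation up to linear combinations. *)
Definition flat_exp (n : nat) : R -> R := fun t => if 0 < t then t ^- n * expR (- t^-1) else 0.

(** For t > 0, exp(1/t) is the power n + 2 of exp(1/((n+2) t)), and 1 + x <= exp x bounds it below
    by ((n+2) t)^-(n+2). The two powers of t left over give the zero derivative at 0. *)
Lemma flat_exp_bound n (t : R) : `|flat_exp n t| <= n.+2%:R ^+ n.+2 * t ^+ 2.
Proof.
rewrite /flat_exp; case: ifPn => t0; last first.
  by rewrite normr0; apply: mulr_ge0; [exact: exprn_ge0|exact: sqr_ge0].
have m0 : 0 < n.+2%:R :> R by [].
have F0 : 0 <= t ^- n * expR (- t^-1).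
  by apply: mulr_ge0; [rewrite invr_ge0 exprn_ge0 // ltW|exact: expR_ge0].
rewrite (ger0_norm F0).
have key : (n.+2%:R * t) ^- n.+2 <= expR t^-1.
  have -> : expR t^-1 = expR (n.+2%:R * t)^-1 ^+ n.+2.
    by rewrite -expRM_natl invfM mulrA mulfV ?mul1r // gt_eqF.
  have i0 : 0 <= (n.+2%:R * t)^-1 by rewrite invr_ge0 mulr_ge0 // ltW.
  rewrite -exprVn; apply: lerXn2r; rewrite ?nnegrE ?expR_ge0 //.
  by apply: (le_trans _ (expR_ge1Dx _)); rewrite lerDr.
have mt : 0 < n.+2%:R * t by rewrite mulr_gt0.
have key' : expR (- t^-1) <= (n.+2%:R * t) ^+ n.+2.
  rewrite expRN -[leRHS]invrK lef_pV2 // posrE; first exact: expR_gt0.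
  by rewrite invr_gt0 exprn_gt0.
have -> : t ^- n * expR (- t^-1) = expR (- t^-1) / t ^+ n by rewrite mulrC.
rewrite ler_pdivrMr ?exprn_gt0 // -mulrA -exprD add2n -exprMn.
exact: key'.
Qed.

Lemma flat_exp_derive n (t : R) : is_derive t 1 (flat_exp n) (flat_exp n.+2 t - n%:R * flat_exp n.+1 t).
Proof.
have [t0|t0|->] := ltgtP t 0.
- have -> : flat_exp n.+2 t - n%:R * flat_exp n.+1 t = 0.
    by rewrite /flat_exp ltNge (ltW t0) mulr0 subr0.
  have N : \near t, cst 0 t = flat_exp n t.
    near=> y; rewrite /flat_exp ltNge ltW //; near: y; exact: lt_nbhsl.
  exact: near_eq_is_derive N (is_derive_cst _ _ _).
- rewrite /flat_exp t0.
  have N : \near t, t ^- n * expR (- t^-1) = (if 0 < t then t ^- n * expR (- t^-1) else 0).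
    near=> y; rewrite (_ : 0 < y) //; near: y; exact: lt_nbhsr.
  apply: near_eq_is_derive N _.
  have tn0 : t != 0 by rewrite gt_eqF.
  have tX0 : t ^+ n != 0 by rewrite expf_neq0.
  have dX : derivable (fun y : R => y ^+ n) t 1 by exact: exprn_derivable.
  have dV := @derivableV R R (fun y : R => y ^+ n) t 1 tX0 dX.
  have di : is_derive t (1 : R) (fun y : R => - y^-1) (t ^- 2).
    apply: is_derive_eq; first by apply: is_deriveN; exact: is_deriveV.
    by rewrite /GRing.scale /= mulr1 opprK.
  have de : is_derive t (1 : R) (fun y : R => expR (- y^-1)) (t ^- 2 * expR (- t^-1)).
    rewrite mulrC; apply: (@is_derive1_comp R expR (fun y : R => - y^-1)).
  have dV' : is_derive t (1 : R) (fun y : R => y ^- n) (- (t ^+ n) ^- 2 * (n%:R * t ^+ n.-1)).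
    split=> //; rewrite (@deriveV R R (fun y : R => y ^+ n) t 1 tX0 dX) (@exp_derive R n t 1).
    by rewrite /GRing.scale /= mulr1.
  have M := @is_deriveM R R (fun y : R => y ^- n) (fun y : R => expR (- y^-1)) t 1 _ _ dV' de.
  apply: (is_derive_eq M).
  rewrite /GRing.scale /=.
  case: n tX0 {dX dV dV' M} => [|n] tX0; first by rewrite !mul0r mulr0 mulr0 addr0 subr0 expr0 invr1 mul1r.
  have tn : t ^+ n != 0 by rewrite expf_neq0.
  move: (expR _) => e; rewrite /= !exprS expr0 mulr1; move: (t ^+ n) (n.+1%:R : R) tn => X c X0.
  by field; rewrite X0 tn0.
have F0 k : flat_exp k 0 = 0 by rewrite /flat_exp ltxx.
rewrite !F0 mulr0 subr0.
suff C : (fun h : R => h^-1 *: ((flat_exp n \o shift 0) (h *: 1) - flat_exp n 0)) @ 0^' --> (0 : R).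
  by split; [exact: cvgP C|exact: cvg_lim C].
apply/cvgrPdist_le => e e0; rewrite F0.
pose K : R := n.+2%:R ^+ n.+2; have K0 : 0 < K by rewrite exprn_gt0.
near=> h.
have h0 : h != 0 by near: h; exact: nbhs_dnbhs_neq.
have hK : `|h| <= e / K.
  near: h; apply: nbhs_dnbhs.
  by apply/nbhs_ballP; exists (e / K) => /=; [rewrite divr_gt0|move=> y; rewrite /ball /= sub0r normrN => /ltW].
rewrite sub0r normrN /= addr0 subr0 [h%:A]mulr1 normrZ.
rewrite normfV ler_pdivrMl ?normr_gt0 //.
apply: le_trans (flat_exp_bound n h) _; rewrite -/K -(real_normK (num_real h)).
by rewrite expr2 mulrCA ler_wpM2l // mulrC -ler_pdivlMr.
Unshelve. all: by end_near. Qed.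

Context {d : nat}.
Local Notation V := 'rV[R]_d.

Definition bump_fun (x : V) (r : R) : V -> R :=
  flat_exp 0 \o (cst (r ^+ 2) - \sum_(k < d) (fun y : V => (y 0 k - x 0 k) ^+ 2)).

Lemma bump_fun_smooth (U : set V) x r : open U -> smooth_on U (bump_fun x r).
Proof.
move=> oU.
apply: (@smooth_on_comp1 _ _ [set phi | exists a n, phi = (fun t : R => a * flat_exp n t)] setT) => //.
- move=> _ [a [n ->]] t _; have [dn _] := flat_exp_derive n t.
  by apply: derivableM => //; exact: derivable_cst.
- move=> _ [a [n ->]]; exists (fun t : R => a * flat_exp n.+2 t), (fun t : R => - (a * n%:R) * flat_exp n.+1 t).
  split; [by eexists; eexists..|].
  move=> t _; have [dn En] := flat_exp_derive n t.
  rewrite derive1E (@deriveMl R R (flat_exp n) a t 1 dn) En; ring.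
- apply: smooth_onB => //; first exact: (smooth_on_cst (r ^+ 2)).
  apply: smooth_on_sum => // k.
  rewrite (_ : (fun y => _) = ((fun y : V => y 0 k) - cst (x 0 k)) ^+ 2); last first.
    by apply/funext => y; rewrite exprfctE.
  apply: smooth_onX => //; apply: smooth_onB => //; first exact: smooth_on_coord.
  exact: (smooth_on_cst (x 0 k)).
- by exists 1, 0%N; apply/funext => t; rewrite mul1r.
Qed.

Lemma bump_fun_neq0 x r : 0 < r -> bump_fun x r x != 0.
Proof.
move=> r0; rewrite /bump_fun /= !fctE fct_sumE big1 ?subr0; last first.
  by move=> k _; rewrite subrr expr0n.
by rewrite /flat_exp exprn_gt0 // expr0 invr1 mul1r gt_eqF // expR_gt0.
Qed.

Lemma bump_fun_supp x r y : 0 < r -> bump_fun x r y != 0 -> forall k, `|y 0 k - x 0 k| < r.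
Proof.
move=> r0; rewrite /bump_fun /= !fctE fct_sumE /flat_exp; case: ifPn; last by rewrite eqxx.
rewrite subr_gt0 => H _ k.
rewrite -(@ltr_pXn2r _ 2) ?nnegrE ?normr_ge0 ?(ltW r0) // real_normK ?num_real //.
apply: le_lt_trans H; rewrite (bigD1 k) //= lerDl sumr_ge0 // => i _; exact: sqr_ge0.
Qed.

End bump.

(** * Functions and vector fields on a manifold *)

Section smooth_functions.
Context {R : realType} {d : nat} {M : manifold R d}.
Local Notation V := 'rV[R]_d.
Local Notation smf := (smf M).
Implicit Types (f g u s : smf) (x : M) (c : chart R d M).

Lemma smfD f g x : (f + g) x = f x + g x. Proof. by []. Qed.
Lemma smfM f g x : (f * g) x = f x * g x. Proof. by []. Qed.
Lemma smfN f x : (- f) x = - f x. Proof. by []. Qed.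
Lemma smf1 x : (1 : smf) x = 1. Proof. by []. Qed.
Lemma smfcE a x : (a%:S : smf) x = a. Proof. by []. Qed.

Lemma smfX f n x : (f ^+ n) x = f x ^+ n.
Proof. by elim: n => [//|n IHn]; rewrite !exprS smfM IHn. Qed.

Lemma smf_sum (I : Type) (r : seq I) (P : pred I) (F : I -> smf) x :
  (\sum_(i <- r | P i) F i) x = \sum_(i <- r | P i) F i x.
Proof. by elim/big_rec2: _ => [//|i y1 y2 _ <-]; rewrite smfD. Qed.

Lemma smfP f c : atlas c -> smooth_on (cimg c) (f \o cinv c).
Proof. by have /asboolP Sf := smf_smooth f; exact: Sf. Qed.

Lemma chart_preimage_open c (O : set M) : open O -> open (cimg c `&` cinv c @^-1` O).
Proof.
move=> oO; rewrite openE => y [cy Oy].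
have ny : nbhs y (cimg c) by apply: open_nbhs_nbhs; split=> //; exact: cimg_open.
apply: filterI => //; apply: (cinv_cont cy).
exact: open_nbhs_nbhs.
Qed.

Lemma chart_near c x (O : set V) : cdom c x -> open O -> O (cmap c x) ->
  \forall z \near x, cdom c z /\ O (cmap c z).
Proof.
move=> cx oO Ox; apply: filterI; first by apply: open_nbhs_nbhs; split=> //; exact: cdom_open.
by apply: (cmap_cont cx); exact: open_nbhs_nbhs.
Qed.

Lemma smooth_continuous (f : M -> R) c x : cdom c x ->
  differentiable (f \o cinv c) (cmap c x) -> {for x, continuous f}.
Proof.
move=> cx df; have cf : {for cmap c x, continuous (f \o cinv c)} by exact: differentiable_continuous.
have H : {for x, continuous ((f \o cinv c) \o cmap c)}.
  by apply: continuous_comp => //; exact: cmap_cont.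
rewrite /prop_for /continuous_at in H *; rewrite /= (cmapK cx) in H.
apply: cvg_trans H; apply: near_eq_cvg.
have : nbhs x (cdom c) by apply: open_nbhs_nbhs; split=> //; exact: cdom_open.
by apply: filterS => z cz /=; rewrite cmapK.
Qed.

(** If all partial derivatives vanished in the chart c, the chain rule for the transition map would
    make them vanish in every chart at x. *)
Lemma dnonzero_chart f x c : dnonzero f x -> atlas c -> cdom c x ->
  exists i, pderiv i (f \o cinv c) (cmap c x) != 0.
Proof.
move=> [c' [Ac' c'x [i fi]]] Ac cx; apply: contrapT => H.
have f0 j : pderiv j (f \o cinv c) (cmap c x) = 0.
  by apply/eqP; apply: contra_notT H => fj; exists j.
move/eqP: fi; apply.
pose U := cimg c' `&` cinv c' @^-1` cdom c.
have oU : open U by apply: chart_preimage_open; exact: cdom_open.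
have Ux : U (cmap c' x) by split; [exact: cmapP|rewrite /= cmapK].
pose phi : V -> V := fun y => cmap c (cinv c' y).
have E y : U y -> ((f : M -> R) \o cinv c') y = ((f \o cinv c) \o phi) y.
  by move=> [_ cy] /=; rewrite /phi cmapK.
rewrite (pderiv_eq_on i oU E Ux) pderiv_comp.
- rewrite big1 // => j _; rewrite /phi cmapK // f0 mulr0 //.
- by move=> j; apply: smooth_on_diff (atlas_smooth Ac' Ac j) Ux.
- by rewrite /phi cmapK //; apply: smooth_on_diff (smfP f Ac) _; exact: cmapP.
Qed.

Lemma dnonzero_not_near0 f x : dnonzero f x -> ~ \forall z \near x, f z = 0.
Proof.
move=> [c [Ac cx [i fi]]] f0; move/eqP: fi; apply.
rewrite -(pderiv_cst i (0 : R) (cmap c x)); apply: near_eq_derive.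
have : {for cmap c x, continuous (cinv c)} by apply: cinv_cont; exact: cmapP.
rewrite /prop_for /continuous_at cmapK // => /(_ _ f0).
by [].
Qed.

(** Were A and B different at a zero x of s, they would differ near x by continuity, and s would
    vanish near x, against its nonzero differential. *)
Lemma dnonzero_cancel s (A B : M -> R) x : (s x = 0 -> dnonzero s x) ->
  {for x, continuous A} -> {for x, continuous B} ->
  (\forall z \near x, s z * A z = s z * B z) -> A x = B x.
Proof.
move=> s0 cA cB sAB.
have [sx|sx] := eqVneq (s x) 0; last first.
  exact: (mulfI sx (nbhs_singleton sAB)).
apply: contrapT => AB; apply: (dnonzero_not_near0 (s0 sx)).
have cAB : (fun z => A z - B z) @ x --> A x - B x by apply: cvgB; [exact: cA|exact: cB].
have AB0 : A x - B x != 0 by rewrite subr_eq0; apply/eqP.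
have /= N : \forall z \near x, A z - B z != 0 by exact: (cvgr_neq0 _ cAB AB0).
apply: filterS2 sAB N => z E zAB.
apply: (mulIf zAB); rewrite mul0r mulrBr E subrr //.
Qed.

Lemma smf_continuous f x : {for x, continuous f}.
Proof.
have [c Ac cx] := atlas_cover x.
apply: (smooth_continuous cx); apply: smooth_on_diff (smfP f Ac) _; exact: cmapP.
Qed.

Lemma smf_cancel s : (forall x, s x = 0 -> dnonzero s x) ->
  forall f g, s * f = s * g -> f = g.
Proof.
move=> s0 f g E; apply: smf_eqP => x.
apply: (@dnonzero_cancel s); [exact: s0|exact: smf_continuous..|].
by apply: filterE => z; rewrite -!smfM E.
Qed.

Lemma smf_of_charts (q : M -> R) : (forall c, atlas c -> smooth_on (cimg c) (q \o cinv c)) ->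
  q \in @smooth_pred R d M.
Proof. by move=> H; apply/asboolP. Qed.

Lemma smf_divide s u : (forall x, s x = 0 -> dnonzero s x /\ u x = 0) ->
  exists q : smf, u = s * q.
Proof.
move=> H.
have ex_chart x : exists c, atlas c /\ cdom c x by have [c] := atlas_cover x; exists c.
have [ch chP] := choice ex_chart.
pose qc c := divf (u \o cinv c) (s \o cinv c).
pose q (x : M) := qc (ch x) (cmap (ch x) x).
have Sqc c : atlas c -> smooth_on (cimg c) (qc c).
  move=> Ac; apply: smooth_on_divf (smfP u Ac) (smfP s Ac) _; first exact: cimg_open.
  move=> y cy /= sy; have [ds us] := H _ sy; split=> //.
  have [i] := dnonzero_chart ds Ac (cinvP cy); rewrite cinvK // => si.
  by exists i.
have qcE c z : atlas c -> cdom c z -> s z * qc c (cmap c z) = u z.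
  move=> Ac cz; have := @divfK_on R d (u \o cinv c) (s \o cinv c) (cmap c z).
  by rewrite /= cmapK // => ->// sz; have [] := H _ sz.
have cqc c x : atlas c -> cdom c x -> {for x, continuous (qc c \o cmap c)}.
  move=> Ac cx; apply: continuous_comp; first exact: cmap_cont.
  by apply: differentiable_continuous; apply: smooth_on_diff (Sqc c Ac) _; exact: cmapP.
(* Multiplied by s, the quotients in two charts both give u; cancelling s shows that they agree,
   also where s vanishes, so they glue. *)
have qE c x : atlas c -> cdom c x -> q x = qc c (cmap c x).
  move=> Ac cx; have [Ac' c'x] := chP x.
  apply: (@dnonzero_cancel s (qc (ch x) \o cmap (ch x)) (qc c \o cmap c) x).
  - by move=> /H[].
  - exact: cqc.
  - exact: cqc.
  - have n1 : nbhs x (cdom c) by apply: open_nbhs_nbhs; split=> //; exact: cdom_open.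
    have n2 : nbhs x (cdom (ch x)) by apply: open_nbhs_nbhs; split=> //; exact: cdom_open.
    by apply: filterS2 n1 n2 => z cz c'z /=; rewrite !qcE.
have Sq : q \in @smooth_pred R d M.
  apply: smf_of_charts => c Ac; apply: smooth_on_eq (Sqc c Ac); first exact: cimg_open.
  by move=> y cy /=; rewrite (qE c) ?cinvK //; exact: cinvP.
exists (Smf Sq); apply: smf_eqP => x; rewrite smfM /=.
by have [Ac cx] := chP x; rewrite (qE (ch x)) // qcE.
Qed.

Lemma smf_invK f : (forall x, f x != 0) -> f * smf_inv f = 1.
Proof.
move=> f0; have [h fh] : exists h : smf, f * h = 1.
  have Sh : (fun x => (f x)^-1) \in @smooth_pred R d M.
    apply: smf_of_charts => c Ac.
    apply: (smooth_onV (@cimg_open R d M c) (smfP f Ac)) => y _; exact: f0.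
  by exists (Smf Sh); apply: smf_eqP => x; rewrite smfM /= mulfV.
rewrite /smf_inv; case: xgetP => [k _ //|/(_ h)]; last by [].
Qed.

Lemma smf_powR f (w : R) : (forall x, 0 < f x) -> exists h : smf, forall x, h x = f x `^ w.
Proof.
move=> f0; have Sh : (fun x => f x `^ w) \in @smooth_pred R d M.
  apply: smf_of_charts => c Ac.
  by apply: (smooth_on_powR w (@cimg_open R d M c) (smfP f Ac)) => y _; exact: f0.
by exists (Smf Sh).
Qed.

(** Extension by zero from a chart. As the manifold is Hausdorff, the compact image of K is closed,
    so the extension is identically zero near every point outside it. *)
Lemma smooth_ext c (B K : set V) (h : V -> R) : atlas c -> open B -> B `<=` cimg c ->
  compact K -> K `<=` B -> smooth_on B h -> (forall y, ~ K y -> h y = 0) ->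
  (fun x : M => if `[< cdom c x >] then h (cmap c x) else 0) \in @smooth_pred R d M.
Proof.
move=> Ac oB Bc cK KB Sh h0; apply: smf_of_charts => c' Ac'.
apply: smooth_on_local => y c'y.
set q := (fun x : M => _).
have [[cx By]|notB] := pselect (cdom c (cinv c' y) /\ B (cmap c (cinv c' y))).
  pose O : set M := [set z | cdom c z /\ B (cmap c z)].
  have oO : open O.
    by rewrite openE => z [cz Bz]; exact: chart_near.
  pose U := cimg c' `&` cinv c' @^-1` O.
  have oU : open U by exact: chart_preimage_open.
  exists U; first by split.
  pose phi : V -> V := fun y => cmap c (cinv c' y).
  apply: (@smooth_on_eq _ _ _ (h \o phi)) => //.
    by move=> z [_ [cz Bz]] /=; rewrite /q asboolT.
  apply: (@smooth_on_comp _ _ _ U B phi h) => //.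
    by move=> i; apply: smooth_on_sub (atlas_smooth Ac' Ac i) => z [c'z [cz _]].
  by move=> z [_ []].
pose K' := cinv c @` K.
have cK' : closed K'.
  apply: compact_closed; first exact: manifold_hausdorff.
  apply: continuous_compact cK; apply: continuous_in_subspaceT => z.
  by rewrite inE => /KB /Bc; exact: cinv_cont.
pose U := cimg c' `&` cinv c' @^-1` (~` K').
have oU : open U by apply: chart_preimage_open; exact: closed_openC.
exists U.
  split=> // -[z Kz zy]; apply: notB; rewrite -zy; split; first by apply: cinvP; apply: Bc; exact: KB.
  by rewrite cinvK; [exact: KB|apply: Bc; exact: KB].
apply: (@smooth_on_eq _ _ _ (cst 0)) => //; last exact: smooth_on_cst.
move=> z [_ /= nK]; rewrite /q; case: asboolP => // cz; rewrite h0 // => Kz; apply: nK.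
by exists (cmap c (cinv c' z)) => //; rewrite cmapK.
Qed.

End smooth_functions.

Section vector_fields.
Context {R : realType} {d : nat} {M : manifold R d}.
Local Notation V := 'rV[R]_d.
Local Notation smf := (smf M).
Implicit Types (f u : smf) (X Y Z : vfield M).

Lemma vfD X f h : X (f + h) = X f + X h.
Proof.
by have := vf_linear X 1 f h; rewrite (_ : 1%:S = 1) ?mul1r //; exact: val_inj.
Qed.

Lemma vf0 X : X 0 = 0.
Proof. by apply: (addrI (X 0)); rewrite -vfD !addr0. Qed.

Lemma vf1 X : X 1 = 0.
Proof.
have := vf_leibniz X 1 1; rewrite !mulr1 mul1r => E.
by apply: (addrI (X 1)); rewrite -E addr0.
Qed.

Lemma vf_cst X (a : R) : X (a%:S) = 0.
Proof. by have := vf_linear X a 1 0; rewrite vf1 vf0 mulr1 !addr0 mulr0. Qed.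

Lemma vfN X f : X (- f) = - X f.
Proof. by apply: (addrI (X f)); rewrite -vfD !subrr vf0. Qed.

Lemma vfB X f h : X (f - h) = X f - X h.
Proof. by rewrite vfD vfN. Qed.

Lemma vf_cstM X (a : R) f : X (a%:S * f) = a%:S * X f.
Proof. by rewrite vf_leibniz vf_cst mul0r add0r. Qed.

Lemma vf_sum X (I : Type) (r : seq I) (P : pred I) (F : I -> smf) :
  X (\sum_(i <- r | P i) F i) = \sum_(i <- r | P i) X (F i).
Proof. by elim/big_rec2: _ => [|i y1 y2 _ <-]; [exact: vf0|rewrite vfD]. Qed.

Lemma vfaddE X Y f : (X + Y) f = X f + Y f. Proof. by []. Qed.
Lemma vfscaleE u X f : (u *: X) f = u * X f. Proof. by []. Qed.

Lemma vfsumE (I : Type) (r : seq I) (P : pred I) (F : I -> vfield M) f :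
  (\sum_(i <- r | P i) F i) f = \sum_(i <- r | P i) F i f.
Proof. by elim/big_rec2: _ => [//|i y1 y2 _ <-]. Qed.

(* Derivations of the algebra of smooth functions are locally combinations of
   the coordinate derivations, by Hadamard's lemma. *)
Lemma local_frame (x0 : M) : exists (chi : smf) (theta : 'I_d -> vfield M -> smf)
    (E : 'I_d -> vfield M),
  [/\ chi x0 != 0, forall i, form1 (theta i) &
    forall X, chi *: X = \sum_(i < d) theta i X *: E i].
Proof.
have [c Ac cx0] := atlas_cover x0.
pose a := cmap c x0.
have [r0 r00 Bc] := open_ball_sub (@cimg_open R d M c) (cmapP cx0).
pose B := ball a r0; have oB : open B by exact: ball_open.
pose r := r0 / 2; have rgt0 : 0 < r by rewrite divr_gt0.
have rr0 : r < r0 by rewrite /r; lra.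
pose K : set V := [set v | forall i, `[a 0 i - r, a 0 i + r]%classic (v 0 i)].
have KB : K `<=` B.
  move=> v Kv; apply/ball_distP; apply: rV_norm_lt => // i; rewrite !mxE.
  have := Kv i; rewrite /= in_itv/= => vi; apply: le_lt_trans rr0.
  by rewrite ler_distl.
have cK : compact K.
  apply: (@rV_compact _ _ (fun i => `[a 0 i - r, a 0 i + r]%classic)) => i.
  exact: segment_compact.
pose b := bump_fun a r.
have bK y : b y != 0 -> K y.
  move=> /(bump_fun_supp rgt0) by' i; rewrite /= in_itv/=.
  by rewrite -ler_distl ltW.
have bB y : b y != 0 -> B y by move=> /bK /KB.
pose bxt (h : V -> R) : M -> R := fun x => if `[< cdom c x >] then (b * h) (cmap c x) else 0.
(* For h smooth on [B] the set is inhabited, so the default 0 is not taken. *)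
pose bx (h : V -> R) : smf := xget 0 [set H : smf | forall x, H x = bxt h x].
have bxE (h : V -> R) x : smooth_on B h -> bx h x = bxt h x.
  move=> Sh; rewrite /bx; case: xgetP => [H _ //|noH].
  have S : bxt h \in @smooth_pred R d M.
    apply: (@smooth_ext R d M c B K (b * h) Ac oB Bc cK KB).
      by apply: (@smooth_onM _ _ _ b h oB _ Sh); exact: bump_fun_smooth.
    move=> y nK; rewrite fctE; have [->|/bK //] := eqVneq (b y) 0.
    by rewrite mul0r.
  by exfalso; apply: (noH (Smf S)).
have bx_in (h : V -> R) x : smooth_on B h -> cdom c x -> bx h x = b (cmap c x) * h (cmap c x).
  by move=> Sh cx; rewrite bxE // /bxt asboolT.
have bx_out (h : V -> R) x : smooth_on B h -> ~ cdom c x -> bx h x = 0.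
  by move=> Sh cx; rewrite bxE // /bxt asboolF.
have Sf f : smooth_on B (f \o cinv c).
  by apply: smooth_on_sub (smfP f Ac).
pose co i : V -> R := fun y => y 0 i.
have Sco i : smooth_on B (co i) by exact: smooth_on_coord.
have S1 : smooth_on B (cst 1 : V -> R) by exact: smooth_on_cst.
pose chi := bx (cst 1); pose z i := bx (co i).
have chi_in x : cdom c x -> chi x = b (cmap c x) by move=> cx; rewrite bx_in // mulr1.
pose e i f := bx (pderiv i (f \o cinv c)).
have Se i f : smooth_on B (pderiv i (f \o cinv c)) by exact: smooth_on_pderiv.
have df f y : B y -> differentiable (f \o cinv c) y by exact: smooth_on_diff.
have e_lin i (t : R) f h : e i (t%:S * f + h) = t%:S * e i f + e i h.
  apply: smf_eqP => x; rewrite smfD smfM smfcE.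
  have [cx|cx] := pselect (cdom c x); last by rewrite !bx_out // mulr0 addr0.
  rewrite !bx_in //; have [->|/bB By] := eqVneq (b (cmap c x)) 0; first by rewrite !mul0r mulr0 addr0.
  rewrite (_ : (t%:S * f + h) \o cinv c = cst t * (f \o cinv c) + (h \o cinv c)) //.
  rewrite pderivD ?pderivM ?pderiv_cst ?mul0r ?add0r; try exact: df; try exact: differentiable_cst.
    by rewrite mulrDr mulrCA.
  by apply: differentiableM; [exact: differentiable_cst|exact: df].
have e_leib i f h : e i (f * h) = e i f * h + f * e i h.
  apply: smf_eqP => x; rewrite smfD !smfM.
  have [cx|cx] := pselect (cdom c x); last by rewrite !bx_out // mulr0 mul0r addr0.
  rewrite !bx_in //; have [->|/bB By] := eqVneq (b (cmap c x)) 0; first by rewrite !mul0r mulr0 addr0.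
  rewrite (_ : (f * h) \o cinv c = (f \o cinv c) * (h \o cinv c)) //.
  rewrite pderivM; [|exact: df..].
  by rewrite /= cmapK //; ring.
pose E i := VField (e_lin i) (e_leib i).
(* Here chi and [z i] are b and b y_i, so this is chi^2 X(z i / chi), that is chi^2 times the i-th
   component of X, written without division. As [E i] is b times the i-th partial derivative, the
   total factor is chi^3. *)
pose theta i X := chi * X (z i) - z i * X chi.
exists (chi ^+ 3), theta, E; split.
- rewrite smfX expf_neq0 // chi_in //; exact: bump_fun_neq0.
- by move=> i u X Y; rewrite /theta !vfaddE !vfscaleE; ring.
move=> X; apply: vfield_eqP => f; rewrite vfscaleE vfsumE.
apply: smf_eqP => p; rewrite smf_sum smfM smfX.
rewrite (eq_bigr (fun i => (chi p * X (z i) p - z i p * X chi p) * e i f p)); last by [].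
have [cp|cp] := pselect (cdom c p); last first.
  rewrite (bx_out (cst 1)) // expr0n mul0r big1 // => i _.
  by rewrite /e (bx_out (pderiv i (f \o cinv c))) // mulr0.
have [bp|bp] := eqVneq (b (cmap c p)) 0.
  rewrite chi_in // bp expr0n mul0r big1 // => i _.
  by rewrite /e (bx_in (pderiv i (f \o cinv c))) // bp !mul0r mulr0.
set q := cmap c p in bp *; have Bq := bB _ bp.
have [F [SF FE Fq]] := Hadamard (Sf f) Bq.
(* Hadamard's expansion of f at p, multiplied by chi^2 so that every factor is globally defined. At
   p both f - f p and the z i - q_i chi vanish, so that X applied to the products leaves only the
   derivatives of these factors. *)
have key : chi ^+ 2 * (f - (f p)%:S) = \sum_(i < d) (z i - (q 0 i)%:S * chi) * bx (F i).
  apply: smf_eqP => x; rewrite smfM smfX smfD smfN smfcE smf_sum.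
  have [cx|cx] := pselect (cdom c x); last first.
    rewrite (bx_out (cst 1)) // expr0n mul0r big1 // => i _.
    by rewrite smfM (bx_out (F i)) // mulr0.
  rewrite chi_in //; have [bx0|bx0] := eqVneq (b (cmap c x)) 0.
    rewrite bx0 expr0n mul0r big1 // => i _.
    by rewrite smfM (bx_in (F i)) // bx0 mul0r mulr0.
  have Ex := FE _ (bB _ bx0); rewrite /= cmapK // /q cmapK // in Ex.
  rewrite Ex addrC addKr mulr_sumr; apply: eq_bigr => i _.
  rewrite smfM smfD smfN smfM smfcE !bx_in // /co /q /cst; ring.
have := congr1 (fun h : smf => X h p) key.
rewrite vf_leibniz smfD 2!smfM smfX smfD smfN smfcE subrr mulr0 add0r.
rewrite vfB vf_cst subr0 vf_sum smf_sum => keyX.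
rewrite exprS -mulrA keyX mulr_sumr; apply: eq_bigr => i _.
rewrite vf_leibniz smfD !smfM vfB vf_cstM !smfD !smfN !smfM !smfcE.
rewrite /e (bx_in (F i)) // (bx_in (pderiv i (f \o cinv c))) // -/q Fq chi_in // -/q (bx_in (co i)) // -/q /co.
ring.
Qed.

End vector_fields.

(** * Densities and tractors in a scale *)

Section scales.
Context {R : realType} {n : nat} {C : conformal R n.+1}.
Local Notation smf := (smf C).
Local Notation vfield := (vfield C).
Local Notation scale := (scale C).
Implicit Types (f : scale -> smf) (g h k : scale) (X Y Z U : vfield) (u v a b Om : smf) (w : R).

Lemma smf_mulI a u v : (forall x, a x != 0) -> a * u = a * v -> u = v.
Proof.
move=> a0 E; apply: smf_eqP => x; apply: (mulfI (a0 x)).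
by rewrite -!smfM E.
Qed.

(** A vector of nonzero square length at each point is what makes the conformal factor between two
    scales unique. *)
Lemma scale_ops g : [/\ Defs.bilinear g, forall X Y, g X Y = g Y X &
  forall x, exists X, g X X x != 0].
Proof.
case: (cclassP C) => g0 [[bl br] sym [p pd on]] cE.
have := scale_in g; rewrite cE => -[Om [Om0 gE]]; split.
- split=> [Y u X X'|X u Y Y']; rewrite !gE; first by rewrite (bl Y); ring.
  by rewrite (br X); ring.
- by move=> X Y; rewrite !gE sym.
move=> x; have [e eE] := on x; exists (e ord0).
rewrite gE smfM smfX eE eqxx mulr1n mulf_neq0 ?expf_neq0 // ?gt_eqF // oppr_eq0 oner_eq0.
Qed.

Lemma metl g u X Y Z : g (u *: X + Y) Z = u * g X Z + g Y Z.
Proof. by have [[bl _] _ _] := scale_ops g; rewrite (bl Z). Qed.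

Lemma metC g X Y : g X Y = g Y X.
Proof. by have [_ s _] := scale_ops g. Qed.

Lemma metr g u X Y Z : g Z (u *: X + Y) = u * g Z X + g Z Y.
Proof. by rewrite !(metC g Z) metl. Qed.

Lemma rescaling_neq0 Om (g h : bform C) : rescaling Om g h -> forall x, Om x != 0.
Proof. by move=> [Om0 _] x; rewrite gt_eqF. Qed.

Lemma rescaling_trans A B (g h k : bform C) : rescaling A g h -> rescaling B h k -> rescaling (B * A) g k.
Proof.
move=> [A0 hE] [B0 kE]; split=> [x|X Y]; first by rewrite smfM mulr_gt0.
by rewrite kE hE; ring.
Qed.

Lemma rescaling_refl (g : bform C) : rescaling 1 g g.
Proof. by split=> [x|X Y]; [rewrite smf1|rewrite expr1n mul1r]. Qed.

Lemma rescaling_uniq A B g h : rescaling A g h -> rescaling B g h -> A = B.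
Proof.
move=> [A0 AE] [B0 BE]; apply: smf_eqP => x.
have [_ _ /(_ x) [X gX]] := scale_ops g.
have : (A ^+ 2 * g X X) x = (B ^+ 2 * g X X) x by rewrite -AE BE.
rewrite smfM [RHS]smfM !smfX => /(mulIf gX) /eqP.
by rewrite eqrXn2 ?ltW // => /eqP.
Qed.

Lemma rescaling_ex g h : exists Om, rescaling Om g h.
Proof.
case: (cclassP C) => g0 m0 cE.
have := scale_in g; rewrite cE => -[A [A0 gE]].
have := scale_in h; rewrite cE => -[B [B0 hE]].
have A0' x : A x != 0 by rewrite gt_eqF.
have AV := smf_invK A0'; exists (B * smf_inv A); split.
  move=> x; have Ax := congr1 (fun u : smf => u x) AV; rewrite smfM smf1 in Ax.
  rewrite smfM mulr_gt0 // -(pmulr_rgt0 _ (A0 x)) Ax //.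
move=> X Y; rewrite hE gE.
have -> : (B * smf_inv A) ^+ 2 * (A ^+ 2 * g0 X Y) = (A * smf_inv A) ^+ 2 * (B ^+ 2 * g0 X Y) by ring.
by rewrite AV expr1n mul1r.
Qed.

Lemma density_ext w (f f' : scale -> smf) g : density w f -> density w f' ->
  f g = f' g -> f = f'.
Proof.
move=> df df' E; apply/funext => h; apply: smf_eqP => x.
have [Om Omgh] := rescaling_ex g h.
by rewrite (df _ _ _ Omgh) (df' _ _ _ Omgh) E.
Qed.

(** The conformal factors relative to g compose and are unique, which is the cocycle identity that
    the density law between two arbitrary scales requires. *)
Lemma density_of_ex g w u : exists f, density w f /\ f g = u.
Proof.
have ex h : exists v, exists Om, rescaling Om g h /\ forall x, v x = Om x `^ w * u x.
  have [Om Omgh] := rescaling_ex g h; have [p pE] := smf_powR w Omgh.1.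
  by exists (p * u), Om; split=> // x; rewrite smfM pE.
have [f fP] := choice ex; exists f; split.
  move=> h k Om Omhk x; have [A [gh ->]] := fP h; have [B [gk ->]] := fP k.
  rewrite (rescaling_uniq gk (rescaling_trans gh Omhk)) smfM powRM ?ltW //.
  - by rewrite mulrA.
  - by case: Omhk.
  - by case: gh.
apply: smf_eqP => x; have [A [gg ->]] := fP g.
by rewrite (rescaling_uniq gg (rescaling_refl g)) smf1 powR1 mul1r.
Qed.

Lemma density_ofP g w u : density w (density_of g w u) /\ density_of g w u g = u.
Proof.
rewrite /density_of; case: xgetP => [f _ //|H].
by have [f fP] := density_of_ex g w u; have := H f fP.
Qed.

Lemma density_of_density g w u : density w (density_of g w u).
Proof. by have [] := density_ofP g w u. Qed.

Lemma density_ofE g w u : density_of g w u g = u.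
Proof. by have [] := density_ofP g w u. Qed.

Lemma densityD w f (f' : scale -> smf) : density w f -> density w f' -> density w (f + f').
Proof.
move=> df df' g h Om gh x.
by rewrite !fctE !smfD (df _ _ _ gh) (df' _ _ _ gh) mulrDr.
Qed.

Lemma densityM w w' f (f' : scale -> smf) : density w f -> density w' f' -> density (w + w') (f * f').
Proof.
move=> df df' g h Om gh x.
rewrite !fctE !smfM (df _ _ _ gh) (df' _ _ _ gh) powRD; first by rewrite mulrACA.
by rewrite (negPf (rescaling_neq0 gh x)) implybT.
Qed.

Lemma density_cst u : density 0 (cst u : scale -> smf).
Proof. by move=> g h Om _ x; rewrite powRr0 mul1r. Qed.

Lemma densityMl w u f : density w f -> density w (cst u * f).
Proof. by move=> df; rewrite -[w]add0r; apply: densityM => //; exact: density_cst. Qed.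

Lemma density_sum w (I : Type) (r : seq I) (F : I -> scale -> smf) :
  (forall i, density w (F i)) -> density w (\sum_(i <- r) F i).
Proof.
move=> dF; elim/big_ind: _ => [|f f'|i _]; [|exact: densityD|exact: dF].
by move=> g h Om _ x; exact: (esym (mulr0 _)).
Qed.

Lemma densityN w f : density w f -> density w (- f).
Proof. by move=> df g h Om gh x; rewrite !fctE !smfN (df _ _ _ gh) mulrN. Qed.

Section ops.
Variables (g : scale) (D : metric_ops g).

Let mu_sharp al : form1 al -> forall X, al X = g X (sharp D al).
Proof. by move=> fa X; rewrite metC sharpP. Qed.

Definition dlog Om : vfield -> smf := fun X => smf_inv Om * X Om.

Lemma dlog_form1 Om : form1 (dlog Om).
Proof. by move=> u X Y; rewrite /dlog vfaddE vfscaleE; ring. Qed.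

Lemma dlog_sharp Om (h : scale) : rescaling Om g h -> forall X, Om * g (sharp D (dlog Om)) X = X Om.
Proof.
move=> gh X; rewrite sharpP; last exact: dlog_form1.
by rewrite /dlog mulrA smf_invK ?mul1r //; exact: rescaling_neq0 gh.
Qed.

Lemma tractor_form1 (t : tractor C) h : form1 (slot_mu (t h)).
Proof. by have /asboolP[mt _] := tractorP t; exact: mt. Qed.

Lemma tractor_ext (t t' : tractor C) : t g = t' g -> t = t'.
Proof.
move=> E; apply/val_inj/funext => h /=.
have [Om gh] := rescaling_ex g h.
have /asboolP[_ /(_ g h Om _ gh (dlog_sharp gh)) [t1 t2 t3]] := tractorP t.
have /asboolP[_ /(_ g h Om _ gh (dlog_sharp gh)) [t'1 t'2 t'3]] := tractorP t'.
rewrite E in t1 t2 t3.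
have e3 : slot_rho (t h) = slot_rho (t' h).
  by apply: (smf_mulI (rescaling_neq0 gh)); rewrite t3 t'3.
have e2 : slot_mu (t h) = slot_mu (t' h) by apply/funext => X; rewrite t2 t'2.
move: e2 e3 (etrans t1 (esym t'1)); case: (t h) => [[a m] b]; case: (t' h) => [[a' m'] b'].
by rewrite /slot_mu /slot_rho /slot_sigma /= => -> -> ->.
Qed.

(** The family is defined by the transformation law out of g; its validity between two other scales
    h and k is the cocycle identity of that law. *)
Lemma tractor_of_ex (sg rho : smf) (mu : vfield -> smf) : form1 mu ->
  exists t : tractor C, t g = (sg, mu, rho).
Proof.
move=> fmu.
pose tr Om U : triple C := (Om * sg, fun X => Om * (mu X + g U X * sg),
   smf_inv Om * (rho - mu U - 2^-1%:S * g U U * sg)).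
have ex h : exists OU : smf * vfield, rescaling OU.1 g h /\ (forall X, OU.1 * g OU.2 X = X OU.1).
  have [Om gh] := rescaling_ex g h; exists (Om, sharp D (dlog Om)); split=> //=.
  exact: dlog_sharp gh.
have [OU OUP] := choice ex.
pose T h : triple C := tr (OU h).1 (OU h).2.
(* The field Upsilon^a is known through its pairings with g; writing mu X as the pairing of X with
   the sharp of mu shows that these determine mu(Upsilon). *)
have muE X Y : (forall Z, g X Z = g Y Z) -> mu X = mu Y by move=> XY; rewrite (mu_sharp fmu X) (mu_sharp fmu Y) XY.
have gE X Y : (forall Z, g X Z = g Y Z) -> g X X = g Y Y.
  by move=> XY; rewrite XY metC XY.
have mu0 : mu 0 = 0.
  by apply: (addrI (mu 0)); rewrite -[X in X + _]mul1r -fmu scale1r !addr0.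
have g0 X : g 0 X = 0.
  by apply: (addrI (g 0 X)); rewrite -[X in X + _]mul1r -metl scale1r !addr0.
have TP : T \in @tractor_pred R n.+1 C.
  apply/asboolP; split=> [h u X Y|h k Om U hk UE].
    by rewrite /slot_mu /= fmu metr; ring.
  have [] := OUP h; have [] := OUP k; rewrite /T; move: (OU h) (OU k) => [A Uh] [B Uk] /=.
  move=> gk UkE gh UhE.
  have BE : B = Om * A := rescaling_uniq gk (rescaling_trans gh hk).
  have A0 := rescaling_neq0 gh; have B0 := rescaling_neq0 gk.
  have [_ hE] := gh.
  (* Upsilon is additive under composition of rescalings; the factor A^2 appears because U has its
     index raised with h = A^2 g. *)
  have W X : g Uk X = g (A ^+ 2 *: U + Uh) X.
    apply: (smf_mulI B0); rewrite UkE metl BE vf_leibniz -UhE -UE hE; ring.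
  have AV := smf_invK A0; have BV := smf_invK B0.
  split; rewrite /slot_sigma /slot_mu /slot_rho /=.
  - by rewrite BE mulrA.
  - by move=> X; rewrite W metl hE BE; ring.
  - have -> : mu Uk = A ^+ 2 * mu U + mu Uh by rewrite -fmu; apply: muE.
    have -> : g Uk Uk = A ^+ 2 * (A ^+ 2 * g U U + g Uh U) + (A ^+ 2 * g Uh U + g Uh Uh).
      by rewrite (gE _ _ W) !metl !metr (metC g U Uh).
    rewrite hE; apply: (smf_mulI A0).
    set rk := rho - _ - _.
    have -> : A * (Om * (smf_inv B * rk)) = (B * smf_inv B) * rk by rewrite BE; ring.
    have AVx u : A * (smf_inv A * u) = u by rewrite mulrA AV mul1r.
    rewrite BV mul1r !mulrBr !AVx /rk.
    set hf : smf := 2^-1%:S.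
    have hh : hf + hf = 1 by apply: smf_eqP => x; rewrite smfD smfcE smf1; field.
    have -> : A * (A * (mu U + g Uh U * sg)) =
        A ^+ 2 * mu U + (hf + hf) * (A ^+ 2 * g Uh U * sg) by rewrite hh; ring.
    ring.
exists (Tractor TP) => /=; rewrite /T.
have [] := OUP g; move: (OU g) => [A U] /= gg UE.
have A1 : A = 1 := rescaling_uniq gg (rescaling_refl g).
have U0 X : g U X = g 0 X by have := UE X; rewrite A1 mul1r vf1 => ->; rewrite g0.
have inv1 : smf_inv (1 : smf) = 1.
  rewrite -[LHS]mul1r; apply: smf_invK => x; exact: oner_neq0.
rewrite /tr A1 inv1 !mul1r (muE _ _ U0) mu0 (gE _ _ U0) g0 mulr0 mul0r !subr0.
by congr (_, _, _); apply/funext => X; rewrite mul1r U0 g0 mul0r addr0.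
Qed.

Lemma tractor_ofE (sg rho : smf) (mu : vfield -> smf) : form1 mu ->
  tractor_of g (sg, mu, rho) g = (sg, mu, rho).
Proof.
move=> fmu; rewrite /tractor_of; case: xgetP => [t _ //|H].
by have [t tP] := tractor_of_ex sg rho fmu; have := H t tP.
Qed.

End ops.

End scales.

(** * Tractor calculus *)

Section curvature.
Context {R : realType} {n : nat} {C : conformal R n.+1} {g : scale C} {D : metric_ops g}.
Local Notation smf := (smf C).
Local Notation vfield := (vfield C).
Implicit Types (X Y Z W : vfield) (u v : smf) (al be : vfield -> smf).

Lemma form1D al X Y : form1 al -> al (X + Y) = al X + al Y.
Proof. by move=> fa; have := fa 1 X Y; rewrite scale1r mul1r. Qed.

Lemma form1_0 al : form1 al -> al 0 = 0.
Proof. by move=> fa; apply: (addrI (al 0)); rewrite -form1D // !addr0. Qed.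

Lemma form1Z al u X : form1 al -> al (u *: X) = u * al X.
Proof. by move=> fa; rewrite -[u *: X]addr0 fa form1_0 ?addr0. Qed.

Lemma form1_sum al (I : Type) (r : seq I) (F : I -> vfield) : form1 al ->
  al (\sum_(i <- r) F i) = \sum_(i <- r) al (F i).
Proof.
by move=> fa; elim/big_rec2: _ => [|i y1 y2 _ <-]; [exact: form1_0|exact: form1D].
Qed.

Lemma form1_vf u : form1 (fun X : vfield => X u).
Proof. by []. Qed.

Lemma sharp_sym al be : form1 al -> form1 be -> al (sharp D be) = be (sharp D al).
Proof.
by move=> fa fb; rewrite -(sharpP D fa) -(sharpP D fb) metC.
Qed.

Lemma lc_linr X u Y Z : lc D X (u *: Y + Z) = u *: lc D X Y + X u *: Y + lc D X Z.
Proof. by rewrite lc_add lc_leibniz. Qed.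

Lemma vfNE X f : (- X) f = - X f.
Proof. by rewrite -scaleN1r vfscaleE mulN1r. Qed.

Lemma vf_bracketE X Y f : (vf_bracket X Y) f = X (Y f) - Y (X f).
Proof. by []. Qed.

Lemma vf_bracket_linl u X X' Y :
  vf_bracket (u *: X + X') Y = u *: vf_bracket X Y + ((- Y u) *: X + vf_bracket X' Y).
Proof.
apply: vfield_eqP => f.
by rewrite !vfaddE !vfscaleE !vf_bracketE !vfaddE !vfscaleE vfD vf_leibniz; ring.
Qed.

Lemma vf_bracketC X Y : vf_bracket X Y = - vf_bracket Y X.
Proof. by apply: vfield_eqP => f; rewrite vfNE !vf_bracketE opprB. Qed.

Local Notation curv := (curv D).

Lemma curv_linl u X X' Y Z : curv (u *: X + X') Y Z = u *: curv X Y Z + curv X' Y Z.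
Proof.
rewrite /Defs.curv vf_bracket_linl !lc_linear lc_linr.
apply: vfield_eqP => f; rewrite !(vfaddE, vfNE, vfscaleE); ring.
Qed.

Lemma lcNl X Y : lc D (- X) Y = - lc D X Y.
Proof.
have E0 : lc D 0 Y = 0.
  apply: (addrI (lc D 0 Y)); rewrite -[X in X + _]scale1r -lc_linear scale1r !addr0 //.
have := lc_linear D (-1) X 0 Y; rewrite addr0 E0 addr0 !scaleN1r; exact.
Qed.

Lemma curvC X Y Z : curv X Y Z = - curv Y X Z.
Proof.
rewrite /Defs.curv (vf_bracketC X Y) lcNl.
apply: vfield_eqP => f; rewrite !(vfaddE, vfNE); ring.
Qed.

Lemma curv_linm u X Y Y' Z : curv X (u *: Y + Y') Z = u *: curv X Y Z + curv X Y' Z.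
Proof.
rewrite !(curvC X) curv_linl opprD; congr (_ + _).
by rewrite scalerN.
Qed.

Lemma curv_linr u X Y Z Z' : curv X Y (u *: Z + Z') = u *: curv X Y Z + curv X Y Z'.
Proof.
rewrite /Defs.curv !lc_linr !lc_add !lc_leibniz.
apply: vfield_eqP => f; rewrite !(vfaddE, vfNE, vfscaleE) vf_bracketE; ring.
Qed.

Lemma contr_ext (B B' : bform C) : (forall X Y, B X Y = B' X Y) -> contr D B = contr D B'.
Proof.
by move=> BB; congr contr; apply/funext => X; apply/funext => Y.
Qed.

(** Linearity of [contr] is available on bilinear forms, so the curvature has to be tensorial in the
    contracted slot as well. *)
Lemma ricci_bilinear : Defs.bilinear (ricci D).
Proof.
have bl Y Z : Defs.bilinear (fun X W => g (curv X Y Z) W).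
  by split=> [W u X X'|X u W W']; [rewrite curv_linl metl|rewrite metr].
split=> [Z u Y Y'|Y u Z Z']; rewrite /ricci -contr_linear //; apply: contr_ext => X W.
  by rewrite curv_linm metl.
by rewrite curv_linr metl.
Qed.

Lemma schouten_bilinear : Defs.bilinear (schouten D).
Proof.
have [rl rr] := ricci_bilinear.
split=> [Y u X X'|X u Y Y']; rewrite /schouten; first by rewrite (rl Y) metl; ring.
by rewrite (rr X) metr; ring.
Qed.

End curvature.

Section tractor_derivative.
Context {R : realType} {n : nat} {C : conformal R n.+1} {g : scale C} {D : metric_ops g}.
Local Notation smf := (smf C).
Local Notation vfield := (vfield C).
Local Notation tractor := (tractor C).
Implicit Types (X Y Z W : vfield) (u v : smf) (a b : tractor).

Local Notation sg a := (slot_sigma (a g)).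
Local Notation mu a := (slot_mu (a g)).
Local Notation rho a := (slot_rho (a g)).

Lemma tractor_comb_slots u a b : [/\ sg (u *: a + b) = u * sg a + sg b,
   forall X, mu (u *: a + b) X = u * mu a X + mu b X &
   rho (u *: a + b) = u * rho a + rho b].
Proof.
have E : (u *: a + b) g = u *: a g + b g.
  by rewrite -[LHS]/(1 *: (u *: a g + 0) + b g) scale1r addr0.
by rewrite E.
Qed.

Lemma triple_ext (t t' : triple C) : slot_sigma t = slot_sigma t' ->
  (forall X, slot_mu t X = slot_mu t' X) -> slot_rho t = slot_rho t' -> t = t'.
Proof.
case: t t' => [[s m] r] [[s' m'] r']; rewrite /slot_sigma /slot_mu /slot_rho /=.
by move=> -> /funext -> ->.
Qed.

Lemma nabla_tractor_slots X a : let na := nabla_tractor D X a in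
  [/\ sg na = X (sg a) - mu a X,
   forall Y, mu na Y = X (mu a Y) - mu a (lc D X Y) + g X Y * rho a + schouten D X Y * sg a &
   rho na = X (rho a) - schouten D X (sharp D (mu a))].
Proof.
rewrite /= /nabla_tractor; have fm : form1 (mu a) := @tractor_form1 _ _ _ a g.
have [_ /(_ X) sr] := @schouten_bilinear _ _ _ _ D.
rewrite (tractor_ofE D) // => u Y Z /=.
by rewrite lc_linr !(form1D _ _ fm) !(form1Z _ _ fm) vfD vf_leibniz metr sr; ring.
Qed.

Lemma nabla_tractor_linl u X Y a :
  nabla_tractor D (u *: X + Y) a = u *: nabla_tractor D X a + nabla_tractor D Y a.
Proof.
have fm : form1 (mu a) := @tractor_form1 _ _ _ a g.
have [sl _] := @schouten_bilinear _ _ _ _ D.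
apply: (tractor_ext D); apply: triple_ext.
- have [-> _ _] := tractor_comb_slots u (nabla_tractor D X a) (nabla_tractor D Y a).
  have [-> _ _] := nabla_tractor_slots (u *: X + Y) a.
  have [-> _ _] := nabla_tractor_slots X a; have [-> _ _] := nabla_tractor_slots Y a.
  by rewrite fm vfaddE vfscaleE; ring.
- move=> Z; have [_ -> _] := tractor_comb_slots u (nabla_tractor D X a) (nabla_tractor D Y a).
  have [_ -> _] := nabla_tractor_slots (u *: X + Y) a.
  have [_ -> _] := nabla_tractor_slots X a; have [_ -> _] := nabla_tractor_slots Y a.
  by rewrite lc_linear fm vfaddE vfscaleE metl (sl Z); ring.
- have [_ _ ->] := tractor_comb_slots u (nabla_tractor D X a) (nabla_tractor D Y a).
  have [_ _ ->] := nabla_tractor_slots (u *: X + Y) a.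
  have [_ _ ->] := nabla_tractor_slots X a; have [_ _ ->] := nabla_tractor_slots Y a.
  by rewrite (sl (sharp D (mu a))) vfaddE vfscaleE; ring.
Qed.

Lemma nabla_tractor_leibniz u X a b :
  nabla_tractor D X (u *: a + b) =
  u *: nabla_tractor D X a + (X u *: a + nabla_tractor D X b).
Proof.
have fm (c : tractor) : form1 (mu c) := @tractor_form1 _ _ _ c g.
have [_ /(_ X) sr] := @schouten_bilinear _ _ _ _ D.
have [E1 E2 E3] := tractor_comb_slots u a b.
set na := nabla_tractor D X a; set nb := nabla_tractor D X b.
have [F1 F2 F3] := tractor_comb_slots u na (X u *: a + nb).
have [G1 G2 G3] := tractor_comb_slots (X u) a nb.
have [H1 H2 H3] := nabla_tractor_slots X (u *: a + b).
have [A1 A2 A3] := nabla_tractor_slots X a; have [B1 B2 B3] := nabla_tractor_slots X b.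
rewrite -/na in A1 A2 A3; rewrite -/nb in B1 B2 B3.
apply: (tractor_ext D); apply: triple_ext.
- by rewrite F1 G1 H1 A1 B1 E1 E2 vfD vf_leibniz; ring.
- by move=> Y; rewrite F2 G2 H2 A2 B2 E1 !E2 E3 vfD vf_leibniz; ring.
(* [sharp_sym] moves the sharp from the slot mu to the form schouten D X, leaving an expression
   visibly linear in mu. *)
- rewrite F3 G3 H3 A3 B3 E3 vfD vf_leibniz !(sharp_sym sr (fm _)) E2; ring.
Qed.

End tractor_derivative.

(** * Derivatives of tensor sections, computed in one scale *)

Section representatives.
Context {R : realType} {n : nat} {C : conformal R n.+1} {g : scale C} (D : metric_ops g).
Context {k : nat}.
Local Notation smf := (smf C).
Local Notation vfield := (vfield C).
Local Notation tractor := (tractor C).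
Local Notation raw := (('I_k -> tractor) -> smf).
Implicit Types (X Y Z W : vfield) (u : smf) (a b : tractor) (t : 'I_k -> tractor).
Implicit Types (v w : raw).

(* A section of weight w is determined by its representative in the scale g, on
   which all the operators are computed. *)
Definition multilin v := forall t i u a b,
  v [eta t with i |-> u *: a + b] = u * v [eta t with i |-> a] + v [eta t with i |-> b].

Lemma update_swap t i j a b : i != j ->
  ([eta [eta t with i |-> a] with j |-> b] : 'I_k -> tractor) = [eta [eta t with j |-> b] with i |-> a].
Proof.
move=> ij; apply/funext => z /=; case: eqVneq => // -> .
by rewrite eq_sym (negPf ij).
Qed.

Lemma update_same t i a b : ([eta [eta t with i |-> a] with i |-> b] : 'I_k -> tractor) = [eta t with i |-> b].
Proof. by apply/funext => z /=; case: eqVneq. Qed.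

Lemma multilin_comb u v w : multilin v -> multilin w -> multilin (fun t => u * v t + w t).
Proof. by move=> mv mw t i u' a b; rewrite mv mw; ring. Qed.

Definition nab X v : raw := fun t =>
  X (v t) - \sum_(i < k) v [eta t with i |-> nabla_tractor D X (t i)].

Lemma nab_split X v t j : nab X v t = X (v t) -
  (v [eta t with j |-> nabla_tractor D X (t j)] +
   \sum_(i < k | i != j) v [eta t with i |-> nabla_tractor D X (t i)]).
Proof. by rewrite /nab (bigD1 j). Qed.

(** The term in X u from differentiating the value of v cancels the one from the Leibniz rule of the
    tractor connection in slot j. *)
Lemma nab_multilin X v : multilin v -> multilin (nab X v).
Proof.
move=> mv t j u a b; pose N := nabla_tractor D X.
pose S c := \sum_(i < k | i != j) v [eta [eta t with j |-> c] with i |-> N (t i)].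
have E c : nab X v [eta t with j |-> c] =
    X (v [eta t with j |-> c]) - (v [eta t with j |-> N c] + S c).
  rewrite (nab_split _ _ _ j) update_same /= eqxx -/N; congr (_ - (_ + _)).
  by apply: eq_bigr => i ij; rewrite (negPf ij).
have ES : S (u *: a + b) = u * S a + S b.
  rewrite /S mulr_sumr -big_split /=; apply: eq_bigr => i ij.
  have ji : j != i by rewrite eq_sym.
  by rewrite !(update_swap t _ _ ji) mv.
rewrite !E ES /N nabla_tractor_leibniz -/N !mv vfD vf_leibniz.
by ring.
Qed.

Lemma nab_linl u X Y v t : multilin v -> nab (u *: X + Y) v t = u * nab X v t + nab Y v t.
Proof.
move=> mv; rewrite /nab vfaddE vfscaleE.
have -> : \sum_(i < k) v [eta t with i |-> nabla_tractor D (u *: X + Y) (t i)] =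
   u * (\sum_(i < k) v [eta t with i |-> nabla_tractor D X (t i)]) +
   \sum_(i < k) v [eta t with i |-> nabla_tractor D Y (t i)].
  rewrite mulr_sumr -big_split /=; apply: eq_bigr => i _.
  by rewrite nabla_tractor_linl mv.
ring.
Qed.

Lemma nab_form1 v t : multilin v -> form1 (fun X => nab X v t).
Proof. by move=> mv u X Y; rewrite nab_linl. Qed.

Lemma nab_comb X u v w t :
  nab X (fun t => u * v t + w t) t = X u * v t + u * nab X v t + nab X w t.
Proof.
rewrite /nab vfD vf_leibniz big_split /= -mulr_sumr.
set S1 := \sum_(_ < _) _; set S2 := \sum_(_ < _) _; ring.
Qed.

Lemma nabM X u v t : nab X (fun t => u * v t) t = X u * v t + u * nab X v t.
Proof.
rewrite /nab vf_leibniz -mulr_sumr.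
set S1 := \sum_(_ < _) _; ring.
Qed.

Definition nab2 X Y v : raw := fun t => nab X (nab Y v) t - nab (lc D X Y) v t.

Lemma nab2_bilinear v t : multilin v -> Defs.bilinear (fun X Y => nab2 X Y v t).
Proof.
move=> mv; split=> [Y u X X'|X u Y Y']; rewrite /nab2.
  by rewrite lc_linear !nab_linl //; [ring|exact: nab_multilin].
have -> : nab (u *: Y + Y') v = (fun t => u * nab Y v t + nab Y' v t).
  by apply/funext => t'; rewrite nab_linl.
rewrite nab_comb lc_linr.
have f1 := nab_form1 t mv.
by rewrite !(form1D _ _ f1) !(form1Z _ _ f1); ring.
Qed.

Lemma nab2_multilin X Y v : multilin v -> multilin (nab2 X Y v).
Proof.
move=> mv t i u a b; rewrite /nab2.
rewrite (nab_multilin _ (nab_multilin _ mv)) (nab_multilin _ mv); ring.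
Qed.

Definition lap v : raw := fun t => contr D (fun X Y => nab2 X Y v t).

Lemma lap_multilin v : multilin v -> multilin (lap v).
Proof.
move=> mv t i u a b; rewrite /lap -contr_linear; do ?exact: nab2_bilinear.
by apply: contr_ext => X Y; rewrite nab2_multilin.
Qed.

Lemma lapD v w t : multilin v -> multilin w -> lap (fun t => v t + w t) t = lap v t + lap w t.
Proof.
move=> mv mw; rewrite /lap -[contr D (fun X Y => nab2 X Y v t)]mul1r -contr_linear; do ?exact: nab2_bilinear.
apply: contr_ext => X Y; rewrite mul1r /nab2.
have E Z v' w' : nab Z (fun t => v' t + w' t) = (fun t => nab Z v' t + nab Z w' t).
  apply/funext => t'; have := nab_comb Z 1 v' w' t'; rewrite vf1 mul0r add0r mul1r => <-.
  by congr nab; apply/funext => z; rewrite mul1r.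
by rewrite !E; ring.
Qed.

Definition hess u : bform C := fun X Y => X (Y u) - (lc D X Y) u.

Lemma hess_bilinear u : Defs.bilinear (hess u).
Proof.
split=> [Y u' X X'|X u' Y Y']; rewrite /hess.
  by rewrite lc_linear !vfaddE !vfscaleE; ring.
by rewrite lc_linr !vfaddE !vfscaleE vfD vf_leibniz; ring.
Qed.

Definition grad u := sharp D (fun X : vfield => X u).

Lemma form1M (al be : vfield -> smf) : form1 al -> form1 be ->
  Defs.bilinear (fun X Y => al X * be Y).
Proof. by move=> fa fb; split=> [Y u X X'|X u Y Y']; rewrite ?fa ?fb; ring. Qed.

Lemma contrD (B B' : bform C) : Defs.bilinear B -> Defs.bilinear B' ->
  contr D (fun X Y => B X Y + B' X Y) = contr D B + contr D B'.
Proof.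
move=> bB bB'; rewrite -[contr D B]mul1r -contr_linear //.
by apply: contr_ext => X Y; rewrite mul1r.
Qed.

Lemma bilinearD (B B' : bform C) : Defs.bilinear B -> Defs.bilinear B' ->
  Defs.bilinear (fun X Y => B X Y + B' X Y).
Proof.
move=> [l r] [l' r']; split=> [Y u X X'|X u Y Y'].
  by rewrite (l Y) (l' Y); ring.
by rewrite (r X) (r' X); ring.
Qed.

Lemma bilinearZ u (B : bform C) : Defs.bilinear B -> Defs.bilinear (fun X Y => u * B X Y).
Proof.
move=> [l r]; split=> [Y u' X X'|X u' Y Y'].
  by rewrite (l Y); ring.
by rewrite (r X); ring.
Qed.

Lemma contrZ u (B : bform C) : Defs.bilinear B -> contr D (fun X Y => u * B X Y) = u * contr D B.
Proof.
move=> bB; have b0 : Defs.bilinear (fun X Y : vfield => 0 : smf).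
  by split=> [Y u' X X'|X u' Y Y']; rewrite mulr0 addr0.
have c0 : contr D (fun X Y : vfield => 0 : smf) = 0.
  set c := contr D _; have E : c = c + c.
    by rewrite -contrD //; apply: contr_ext => X Y; rewrite addr0.
  by apply: (addrI c); rewrite -E addr0.
rewrite -[RHS]addr0 -c0 -contr_linear //.
by apply: contr_ext => X Y; rewrite addr0.
Qed.

Lemma contr_sum (I : Type) (r : seq I) (F : I -> bform C) : (forall i, Defs.bilinear (F i)) ->
  contr D (fun X Y => \sum_(i <- r) F i X Y) = \sum_(i <- r) contr D (F i).
Proof.
move=> bF.
have bS s : Defs.bilinear (fun X Y => \sum_(i <- s) F i X Y).
  split=> [Y u X X'|X u Y Y']; rewrite mulr_sumr -big_split; apply: eq_bigr => i _;
  by case: (bF i) => l r'; rewrite ?(l Y) ?(r' X).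
elim: r => [|i r IHr].
  rewrite big_nil -[RHS](mul0r (contr D (hess 0))) -contrZ; last exact: hess_bilinear.
  by apply: contr_ext => X Y; rewrite big_nil mul0r.
rewrite big_cons -IHr -contrD //.
by apply: contr_ext => X Y; rewrite big_cons.
Qed.

(** The two cross terms X u * nab Y v and nab X v * Y u have the same contraction by symmetry of the
    metric, whence the factor 2. *)
Lemma lapM u v t : multilin v ->
  lap (fun t => u * v t) t = u * lap v t + 2%:R * nab (grad u) v t + contr D (hess u) * v t.
Proof.
move=> mv; have fv := nab_form1 t mv; have fu := @form1_vf _ _ _ u.
have bh := hess_bilinear u; have b2 := nab2_bilinear t mv.
have b3 := form1M fu fv; have b4 := form1M fv fu.
have E : contr D (fun X Y => nab2 X Y (fun t => u * v t) t) =
   contr D (fun X Y => (u * nab2 X Y v t + v t * hess u X Y) +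
       (X u * nab Y v t + nab X v t * Y u)).
  apply: contr_ext => X Y; rewrite /nab2 /hess.
  have -> : nab Y (fun t => u * v t) = (fun t => Y u * v t + u * nab Y v t).
    by apply/funext => t'; rewrite nabM.
  by rewrite nab_comb !nabM; ring.
have := contrD (bilinearD (bilinearZ u b2) (bilinearZ (v t) bh)) (bilinearD b3 b4).
rewrite (contrD (bilinearZ u b2) (bilinearZ (v t) bh)) (contrD b3 b4).
rewrite (contrZ u b2) (contrZ (v t) bh) (contr_form1 D fu fv) (contr_form1 D fv fu).
rewrite (sharp_sym fu fv) -/(grad u) -/(lap v t) => EE.
by rewrite {1}/lap E EE; ring.
Qed.

End representatives.

Section sections.
Context {R : realType} {n : nat} {C : conformal R n.+1} {g : scale C} (D : metric_ops g).
Context {k : nat}.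
Local Notation smf := (smf C).
Local Notation vfield := (vfield C).
Local Notation tractor := (tractor C).
Local Notation raw := (('I_k -> tractor) -> smf).
Local Notation tens := (tens C k).
Implicit Types (X Y Z W : vfield) (u : smf) (a b : tractor) (t : 'I_k -> tractor).
Implicit Types (v : raw) (V : tens) (w : R).

Definition rep V : raw := fun t => V t g.
Definition unrep w v : tens := fun t => density_of g w (v t).

Lemma unrepK w v : rep (unrep w v) = v.
Proof. by apply/funext => t; exact: density_ofE. Qed.

Lemma unrep_density w v t : density w (unrep w v t).
Proof. exact: density_of_density. Qed.

Lemma tens_ext w V V' : (forall t, density w (V t)) -> (forall t, density w (V' t)) ->
  rep V = rep V' -> V = V'.
Proof.
move=> dV dV' E; apply/funext => t; apply: density_ext (dV t) (dV' t) _.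
exact: (congr1 (fun v : raw => v t) E).
Qed.

(** Passing to another scale multiplies all values by a common factor, so multilinearity in the
    scale g implies it in every scale. *)
Lemma is_tensorP w V : is_tensor w V <-> (forall t, density w (V t)) /\ multilin (rep V).
Proof.
split=> [[dV mV]|[dV mV]]; split=> //; first by move=> t i u a b; exact: mV.
move=> t i u a b h.
have [Om gh] := rescaling_ex g h; apply: smf_eqP => x.
have E : V [eta t with i |-> u *: a + b] g x =
    u x * V [eta t with i |-> a] g x + V [eta t with i |-> b] g x.
  exact: (congr1 (fun f : smf => f x) (mV t i u a b)).
rewrite -[RHS]/(u x * V [eta t with i |-> a] h x + V [eta t with i |-> b] h x).
by rewrite !(dV _ _ _ _ gh) E; ring.
Qed.

Lemma dmul_density w w' (f : scale C -> smf) V : density w f ->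
  (forall t, density w' (V t)) -> forall t, density (w + w') (dmul f V t).
Proof. by move=> df dV t; exact: densityM. Qed.

Lemma fmul_density w u V : (forall t, density w (V t)) -> forall t, density w (fmul u V t).
Proof. by move=> dV t; exact: densityMl. Qed.

Lemma addV_density w V V' : (forall t, density w (V t)) -> (forall t, density w (V' t)) ->
  forall t, density w ((V + V') t).
Proof. by move=> dV dV' t; exact: densityD. Qed.

Lemma rep_nabla w X V : rep (nabla D w X V) = nab D X (rep V).
Proof.
apply/funext => t; rewrite /rep /nabla /nab /nabla_density.
rewrite -[LHS]/(density_of g w (X (V t g)) g -
  (\sum_(i < k) V [eta t with i |-> nabla_tractor D X (t i)]) g).
by rewrite density_ofE fct_sumE.
Qed.

Lemma nabla_densityP w X V : (forall t, density w (V t)) -> forall t, density w (nabla D w X V t).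
Proof.
move=> dV t; apply: densityD; first exact: density_of_density.
by apply: densityN; exact: density_sum.
Qed.

Lemma rep_laplacian w V : rep (laplacian D w V) = lap D (rep V).
Proof.
apply/funext => t; rewrite /rep /laplacian density_ofE /lap; apply: contr_ext => X Y.
rewrite /nab2 -!(rep_nabla w) //.
Qed.

End sections.

Arguments rep {R n C} g {k} V _.
Arguments unrep {R n C} g {k} w v _.

(** * The scale tractor and the operator I.D on representatives *)

Section scale_tractor.
Context {R : realType} {n : nat} {C : conformal R n.+1} {g : scale C} (D : metric_ops g).
Implicit Types (sg : scale C -> smf C) (s : smf C).

Definition rho_I s : smf C :=
  (- n.+1%:R^-1)%:S * (contr D (hess D s) + schoutenJ D * s).

Lemma scale_tractorE sg :
  scale_tractor D sg g = (sg g, fun X : vfield C => X (sg g), rho_I (sg g)) :> triple C.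
Proof.
pose e := fun _ : 'I_0 => 0 : tractor C.
pose sg0 : tens C 0 := fun _ => sg.
have n0 : n.+1%:R != 0 :> R by rewrite pnatr_eq0.
have nabE X (s : smf C) : nab D X (fun _ : 'I_0 -> tractor C => s) = fun _ => X s.
  by apply/funext => t; rewrite /nab big_ord0 subr0.
have E : (n.+1%:R^-1%:S *: (((thomasD D 1 sg0).1.1 e g, fun X => (thomasD D 1 sg0).1.2 X e g,
    (thomasD D 1 sg0).2 e g) : triple C)) = (sg g, fun X : vfield C => X (sg g), rho_I (sg g)).
  (* At weight 1 the coefficient d + 2 w - 2 of the Thomas operator is d, which the factor 1/d in I
     cancels. *)
  have c1 : n.+1%:R + 2 * 1 - 2 = n.+1%:R :> R by ring.
  have inv (u : smf C) : n.+1%:R^-1%:S * (n.+1%:R%:S * u) = u.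
    by apply: smf_eqP => x; rewrite !smfM !smfcE mulKf.
  rewrite /thomasD c1; apply: triple_ext.
  - by rewrite -[LHS]/(n.+1%:R^-1%:S * ((n.+1%:R * 1)%:S * sg g)) mulr1 inv.
  - move=> X; rewrite -[LHS]/(n.+1%:R^-1%:S * (n.+1%:R%:S * (rep g (nabla D 1 X sg0) e))).
    by rewrite rep_nabla inv nabE.
  - rewrite -[LHS]/(n.+1%:R^-1%:S *
      - (rep g (laplacian D 1 sg0) e + 1%:S * (density_of g (-2) (schoutenJ D) g * sg g))).
    rewrite rep_laplacian density_ofE /rho_I /lap.
    have -> : contr D (fun X Y => nab2 D X Y (rep g sg0) e) = contr D (hess D (sg g)).
      by apply: contr_ext => X Y; rewrite /nab2 !nabE.
    apply: smf_eqP => x; rewrite !(smfM, smfD, smfN, smfcE); ring.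
rewrite /scale_tractor -/sg0 -/e E (tractor_ofE D) //.
Qed.

Definition I2 s : smf C := 2%:R * (s * rho_I s) + grad D s s.

Lemma IsqE sg : Isq D sg = I2 (sg g).
Proof.
rewrite /Isq /I2 scale_tractorE /tractor_metric /slot_sigma /slot_mu /slot_rho /=.
by rewrite -/(grad D (sg g)); ring.
Qed.

Context {k : nat}.
Implicit Types (v : ('I_k -> tractor C) -> smf C) (w : R).

Definition IDrep s w v : ('I_k -> tractor C) -> smf C := fun t =>
  let c := n.+1%:R + 2 * w - 2 in
  s * - (lap D v t + w%:S * (schoutenJ D * v t)) + rho_I s * ((c * w)%:S * v t)
  + c%:S * nab D (grad D s) v t.

Lemma rep_IdotD sg w (V : tens C k) : rep g (IdotD D sg w V) = IDrep (sg g) w (rep g V).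
Proof.
apply/funext => t; rewrite /rep /IdotD density_ofE scale_tractorE /slot_sigma /slot_mu /slot_rho /=.
set c := _ + _ - _; rewrite -/(grad D (sg g)).
rewrite -[LHS]/(sg g * - (rep g (laplacian D w V) t + w%:S * (density_of g (-2) (schoutenJ D) g * V t g))
   + rho_I (sg g) * ((c * w)%:S * V t g) + c%:S * rep g (nabla D w (grad D (sg g)) V) t).
by rewrite rep_laplacian rep_nabla density_ofE.
Qed.

Lemma IdotD_density sg w (V : tens C k) t : density (w - 1) (IdotD D sg w V t).
Proof. exact: density_of_density. Qed.

Lemma smf_cstD (a b : R) : (a + b)%:S = a%:S + b%:S :> smf C.
Proof. exact: val_inj. Qed.
Lemma smf_cstM (a b : R) : (a * b)%:S = a%:S * b%:S :> smf C.
Proof. exact: val_inj. Qed.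
Lemma smf_cstN (a : R) : (- a)%:S = - a%:S :> smf C.
Proof. exact: val_inj. Qed.
Lemma smf_cst1 : 1%:S = 1 :> smf C.
Proof. exact: val_inj. Qed.
Lemma smf_cst_nat m : (m%:R)%:S = m%:R :> smf C.
Proof.
elim: m => [|m IHm]; first exact: val_inj.
by rewrite -natr1 smf_cstD IHm smf_cst1 natr1.
Qed.

Lemma IDrep_multilin s w v : multilin v -> multilin (IDrep s w v).
Proof.
move=> mv t i u a b; rewrite /IDrep (lap_multilin D mv) (nab_multilin D _ mv) mv; ring.
Qed.

Lemma IDrep_comb s w (r : R) v v' : multilin v -> multilin v' ->
  IDrep s w (fun t => r%:S * v t + v' t) = fun t => r%:S * IDrep s w v t + IDrep s w v' t.
Proof.
move=> mv mv'; apply/funext => t; rewrite /IDrep.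
have mrv : multilin (fun t => r%:S * v t) by move=> z i u a b; rewrite mv; ring.
rewrite lapD // nab_comb lapM // vf_cst mul0r add0r.
have g0 : grad D (r%:S) = sharp D (fun X : vfield C => 0).
  by rewrite /grad; congr sharp; apply/funext => X; rewrite vf_cst.
have f0 : form1 (fun X : vfield C => 0 : smf C) by move=> u X Y; rewrite mulr0 addr0.
have n0 : nab D (grad D (r%:S)) v t = 0.
  (* The pairing is turned around so that the zero form is evaluated on a vector field. *)
  by rewrite g0 (sharp_sym (nab_form1 D t mv) f0).
have h0 : contr D (hess D (r%:S)) = 0.
  have bh := @hess_bilinear _ _ _ _ D 0.
  rewrite -(mul0r (contr D (hess D 0))) -contrZ //; apply: contr_ext => X Y.
  by rewrite mul0r /hess !vf_cst vf0 subrr.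
rewrite n0 h0; ring.
Qed.

(** The product rule brings in the part |ds|^2 of I^2 and the Laplacian of s. The latter is -d rho -
    J s by definition of the bottom slot rho of I: its first term completes the part 2 s rho of I^2,
    and its second adjusts the J term to the weight w - 1. *)
Lemma IDrep_sigma s w v t : multilin v ->
  IDrep s w (fun t => s * v t) t =
  s * IDrep s (w - 1) v t + (n.+1%:R + 2 * (w - 1))%:S * (I2 s * v t).
Proof.
move=> mv; rewrite /IDrep lapM // nabM /I2.
set L := lap D v t; set N := nab D _ v t; set vt := v t; set J := schoutenJ D.
set gs := grad D s s.
have H : contr D (hess D s) = - (n.+1%:R%:S * rho_I s) - J * s.
  rewrite /rho_I -/J; apply: smf_eqP => x.
  rewrite !(smfM, smfD, smfN, smfcE); have n0 : n.+1%:R != 0 :> R by rewrite pnatr_eq0.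
  by rewrite mulNr mulrN opprK mulrA mulfV // mul1r addrK.
rewrite H; move: (rho_I s) => rho.
rewrite !(smf_cstD, smf_cstM, smf_cstN, smf_cst1, smf_cst_nat).
move: (w%:S) => W; ring.
Qed.

End scale_tractor.

(** * Sections of a tractor bundle *)

Section bundle.
Context {R : realType} {n : nat} {C : conformal R n.+1} {g : scale C} (D : metric_ops g).
Context {k : nat} (Phi : set (tens C k)) (hPhi : tractor_bundle D Phi).
Local Notation smf := (smf C).
Local Notation vfield := (vfield C).
Local Notation tractor := (tractor C).
Local Notation raw := (('I_k -> tractor) -> smf).
Implicit Types (X Y Z : vfield) (u : smf) (v : raw) (V : tens C k) (w : R).

(** Multiplying by a power of sigma_g changes the weight but not the representative in g, so one
    predicate on representatives serves all weights. *)
Definition in_bundle v : Prop := Phi (unrep g 0 v).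

Lemma in_bundle_multilin v : in_bundle v -> multilin v.
Proof.
case: (hPhi) => -[pi [_ _ _ PhiE]] _; rewrite /in_bundle PhiE => -[/(is_tensorP (g := g))[_ mv] _].
by rewrite unrepK in mv.
Qed.

Lemma bundle_sectionP w V :
  bundle_section g Phi w V <-> (forall t, density w (V t)) /\ in_bundle (rep g V).
Proof.
split=> [[/(is_tensorP (g := g))[dV _] SV]|[dV SV]]; first by split.
split=> //; apply/(is_tensorP (g := g)); split=> //.
exact: in_bundle_multilin SV.
Qed.

Lemma unrep_comb u v v' :
  unrep g 0 (fun t => u * v t + v' t) = fmul u (unrep g 0 v) + unrep g 0 v'.
Proof.
apply: (tens_ext (g := g) (w := 0)); first exact: unrep_density.
  by apply: addV_density; [apply: fmul_density => t|]; exact: unrep_density.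
rewrite unrepK; apply/funext => t.
by rewrite /rep -[RHS]/(u * rep g (unrep g 0 v) t + rep g (unrep g 0 v') t) !unrepK.
Qed.

Lemma unrep_tensor v : multilin v -> is_tensor 0 (unrep g 0 v).
Proof.
move=> mv; apply/(is_tensorP (g := g)); split; first exact: unrep_density.
by rewrite unrepK.
Qed.

Lemma bundle_projection : exists pr : raw -> raw,
  (forall v, in_bundle v <-> multilin v /\ pr v = v) /\
  (forall u v v', multilin v -> multilin v' ->
    pr (fun t => u * v t + v' t) = fun t => u * pr v t + pr v' t).
Proof.
case: (hPhi) => -[pi [pT pL _ PhiE]] _.
exists (fun v => rep g (pi (unrep g 0 v))); split=> [v|u v v' mv mv'].
  rewrite /in_bundle PhiE /=; split=> [[/(is_tensorP (g := g))[_]]|[mv pv]].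
    by rewrite unrepK => mv ->; rewrite unrepK.
  split; first exact: unrep_tensor.
  have [dp _] := pT _ (unrep_tensor mv).
  apply: (tens_ext (g := g) dp (unrep_density (g := g) 0 v)).
  by rewrite pv unrepK.
by rewrite unrep_comb pL //; exact: unrep_tensor.
Qed.

Lemma in_bundle_comb u v v' : in_bundle v -> in_bundle v' ->
  in_bundle (fun t => u * v t + v' t).
Proof.
have [pr [iB pL]] := bundle_projection; move=> /iB[mv pv] /iB[mv' pv'].
by apply/iB; split; [exact: multilin_comb|rewrite pL // pv pv'].
Qed.

Lemma in_bundle0 : in_bundle (fun _ => 0).
Proof.
have [pr [iB pL]] := bundle_projection.
have m0 : multilin (fun _ : 'I_k -> tractor => 0 : smf) by move=> t i u a b; rewrite mulr0 addr0.
apply/iB; split=> //.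
have E : (fun _ : 'I_k -> tractor => 1 * 0 + 0 : smf) = (fun _ => 0).
  by apply/funext => t; rewrite mulr0 addr0.
have := pL 1 _ _ m0 m0; rewrite E => P; apply/funext => t.
by apply: (addrI (pr (fun _ => 0) t)); rewrite addr0 {3}P mul1r.
Qed.

Lemma in_bundleZ u v : in_bundle v -> in_bundle (fun t => u * v t).
Proof.
move=> bv; have := in_bundle_comb u bv in_bundle0.
by congr in_bundle; apply/funext => t; rewrite addr0.
Qed.

Lemma in_bundleD v v' : in_bundle v -> in_bundle v' -> in_bundle (fun t => v t + v' t).
Proof.
move=> bv bv'; have := in_bundle_comb 1 bv bv'.
by congr in_bundle; apply/funext => t; rewrite mul1r.
Qed.

Lemma in_bundle_sum (I : Type) (r : seq I) (F : I -> raw) :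
  (forall i, in_bundle (F i)) -> in_bundle (fun t => \sum_(i <- r) F i t).
Proof.
move=> bF; elim: r => [|i r IHr].
  by have := in_bundle0; congr in_bundle; apply/funext => t; rewrite big_nil.
have := in_bundleD (bF i) IHr.
by congr in_bundle; apply/funext => t; rewrite big_cons.
Qed.

(** The projection is C^oo-linear, so s pr(v) = pr(s v) = s v, and s cancels. Multilinearity of v
    follows by the same cancellation. *)
Lemma in_bundle_cancel s v : (forall a b : smf, s * a = s * b -> a = b) ->
  in_bundle (fun t => s * v t) -> in_bundle v.
Proof.
have [pr [iB pL]] := bundle_projection; move=> sI /iB[msv psv].
have mv : multilin v.
  move=> t i u a b; apply: sI; rewrite msv; ring.
have m0 := in_bundle_multilin in_bundle0.
apply/iB; split=> //; apply/funext => t; apply: sI.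
have [_ pr0] := (iB _).1 in_bundle0.
have := pL s _ _ mv m0; rewrite pr0 => E.
transitivity (pr (fun t => s * v t) t); last by rewrite psv.
have -> : (fun t => s * v t) = (fun t => s * v t + 0) by apply/funext => z; rewrite addr0.
by rewrite E addr0.
Qed.

Lemma in_bundle_nab X v : in_bundle v -> in_bundle (nab D X v).
Proof.
case: (hPhi) => _ hnab bv; have := hnab X _ bv; congr Phi.
apply: (tens_ext (g := g) (w := 0)).
- by apply: nabla_densityP => t; exact: unrep_density.
- exact: unrep_density.
- by rewrite rep_nabla !unrepK.
Qed.

Lemma in_bundle_nab2 X Y v : in_bundle v -> in_bundle (nab2 D X Y v).
Proof.
move=> bv; have := in_bundle_comb (-1) (in_bundle_nab (lc D X Y) bv) (in_bundle_nab X (in_bundle_nab Y bv)).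
by congr in_bundle; apply/funext => t; rewrite /nab2 mulN1r addrC.
Qed.

(* A local frame writes a multiple of the Laplacian as a finite combination of
   second derivatives, so that the projection onto the bundle fixes it. *)
Lemma in_bundle_lap v : in_bundle v -> in_bundle (lap D v).
Proof.
move=> bv; have [pr [iB pL]] := bundle_projection.
have mv := in_bundle_multilin bv.
have ml := lap_multilin D mv; apply/iB; split=> //.
apply/funext => t; apply: smf_eqP => x.
have [chi [theta [E [chi0 fth chiE]]]] := local_frame x.
(* One factor chi for each slot of the second derivative. The contraction then falls on the products
   of the forms theta and only produces coefficient functions. *)
have cE t' : chi ^+ 2 * lap D v t' =
    \sum_(i < n.+1) \sum_(j < n.+1) (theta i (sharp D (theta j))) * nab2 D (E i) (E j) v t'.
  have b2 := nab2_bilinear D t' mv; have [bl br] := b2.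
  have bt i j : Defs.bilinear (fun X Y => nab2 D (E i) (E j) v t' * (theta i X * theta j Y)).
    by apply: bilinearZ; exact: form1M.
  transitivity (contr D (fun X Y => \sum_(i < n.+1) \sum_(j < n.+1)
       nab2 D (E i) (E j) v t' * (theta i X * theta j Y))).
    rewrite /lap -contrZ //; apply: contr_ext => X Y.
    have fl Z : form1 (fun X => nab2 D X Z v t') by exact: bl.
    have fr Z : form1 (fun Y => nab2 D Z Y v t') by exact: br.
    rewrite expr2 -mulrA -(form1Z _ _ (fr X)) -(form1Z _ _ (fl _)) !chiE.
    rewrite (form1_sum _ _ (fl _)); apply: eq_bigr => i _.
    rewrite (form1Z _ _ (fl _)) (form1_sum _ _ (fr _)) mulr_sumr; apply: eq_bigr => j _.
    by rewrite (form1Z _ _ (fr _)); ring.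
  have bts i : Defs.bilinear (fun X Y => \sum_(j < n.+1) nab2 D (E i) (E j) v t' * (theta i X * theta j Y)).
    split=> [Y u X X'|X u Y Y']; rewrite mulr_sumr -big_split; apply: eq_bigr => j _;
    by case: (bt i j) => l r; rewrite ?(l Y) ?(r X).
  rewrite contr_sum //; apply: eq_bigr => i _; rewrite contr_sum //; apply: eq_bigr => j _.
  by rewrite contrZ ?contr_form1 //; [rewrite mulrC|exact: form1M].
have bc : in_bundle (fun t' => chi ^+ 2 * lap D v t').
  have -> : (fun t' => chi ^+ 2 * lap D v t') = (fun t' => \sum_(i < n.+1) \sum_(j < n.+1)
      (theta i (sharp D (theta j))) * nab2 D (E i) (E j) v t').
    by apply/funext => t'; exact: cE.
  apply: in_bundle_sum => i; apply: in_bundle_sum => j.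
  by apply: in_bundleZ; exact: in_bundle_nab2.
have [_ pc] := (iB _).1 bc; have [m0 pr0] := (iB _).1 in_bundle0.
have := pL (chi ^+ 2) _ _ ml m0; rewrite pr0.
have -> : (fun t' => chi ^+ 2 * lap D v t' + 0) = (fun t' => chi ^+ 2 * lap D v t').
  by apply/funext => z; rewrite addr0.
rewrite pc => /(congr1 (fun h : raw => h t)) Q.
have {}Q : chi ^+ 2 * lap D v t = chi ^+ 2 * pr (lap D v) t by rewrite [LHS]Q addr0.
(* The frame was chosen for the point x, so chi^2 is cancelled in the values at x. *)
have cx : (chi ^+ 2) x != 0 by rewrite smfX expf_neq0.
apply: (mulfI cx); exact: (congr1 (fun h : smf => h x) (esym Q)).
Qed.

Lemma in_bundle_IDrep s w v : in_bundle v -> in_bundle (IDrep D s w v).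
Proof.
move=> bv; set c := n.+1%:R + 2 * w - 2.
have b1 := in_bundleZ (- s) (in_bundle_comb (w%:S * schoutenJ D) bv (in_bundle_lap bv)).
have b2 := in_bundleZ (rho_I D s * (c * w)%:S) bv.
have b3 := in_bundleZ (c%:S) (in_bundle_nab (grad D s) bv).
have := in_bundleD (in_bundleD b1 b2) b3; congr in_bundle; apply/funext => t.
rewrite /IDrep -/c; ring.
Qed.

End bundle.

(** * The extension problem *)

Section obstruction.
Context {R : realType} {n : nat} {C : conformal R n.+1} {g : scale C} (D : metric_ops g).
Context {k : nat} (Phi : set (tens C k)) (hPhi : tractor_bundle D Phi).
Local Notation smf := (smf C).
Local Notation tractor := (tractor C).
Local Notation raw := (('I_k -> tractor) -> smf).
Local Notation inB := (in_bundle (g := g) Phi).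
Local Notation d := (n.+1%:R : R).
Implicit Types (u : smf) (v : raw) (w r : R).

Variables (s i2 : smf).
Hypothesis i2P : I2 D s * i2 = 1.

(** Each factor sigma lowers the weight of what remains by 1, so iterating [IDrep_sigma] adds up d +
    2 (w - 1 - i) for i from 0 to j; the sum is (j+1) (d + 2 w - 2 - j). *)
Lemma IDrep_sigmaX j w v t : multilin v ->
  IDrep D s w (fun t => s ^+ j.+1 * v t) t =
  s ^+ j.+1 * IDrep D s (w - j.+1%:R) v t
  + (j.+1%:R * (d + 2 * w - 2 - j%:R))%:S * (I2 D s * (s ^+ j * v t)).
Proof.
move=> mv; elim: j w t => [|j IHj] w t.
  rewrite expr1 IDrep_sigma // expr0 !mul1r; congr (_ + _ * _); congr smf_cst; ring.
have mX i : multilin (fun t => s ^+ i * v t) by move=> z i' u a b; rewrite mv; ring.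
have -> : (fun t => s ^+ j.+2 * v t) = (fun t => s * (s ^+ j.+1 * v t)).
  by apply/funext => z; rewrite [s ^+ j.+2]exprS mulrA.
rewrite IDrep_sigma // IHj.
have -> : w - 1 - j.+1%:R = w - j.+2%:R by rewrite -[j.+2%:R]natr1; ring.
set P := IDrep _ _ _ _ _.
have -> : (j.+2%:R * (d + 2 * w - 2 - j.+1%:R))%:S =
   (j.+1%:R * (d + 2 * (w - 1) - 2 - j%:R))%:S + (d + 2 * (w - 1))%:S :> smf.
  rewrite -smf_cstD; congr smf_cst.
  by rewrite -[j.+2%:R]natr1 -[j.+1%:R]natr1; ring.
by rewrite [s ^+ j.+2]exprS [s ^+ j.+1]exprS; ring.
Qed.

Definition obs1 w v : raw := fun t => - (i2 * IDrep D s w v t).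

Fixpoint obsrep m w v : raw :=
  if m is m'.+1 then obsrep m' (w - 1) (obs1 w v) else v.

Lemma in_bundle_obs1 w v : inB v -> inB (obs1 w v).
Proof.
move=> bv; have := in_bundleZ hPhi (- i2) (in_bundle_IDrep hPhi s w bv).
by congr in_bundle; apply/funext => t; rewrite mulNr.
Qed.

Lemma in_bundle_obsrep m w v : inB v -> inB (obsrep m w v).
Proof. by elim: m w v => //= m IHm w v bv; apply: IHm; exact: in_bundle_obs1. Qed.

Lemma obs1_multilin w v : multilin v -> multilin (obs1 w v).
Proof. by move=> mv t i u a b; rewrite /obs1 (IDrep_multilin D s w mv); ring. Qed.

Lemma obsrep_comb m w r v v' : multilin v -> multilin v' ->
  obsrep m w (fun t => r%:S * v t + v' t) = (fun t => r%:S * obsrep m w v t + obsrep m w v' t).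
Proof.
elim: m w v v' => //= m IHm w v v' mv mv'.
rewrite -IHm; [|exact: obs1_multilin..]; congr obsrep.
by apply/funext => t; rewrite /obs1 IDrep_comb //; ring.
Qed.

Lemma obs1_sigmaX j w v t : multilin v ->
  obs1 w (fun t => s ^+ j.+1 * v t) t =
  s ^+ j * (s * obs1 (w - j.+1%:R) v t + (- (j.+1%:R * (d + 2 * w - 2 - j%:R)))%:S * v t).
Proof.
move=> mv; rewrite /obs1 IDrep_sigmaX // smf_cstN exprS.
set P := IDrep _ _ _ _ _; set c := (_ * _)%:S.
have -> : i2 * (s * s ^+ j * P + c * (I2 D s * (s ^+ j * v t))) =
   i2 * (s * s ^+ j * P) + c * ((I2 D s * i2) * (s ^+ j * v t)) by ring.
rewrite i2P; ring.
Qed.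

(** The companion of [IDrep_sigmaX], with one sigma and a power of the operator, as in the
    commutation relations of sl2. Now the operators lower the weight, and the same arithmetic
    progression is summed. The coefficient of the lower power vanishes when m = d + 2 w - 2. *)
Lemma obsrep_sigma m w v : multilin v ->
  obsrep m.+1 w (fun t => s * v t) =
  (fun t => (- (m.+1%:R * (d + 2 * w - 2 - m%:R)))%:S * obsrep m (w - 1) v t
            + s * obsrep m.+1 (w - 1) v t).
Proof.
have E1 w' v' : multilin v' -> obs1 w' (fun t => s * v' t) =
    (fun t => (- (d + 2 * w' - 2))%:S * v' t + s * obs1 (w' - 1) v' t).
  move=> mv'; apply/funext => t.
  have -> : (fun t => s * v' t) = (fun t => s ^+ 1 * v' t) by apply/funext => z; rewrite expr1.
  by rewrite obs1_sigmaX // expr0 !mul1r addrC subr0.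
elim: m w v => [|m IHm] w v mv.
  by rewrite /= E1 //; apply/funext => t; rewrite mul1r subr0.
have m1 : multilin (obs1 (w - 1) v) by exact: obs1_multilin.
have ms : multilin (fun t => s * obs1 (w - 1) v t) by move=> z i u a b; rewrite m1; ring.
rewrite -[LHS]/(obsrep m.+1 (w - 1) (obs1 w (fun t => s * v t))) E1 // obsrep_comb // IHm //.
apply/funext => t.
rewrite -[obsrep m.+2 (w - 1) v t]/(obsrep m.+1 (w - 1 - 1) (obs1 (w - 1) v) t).
rewrite -[obsrep m (w - 1 - 1) _ t]/(obsrep m.+1 (w - 1) v t).
have -> : (- (m.+2%:R * (d + 2 * w - 2 - m.+1%:R)))%:S =
   (- (d + 2 * w - 2))%:S + (- (m.+1%:R * (d + 2 * (w - 1) - 2 - m%:R)))%:S :> smf.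
  rewrite -smf_cstD; congr smf_cst.
  by rewrite -[m.+2%:R]natr1 -[m.+1%:R]natr1; ring.
set a := (- (n.+1%:R + 2 * w - 2))%:S; set b := (- (m.+1%:R * _))%:S.
by rewrite addrA (mulrDl a b).
Qed.

(* The hypothesis on the weight keeps every factor produced by [obs1_sigmaX] away
   from zero. *)
Lemma obsrep_lead j w v : inB v -> d + 2 * w - 1 - j%:R < 0 ->
  exists2 K : R, K != 0 & exists2 v', inB v' &
    obsrep j w (fun t => s ^+ j * v t) = (fun t => K%:S * v t + s * v' t).
Proof.
elim: j w v => [|j IHj] w v bv wj.
  exists 1; first exact: oner_neq0; exists (fun _ => 0); first exact: (in_bundle0 hPhi).
  by apply/funext => t; rewrite /= expr0 mulr0 addr0 smf_cst1.
have mv := in_bundle_multilin hPhi bv.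
pose c := - (j.+1%:R * (d + 2 * w - 2 - j%:R)).
have wj' : d + 2 * w - 2 - j%:R < 0 by move: wj; rewrite -natr1; lra.
have c0 : c != 0 by rewrite oppr_eq0 mulf_neq0 ?pnatr_eq0 // lt_eqF.
(* One factor of the operator lowers the power of s by one and replaces the coefficient v by c v,
   modulo s. *)
pose v1 : raw := fun t => s * obs1 (w - j.+1%:R) v t + c%:S * v t.
have bo := in_bundle_obs1 (w - j.+1%:R) bv.
have b1 : inB v1 by exact: (in_bundle_comb hPhi s bo (in_bundleZ hPhi (c%:S) bv)).
(* Passing from (w, j + 1) to (w - 1, j) lowers the quantity d + 2 w - 1 - j by 1, so it stays
   negative. *)
have [|K K0 [v1' bv1' E]] := IHj (w - 1) v1 b1; first by lra.
exists (K * c); first by rewrite mulf_neq0.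
exists (fun t => K%:S * obs1 (w - j.+1%:R) v t + v1' t).
  exact: (in_bundle_comb hPhi).
rewrite /=; have -> : obs1 w (fun t => s ^+ j.+1 * v t) = (fun t => s ^+ j * v1 t).
  by apply/funext => t; rewrite obs1_sigmaX.
by rewrite E; apply/funext => t; rewrite /v1 smf_cstM; ring.
Qed.

End obstruction.

(** * Orders of vanishing in terms of representatives, and the theorem *)

Section extension.
Context {R : realType} {n : nat} {C : conformal R n.+1} {g : scale C} (D : metric_ops g).
Context {k : nat} (Phi : set (tens C k)) (hPhi : tractor_bundle D Phi).
Local Notation smf := (smf C).
Local Notation tractor := (tractor C).
Local Notation raw := (('I_k -> tractor) -> smf).
Local Notation inB := (in_bundle (g := g) Phi).
Implicit Types (u : smf) (v : raw) (w r : R) (V : tens C k) (sg : scale C -> smf).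

Lemma densityX sg m : density 1 sg -> density m%:R (sg ^+ m).
Proof.
move=> ds; elim: m => [|m IHm].
  by move=> h h' Om _ x; rewrite powRr0 mul1r.
by rewrite exprS -natr1 addrC; apply: densityM.
Qed.

Lemma dmul_rep (f : scale C -> smf) V : rep g (dmul f V) = (fun t => f g * rep g V t).
Proof. by []. Qed.

Lemma repD V V' : rep g (V + V') = (fun t => rep g V t + rep g V' t).
Proof. by []. Qed.

Lemma repB V V' : rep g (V - V') = (fun t => rep g V t - rep g V' t).
Proof. by []. Qed.

Lemma rep_dmulX sg m V : rep g (dmul (sg ^+ m) V) = (fun t => sg g ^+ m * rep g V t).
Proof. by rewrite dmul_rep exprfctE. Qed.

(** The quotient by sigma^m can be given the weight w - m that the definition asks for by choosing
    its representative in g, so divisibility becomes a statement about representatives. *)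
Lemma bigO_sigmaP sg w m V : density 1 sg -> (forall t, density w (V t)) ->
  bigO_sigma g sg Phi w m V <-> exists2 v, inB v & rep g V = (fun t => sg g ^+ m * v t).
Proof.
move=> ds dV; split=> [[U bU ->]|[v bv E]].
  have [_ b] := (bundle_sectionP hPhi _ _).1 bU.
  by exists (rep g U) => //; rewrite rep_dmulX.
exists (unrep g (w - m%:R) v).
  by apply/(bundle_sectionP hPhi); split; [exact: unrep_density|rewrite unrepK].
apply: (tens_ext (g := g) dV); last by rewrite E rep_dmulX unrepK.
move=> t; have := dmul_density (densityX m ds) (unrep_density (g := g) (w - m%:R) v) t.
by rewrite addrC subrK.
Qed.

Lemma rep_obstruction_op sg m w V :
  rep g (obstruction_op D sg m w V) =
  obsrep D (sg g) (smf_inv (I2 D (sg g))) m w (rep g V).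
Proof.
elim: m w V => [//|m IHm] w V /=; rewrite IHm; congr obsrep.
by apply/funext => t; rewrite /obs1 -rep_IdotD -IsqE.
Qed.

Lemma obstruction_op_density sg m w V : (forall t, density w (V t)) ->
  forall t, density (w - m%:R) (obstruction_op D sg m w V t).
Proof.
elim: m w V => [|m IHm] w V dV t; first by rewrite subr0; exact: dV.
rewrite /= -natr1 opprD [_ - 1]addrC addrA; apply: IHm => t'.
by apply: densityN; apply: densityMl; exact: IdotD_density.
Qed.

End extension.

Unset Implicit Arguments.
Theorem lemma9p8 (R : realType) (n : nat) (hn : (2 <= n)%N)
    (C : conformal R n.+1) (g : scale C) (D : metric_ops g)
    (sg : scale C -> smf C) (Sigma : set C)
    (hI : almost_pseudo_Riemannian D sg)
    (hsg : defining_density D sg Sigma)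
    (hI2 : forall x, Isq D sg x != 0)
    (k : nat) (Phi : set (tens C k)) (hPhi : tractor_bundle D Phi)
    (w0 : R) (l : nat) (f : nat -> tens C k)
    (hf : forall i, (i <= l)%N -> bundle_section g Phi (w0 - i%:R) (f i))
    (F : tens C k)
    (hF : bigO_sigma g sg Phi w0 l.+1
            (F - \sum_(i < l.+1) dmul (sg ^+ i) (f i)))
    (hsol : bigO_sigma g sg Phi (w0 - 1) l (IdotD D sg w0 F)) :
  let h0 := n.+1%:R + 2 * w0 in
  let extension u :=
    bundle_section g Phi (w0 - l.+1%:R) u /\
    bigO_sigma g sg Phi (w0 - 1) l.+1
      (IdotD D sg w0 (F + dmul (sg ^+ l.+1) u)) in
  (l%:R != h0 - 2 ->
    (exists u, extension u) /\
    (forall u v, extension u -> extension v ->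
      bigO_sigma g sg Phi w0 l.+2
        ((F + dmul (sg ^+ l.+1) u) - (F + dmul (sg ^+ l.+1) v)))) /\
  (l%:R = h0 - 2 ->
    tangential g sg Phi w0 (w0 - l.+1%:R) (obstruction_op D sg l.+1 w0) /\
    ((exists u, extension u) <->
     vanishes_on g Sigma (obstruction_op D sg l.+1 w0 (f 0%N)))).
Proof.
move=> h0 extension; pose s := sg g; have [ds _] := hI; have [SigmaE Sigma_reg] := hsg.
have s_reg x : s x = 0 -> dnonzero s x.
  move=> sx; have Sx : Sigma x by rewrite SigmaE.
  by have [] := Sigma_reg x Sx.
have sI := smf_cancel s_reg.
have sXI m a b : s ^+ m * a = s ^+ m * b -> a = b.
  elim: m a b => [|m IHm] a b; first by rewrite expr0 !mul1r.
  by rewrite exprS -!mulrA => /sI /IHm.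
pose i2 := smf_inv (I2 D s).
have i2P : I2 D s * i2 = 1.
  by apply: smf_invK => x; have := hI2 x; rewrite (IsqE D sg).
pose inB := in_bundle (g := g) Phi.
have bP w V := bundle_sectionP (g := g) hPhi w V.
have bf (i : 'I_l.+1) := (bP _ _).1 (hf i (ltn_ord i)).
case: hF => U /bP[dU bU] FE.
have {}FE : F = \sum_(i < l.+1) dmul (sg ^+ i) (f i) + dmul (sg ^+ l.+1) U.
  by rewrite -FE addrC subrK.
have dX (w : R) m (V : tens C k) : (forall t, density (w - m%:R) (V t)) ->
    forall t, density w (dmul (sg ^+ m) V t).
  move=> dV t; have := dmul_density (densityX m ds) dV t.
  by rewrite addrC subrK.
have dsum t : density w0 ((\sum_(i < l.+1) dmul (sg ^+ i) (f i)) t).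
  by rewrite fct_sumE; apply: density_sum => i; apply: dX; have [] := bf i.
have dF t : density w0 (F t) by rewrite FE; apply: densityD; [exact: dsum|exact: dX].
pose f0 := rep g (f 0%N).
have bf0 : inB f0 by have [] := bf ord0.
(* The remainder sigma^(l+1) U is included, so that F = f_0 + sigma W holds exactly. *)
pose W t : smf C := \sum_(i < l) s ^+ i * rep g (f i.+1) t + s ^+ l * rep g U t.
have bW : inB W.
  apply: (in_bundleD hPhi); last exact: (in_bundleZ hPhi).
  apply: (in_bundle_sum hPhi) => i; apply: (in_bundleZ hPhi).
  by have [] := bf (lift ord0 i).
have repF : rep g F = (fun t => s * W t + f0 t).
  apply/funext => t; rewrite FE /rep.
  rewrite -[LHS]/((\sum_(i < l.+1) dmul (sg ^+ i) (f i)) t g + (sg ^+ l.+1) g * U t g).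
  rewrite !fct_sumE big_ord_recl.
  have -> : dmul (sg ^+ (ord0 : 'I_l.+1)) (f (ord0 : 'I_l.+1)) t g = f0 t.
    by rewrite -[LHS]/((sg ^+ 0) g * f0 t) exprfctE expr0 mul1r.
  rewrite (eq_bigr (fun i : 'I_l => s * (s ^+ i * rep g (f i.+1) t))); last first.
    move=> i _; rewrite mulrA -exprS -[LHS]/((sg ^+ (lift ord0 i)) g * rep g (f i.+1) t).
    by rewrite exprfctE.
  have -> : (sg ^+ l.+1) g = s * s ^+ l by rewrite exprfctE exprS.
  rewrite -mulr_sumr /W -/(rep g U t).
  by set S := \sum_(_ < _) _; ring.
have bF : inB (rep g F) by rewrite repF; exact: (in_bundle_comb hPhi).
have mF := in_bundle_multilin hPhi bF.
have [E bE IF] : exists2 E, inB E & IDrep D s w0 (rep g F) = (fun t => s ^+ l * E t).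
  have := (bigO_sigmaP hPhi l ds (IdotD_density D sg w0 F)).1 hsol.
  by rewrite rep_IdotD.
pose c : R := l.+1%:R * (n.+1%:R + 2 * w0 - 2 - l%:R).
(* The term sigma^(l+1) I.D u of the commutator formula is already of the required order. Cancelling
   sigma^l leaves the condition that E + c I^2 u be sigma times a section of the bundle. *)
have extP u : extension u <-> [/\ forall t, density (w0 - l.+1%:R) (u t), inB (rep g u) &
    exists2 e, inB e & forall t, E t + c%:S * (I2 D s * rep g u t) = s * e t].
  have main : inB (rep g u) -> rep g (IdotD D sg w0 (F + dmul (sg ^+ l.+1) u)) =
      (fun t => s ^+ l * (E t + c%:S * (I2 D s * rep g u t) +
                          s * IDrep D s (w0 - l.+1%:R) (rep g u) t)).
    move=> bu; have mu := in_bundle_multilin hPhi bu.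
    have mX : multilin (fun t => s ^+ l.+1 * rep g u t) by move=> z i v a b; rewrite mu; ring.
    rewrite rep_IdotD repD rep_dmulX -/s.
    have -> : (fun t => rep g F t + s ^+ l.+1 * rep g u t) =
        (fun t => 1%:S * rep g F t + s ^+ l.+1 * rep g u t).
      by apply/funext => t; rewrite smf_cst1 mul1r.
    rewrite IDrep_comb // IF; apply/funext => t.
    by rewrite IDrep_sigmaX // -/c smf_cst1 exprS; ring.
  have bI := bigO_sigmaP hPhi l.+1 ds (IdotD_density D sg w0 (F + dmul (sg ^+ l.+1) u)).
  split=> [[/bP[du bu]]|[du bu [e be ee]]].
    move=> /bI[v bv]; rewrite main // => ve.
    split=> //; exists (fun t => (-1) * IDrep D s (w0 - l.+1%:R) (rep g u) t + v t).
      by apply: (in_bundle_comb hPhi) => //; exact: in_bundle_IDrep.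
    move=> t; have := congr1 (fun v => v t) ve; rewrite /= exprSr -mulrA => /sXI H.
    have {}H : E t + c%:S * (I2 D s * rep g u t) + s * IDrep D s (w0 - l.+1%:R) (rep g u) t
      = s * v t := H.
    by rewrite mulrDr -H; ring.
  split; first exact/bP.
  apply/bI.
  exists (fun t => e t + IDrep D s (w0 - l.+1%:R) (rep g u) t).
    by apply: (in_bundleD hPhi) => //; exact: in_bundle_IDrep.
  by rewrite main //; apply/funext => t; rewrite ee -/s [s ^+ l.+1]exprSr; ring.
split=> [lh0|lh0].
  have c0 : c != 0.
    rewrite mulf_neq0 ?pnatr_eq0 // -/h0 subr_eq0 eq_sym //.
  have cV (a : smf C) : c%:S * (c^-1%:S * a) = a.
    by rewrite mulrA -smf_cstM mulfV // smf_cst1 mul1r.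
  split.
    (* This choice solves E + c I^2 v = 0 identically, not only along Sigma. *)
    pose v t : smf C := - (c^-1%:S * i2) * E t.
    have bv : inB v by exact: (in_bundleZ hPhi).
    exists (unrep g (w0 - l.+1%:R) v); apply/extP; split; first exact: unrep_density.
      by rewrite unrepK.
    exists (fun _ => 0); first exact: (in_bundle0 hPhi).
    move=> t; rewrite unrepK /v mulr0.
    have -> : c%:S * (I2 D s * (- (c^-1%:S * i2) * E t)) =
      - (c%:S * (c^-1%:S * ((I2 D s * i2) * E t))) by ring.
    by rewrite cV i2P mul1r subrr.
  move=> u v /extP[du bu [e be ee]] /extP[dv bv [e' be' ee']].
  have dFX (V : tens C k) : (forall t, density (w0 - l.+1%:R) (V t)) ->
      forall t, density w0 ((F + dmul (sg ^+ l.+1) V) t).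
    by move=> dV; apply: addV_density => //; exact: dX.
  have dFF t : density w0 (((F + dmul (sg ^+ l.+1) u) - (F + dmul (sg ^+ l.+1) v)) t).
    by apply: densityD; [exact: dFX|apply: densityN; exact: dFX].
  apply/(bigO_sigmaP hPhi l.+2 ds dFF).
  (* Subtracting the conditions on u and v gives c I^2 (u - v) = sigma (e - e'), which is solved for
     u - v. *)
  pose v' t := (c^-1%:S * i2) * (e t + (-1) * e' t).
  exists v'.
    apply: (in_bundleZ hPhi); apply: (in_bundleD hPhi) => //; exact: (in_bundleZ hPhi).
  rewrite repB !repD !rep_dmulX -/s; apply/funext => t.
  have key : rep g u t - rep g v t = s * v' t.
    rewrite /v'; have -> : s * (c^-1%:S * i2 * (e t + -1 * e' t)) =
      c^-1%:S * i2 * (s * e t - s * e' t) by ring.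
    rewrite -ee -ee'.
    have -> : c^-1%:S * i2 * (E t + c%:S * (I2 D s * rep g u t) - (E t + c%:S * (I2 D s * rep g v t))) =
      c%:S * (c^-1%:S * ((I2 D s * i2) * (rep g u t - rep g v t))) by ring.
    by rewrite cV i2P mul1r.
  have -> : rep g F t + s ^+ l.+1 * rep g u t - (rep g F t + s ^+ l.+1 * rep g v t) =
    s ^+ l.+1 * (rep g u t - rep g v t) by ring.
  by rewrite key [s ^+ l.+2]exprSr mulrA.
have c0 : c = 0 by rewrite /c -/h0 lh0 subrr mulr0.
(* In [obsrep_sigma] with m = l and w = w0 the coefficient of the lower power is -c, which is zero
   here. *)
have tang (v : ('I_k -> tractor C) -> smf C) : multilin v ->
    obsrep D s i2 l.+1 w0 (fun t => s * v t) = (fun t => s * obsrep D s i2 l.+1 (w0 - 1) v t).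
  move=> mv; rewrite obsrep_sigma // -/c c0 oppr0; apply/funext => t.
  by rewrite (_ : 0%:S = 0) ?mul0r ?add0r //; exact: val_inj.
have repP m w V : rep g (obstruction_op D sg m w V) = obsrep D s i2 m w (rep g V).
  exact: rep_obstruction_op.
have wE : w0 - l.+1%:R - 1 = w0 - 1 - l.+1%:R by ring.
split.
  exists (obstruction_op D sg l.+1 (w0 - 1)); split.
  - move=> V /bP[dV bV]; apply/bP; split.
      by rewrite wE; exact: obstruction_op_density.
    by rewrite repP; exact: in_bundle_obsrep.
  - move=> a V V' /bP[dV bV] /bP[dV' bV'].
    have mV := in_bundle_multilin hPhi bV; have mV' := in_bundle_multilin hPhi bV'.
    have dP (V1 : tens C k) := @obstruction_op_density _ _ _ g D k sg l.+1 (w0 - 1) V1.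
    apply: (tens_ext (g := g) (w := w0 - 1 - l.+1%:R)).
    + by apply: dP; apply: addV_density => //; exact: fmul_density.
    + by apply: addV_density; [apply: fmul_density|]; exact: dP.
    rewrite repP -[rep g (rmul a V + V')]/(fun t => a%:S * rep g V t + rep g V' t).
    by rewrite obsrep_comb // -!repP.
  - move=> V /bP[dV bV]; have mV := in_bundle_multilin hPhi bV.
    have dsV t : density w0 (dmul sg V t).
      by have := dmul_density ds dV t; rewrite addrC subrK.
    apply: (tens_ext (g := g) (w := w0 - l.+1%:R)).
    + exact: obstruction_op_density.
    + move=> t; have dO := @obstruction_op_density _ _ _ g D k sg l.+1 _ _ dV.
      have := dmul_density ds dO t.
      by rewrite -wE addrC subrK.
    by rewrite dmul_rep !repP dmul_rep tang.
have mW := in_bundle_multilin hPhi bW; have mf0 := in_bundle_multilin hPhi bf0.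
(* The first factor of P_(l+1) sends F to sigma^l [E2]; the l factors that remain act at weights
   starting from w0 - 1 and are handled by [obsrep_lead]. *)
pose E2 t : smf C := - i2 * E t.
have bE2 : inB E2 by exact: (in_bundleZ hPhi).
(* For l = h0 - 2 the left-hand side equals -1. *)
have lead : n.+1%:R + 2 * (w0 - 1) - 1 - l%:R < 0 :> R.
  by rewrite lh0 /h0; lra.
have [K K0 [E3 bE3 E3E]] := @obsrep_lead _ _ _ _ D k Phi hPhi s i2 i2P l _ _ bE2 lead.
have obsF : obsrep D s i2 l.+1 w0 (rep g F) = (fun t => K%:S * E2 t + s * E3 t).
  rewrite -E3E /=; congr obsrep; apply/funext => t; rewrite /obs1 IF /E2; ring.
(* By tangentiality, replacing F = f_0 + s W by f_0 changes the result by a multiple of s. *)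
have obsf0 t : obsrep D s i2 l.+1 w0 f0 t =
    K%:S * E2 t + s * (E3 t - obsrep D s i2 l.+1 (w0 - 1) W t).
  have msW : multilin (fun t => s * W t) by move=> z i v a b; rewrite mW; ring.
  have := congr1 (fun v => v t) obsF.
  have -> : rep g F = (fun t => 1%:S * (s * W t) + f0 t).
    by rewrite repF; apply/funext => z; rewrite smf_cst1 mul1r.
  rewrite obsrep_comb // tang // smf_cst1 mul1r => OE.
  by apply: (addrI (s * obsrep D s i2 l.+1 (w0 - 1) W t)); rewrite OE; ring.
have i20 x : i2 x != 0.
  apply/eqP => i2x; have := congr1 (fun u : smf C => u x) i2P.
  rewrite /= -[LHS]/(I2 D s x * i2 x) i2x mulr0 => /eqP.
  by rewrite eq_sym (negPf (oner_neq0 R)).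
have opE t : obstruction_op D sg l.+1 w0 (f 0%N) t g = obsrep D s i2 l.+1 w0 f0 t.
  by rewrite /f0 -repP.
split=> [[u /extP[_ _ [e be ee]]] t x|van].
  rewrite SigmaE => sx.
  rewrite opE.
  have Ee : E t = s * e t.
    by rewrite -ee c0 (_ : 0%:S = 0) ?mul0r ?addr0 //; exact: val_inj.
  rewrite obsf0 /E2 Ee.
  have -> : K%:S * (- i2 * (s * e t)) + s * (E3 t - obsrep D s i2 l.+1 (w0 - 1) W t) =
    s * (K%:S * (- i2 * e t) + (E3 t - obsrep D s i2 l.+1 (w0 - 1) W t)) by ring.
  by rewrite smfM sx mul0r.
have E0 t x : s x = 0 -> E t x = 0.
  move=> sx; have Sx : Sigma x by rewrite SigmaE.
  have := van t x Sx.
  rewrite opE.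
  rewrite obsf0 /E2 smfD smfM smfcE [X in _ + X]smfM sx mul0r addr0 smfM smfN => /eqP.
  by rewrite mulf_eq0 (negPf K0) mulf_eq0 oppr_eq0 (negPf (i20 x)) /= => /eqP.
(* The quotient is chosen separately for each tuple of tractors; that the chosen functions form a
   section of the bundle is recovered at the end by cancelling s. *)
have divE t : exists q : smf C, E t = s * q.
  by apply: smf_divide => x sx; split; [exact: s_reg|exact: E0].
have [e eE] := choice divE.
(* As c = 0, the correction drops out of the condition, and u = 0 serves. *)
exists (unrep g (w0 - l.+1%:R) (fun _ => 0)); apply/extP; split.
- exact: unrep_density.
- by rewrite unrepK; exact: (in_bundle0 hPhi).
exists e; last by move=> t; rewrite unrepK mulr0 mulr0 addr0.
apply: (in_bundle_cancel hPhi sI).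
by have := bE; congr in_bundle; apply/funext => t.
Qed.
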